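(* There exist a real $\epsilon>0$ and an existential formula $\psi(y)$ of $\mathcal M$ containing a single existential quantifier such that, whenever $\langle P_d(y)\mid d\in\omega\rangle$ is a sequence of propositional formulas of $\mathcal M$ with $\mathbf M_d\models\forall y\,(\psi(y)\leftrightarrow P_d(y))$ for all $d\in\omega$, then for infinitely many $d\in\omega$ we have $\mathrm{depth}(P_d)\ge\epsilon(\log d)^{1/2}$.
   Context: $\omega=\{0,1,2,\dots\}$. $\mathcal M$ is the first-order language with equality (and no other relation symbols) with constant symbols $\mathbf 0,\mathbf 1,-\mathbf 1,\mathbf n$, unary function symbols $\mathcal N,\mathbf p$, and binary function symbols $+,\times,\div,\max,\min,\cap$. For $d\in\omega$ and $n=2^d$, $\mathbf M_d$ has universe $\{0,\dots,2^n-1\}$; $+,\times$ are modulo $2^n$; $\mathbf p(x)=\min\{2^x,2^n-1\}$; $\div(x,y)=\lfloor x/y\rfloor$ for $y\ne0$ and $0$ for $y=0$; constants $\mathbf 0,\mathbf 1,\mathbf n,-\mathbf 1$ denote $0,1,n,2^n-1$; $\max,\min$ usual; $\cap$ is bitwise AND and $\mathcal N$ is bitwise complement of $n$-bit binary representations. A propositional formula is a quantifier-free formula built from atomic formulas $t_1=t_2$ ($t_1,t_2$ terms) using boolean connectives. The depth of a propositional formula is the maximal number of nestings of function symbols and boolean operations together. Logarithms are base 2. *)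

(* Defs.v *)
From Stdlib Require Import Reals Arith Lia.

Definition variable := nat.

Inductive constant := c_zero | c_one | c_minus_one | c_n.
Inductive unary := f_compl | f_pow.
Inductive binary := f_add | f_mul | f_div | f_max | f_min | f_cap.

Inductive term :=
| Var (x : variable)
| Cst (c : constant)
| Un (f : unary) (t : term)
| Bin (f : binary) (t u : term).

Inductive formula :=
| Eq (t u : term)
| Not (a : formula)
| And (a b : formula)
| Or (a b : formula)
| Imp (a b : formula)
| Iff (a b : formula)
| All (x : variable) (a : formula)
| Ex (x : variable) (a : formula).

Fixpoint occurs (x : variable) (t : term) : Prop :=
  match t with
  | Var z => x = z
  | Cst _ => False
  | Un _ t => occurs x t
  | Bin _ t u => occurs x t \/ occurs x u
  end.

Fixpoint free_in (x : variable) (a : formula) : Prop :=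
  match a with
  | Eq t u => occurs x t \/ occurs x u
  | Not a => free_in x a
  | And a b | Or a b | Imp a b | Iff a b => free_in x a \/ free_in x b
  | All z a | Ex z a => x <> z /\ free_in x a
  end.

Definition only_free (y : variable) (a : formula) : Prop :=
  forall x, free_in x a -> x = y.

Fixpoint propositional (a : formula) : Prop :=
  match a with
  | Eq _ _ => True
  | Not a => propositional a
  | And a b | Or a b | Imp a b | Iff a b => propositional a /\ propositional b
  | All _ _ | Ex _ _ => False
  end.

Definition single_existential (a : formula) : Prop :=
  exists (x : variable) (b : formula), propositional b /\ a = Ex x b.

(** Variables and constant symbols have depth 0, and the equality sign of an
    atomic formula does not count. *)
Fixpoint term_depth (t : term) : nat :=
  match t with
  | Var _ | Cst _ => 0
  | Un _ t => S (term_depth t)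
  | Bin _ t u => S (Nat.max (term_depth t) (term_depth u))
  end.

(** Only used for propositional formulas; the values at quantified formulas are
    immaterial. *)
Fixpoint depth (a : formula) : nat :=
  match a with
  | Eq t u => Nat.max (term_depth t) (term_depth u)
  | Not a => S (depth a)
  | And a b | Or a b | Imp a b | Iff a b => S (Nat.max (depth a) (depth b))
  | All _ a | Ex _ a => depth a
  end.

Record structure := Structure {
  carrier :> Type;
  cst_i : constant -> carrier;
  un_i : unary -> carrier -> carrier;
  bin_i : binary -> carrier -> carrier -> carrier
}.

Fixpoint eval (S : structure) (rho : variable -> S) (t : term) : S :=
  match t with
  | Var x => rho x
  | Cst c => cst_i S c
  | Un f t => un_i S f (eval S rho t)
  | Bin f t u => bin_i S f (eval S rho t) (eval S rho u)
  end.

Definition update {A : Type} (rho : variable -> A) (x : variable) (v : A) :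
    variable -> A :=
  fun z => if Nat.eqb z x then v else rho z.

Fixpoint sat (S : structure) (rho : variable -> S) (a : formula) : Prop :=
  match a with
  | Eq t u => eval S rho t = eval S rho u
  | Not a => ~ sat S rho a
  | And a b => sat S rho a /\ sat S rho b
  | Or a b => sat S rho a \/ sat S rho b
  | Imp a b => sat S rho a -> sat S rho b
  | Iff a b => sat S rho a <-> sat S rho b
  | All x a => forall v : S, sat S (update rho x v) a
  | Ex x a => exists v : S, sat S (update rho x v) a
  end.

Definition models (S : structure) (a : formula) : Prop :=
  forall rho : variable -> S, sat S rho a.

Definition cst_nat (n : nat) (c : constant) : nat :=
  match c with
  | c_zero => 0
  | c_one => 1
  | c_minus_one => 2 ^ n - 1
  | c_n => n
  end.

(** For [x < 2 ^ n], [Nat.lnot x n] complements the [n]-bit representation. *)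
Definition un_nat (n : nat) (f : unary) (x : nat) : nat :=
  match f with
  | f_compl => Nat.lnot x n
  | f_pow => Nat.min (2 ^ x) (2 ^ n - 1)
  end.

Definition bin_nat (n : nat) (f : binary) (x y : nat) : nat :=
  match f with
  | f_add => (x + y) mod 2 ^ n
  | f_mul => (x * y) mod 2 ^ n
  | f_div => if Nat.eqb y 0 then 0 else x / y
  | f_max => Nat.max x y
  | f_min => Nat.min x y
  | f_cap => Nat.land x y
  end.

Lemma cst_nat_lt (d : nat) (c : constant) : cst_nat (2 ^ d) c < 2 ^ (2 ^ d).
Proof.
  assert (H : 2 ^ d < 2 ^ (2 ^ d)) by (apply Nat.pow_gt_lin_r; lia).
  assert (H' : 2 ^ d <> 0) by (apply Nat.pow_nonzero; lia).
  destruct c; simpl; lia.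
Qed.

Lemma un_nat_lt (n : nat) (f : unary) (x : nat) :
  x < 2 ^ n -> un_nat n f x < 2 ^ n.
Proof.
  intros Hx; destruct f; simpl.
  - destruct (Nat.eq_dec x 0) as [->|Hx0].
    + rewrite Nat.lnot_0_l, Nat.ones_equiv; lia.
    + rewrite Nat.lnot_sub_low, Nat.ones_equiv by (apply Nat.log2_lt_pow2; lia).
      lia.
  - lia.
Qed.

Lemma bin_nat_lt (n : nat) (f : binary) (x y : nat) :
  x < 2 ^ n -> y < 2 ^ n -> bin_nat n f x y < 2 ^ n.
Proof.
  intros Hx Hy; destruct f; simpl.
  - apply Nat.mod_upper_bound; lia.
  - apply Nat.mod_upper_bound; lia.
  - destruct (Nat.eqb_spec y 0) as [->|Hy0]; [lia|].
    apply Nat.le_lt_trans with x; [apply Nat.Div0.div_le_upper_bound; nia | lia].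
  - lia.
  - lia.
  - apply Nat.le_lt_trans with x; [apply Nat.land_le_l | lia].
Qed.

Definition universe (d : nat) : Type := {x : nat | x < 2 ^ (2 ^ d)}.

Definition M (d : nat) : structure := {|
  carrier := universe d;
  cst_i c := exist _ (cst_nat (2 ^ d) c) (cst_nat_lt d c);
  un_i f x := exist _ (un_nat (2 ^ d) f (proj1_sig x))
                (un_nat_lt (2 ^ d) f _ (proj2_sig x));
  bin_i f x y := exist _ (bin_nat (2 ^ d) f (proj1_sig x) (proj1_sig y))
                   (bin_nat_lt (2 ^ d) f _ _ (proj2_sig x) (proj2_sig y))
|}.

(** Equality in [M d], an equality of dependent pairs, is equality of numbers. *)
Lemma universe_eq (d : nat) (x y : universe d) :
  proj1_sig x = proj1_sig y -> x = y.
Proof.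
  destruct x as [x Hx], y as [y Hy]; simpl; intros <-.
  f_equal; apply Peano_dec.le_unique.
Qed.

Definition log2R (x : R) : R := (ln x / ln 2)%R.

(* Main.v *)
(** [psi] says that a system of quadratic equations, coded by its argument, has a
    solution. If every [psi] were equivalent to a propositional formula [P_d] of small
    depth, the negation of a solvable system would be solvable itself, with slightly
    longer unknowns: its truth value is computed by [P_d], and the graphs of the
    operations of [M_d] are solvability relations. So quantifiers could be eliminated
    again and again. Since only [O(log d)] eliminations are needed, this happens within
    the structures between [15/16 d] and [d].

    With alternating quantifiers over such short words one can describe the arithmetic
    of the exponentially longer numbers of [M_d] block by block, in boundedly many
    quantifier alternations per operation: sums and carries by guessing the run of an
    iteration, products by a discrete Fourier transform modulo [2^a + 1], quotients by
    a geometric series. Hence the truth of [P_d] itself becomes the solvability of a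
    system so small that its code is an argument of [psi] in [M_d], and the system that
    expresses the failure of [P_d] at the code given by [q] contradicts the equivalence of
    [psi] and [P_d] when [q] is a description of that very system. *)

Require Import Defs.
From Stdlib Require Import Reals Lra Arith Lia List Bool FunctionalExtensionality.
Import ListNotations.

(** * Sums and digits *)

(** The code of a system has [2 ^ d] bits, but it is a sum of few terms [2 ^ g] or [v_k * 2 ^ g]
    (type [lin]). This sparsity is used twice: a small system can compute the code from the inputs,
    so that solvability may be replaced by [P_d] of the code and then negated; and a short word can
    list the terms, which permits the final self-reference.

    An elimination multiplies the size of a system by about [2 ^ depth * d], and a system of size
    [K] with [L]-bit unknowns needs a code of about [L * K ^ 3] bits, so every elimination moves to
    a larger [d]. Two relations of one level are conjoined just one level up; hence the number of
    eliminations for [P_d] is proportional to its depth, not to its size. For depth at most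
    [x = log d] there are [O(x)] levels, each raising [d] by [O(x ^ 2)], and the total [O(x ^ 3)] is
    far below the available [d / 16]. The square root enters only through its comparison with [x].

    Division is shaped by the word length: an [n]-bit reciprocal cannot be guessed as one word, only
    a shorter approximation, which the series refines. *)

Fixpoint sum (n : nat) (f : nat -> nat) : nat :=
  match n with 0 => 0 | S n => sum n f + f n end.

Lemma sum_ext n f g : (forall i, i < n -> f i = g i) -> sum n f = sum n g.
Proof.
  induction n as [|n IH]; simpl; intros H; [easy|].
  rewrite IH, (H n) by auto; reflexivity.
Qed.

Lemma sum_0 n f : (forall i, i < n -> f i = 0) -> sum n f = 0.
Proof.
  induction n as [|n IH]; simpl; intros H; [easy|].
  rewrite IH, (H n) by auto; reflexivity.
Qed.

Lemma sum_add n f g : sum n (fun i => f i + g i) = sum n f + sum n g.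
Proof. induction n; simpl; lia. Qed.

Lemma sum_mul_l c n f : sum n (fun i => c * f i) = c * sum n f.
Proof. induction n; simpl; lia. Qed.

Lemma sum_mul_r c n f : sum n (fun i => f i * c) = sum n f * c.
Proof. induction n; simpl; lia. Qed.

Lemma sum_le n f g : (forall i, i < n -> f i <= g i) -> sum n f <= sum n g.
Proof.
  induction n as [|n IH]; simpl; intros H; [easy|].
  specialize (IH (fun i Hi => H i (Nat.lt_lt_succ_r _ _ Hi))).
  specialize (H n (Nat.lt_succ_diag_r n)); lia.
Qed.

Lemma sum_const n c : sum n (fun _ => c) = n * c.
Proof. induction n; simpl; lia. Qed.

Lemma sum_term_le n f i : i < n -> f i <= sum n f.
Proof.
  induction n as [|n IH]; simpl; intros H; [easy|].
  destruct (Nat.eq_dec i n) as [->|]; [lia|]. specialize (IH ltac:(lia)); lia.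
Qed.

Lemma sum_swap n k (f : nat -> nat -> nat) :
  sum n (fun i => sum k (f i)) = sum k (fun j => sum n (fun i => f i j)).
Proof.
  induction n as [|n IH]; simpl.
  - symmetry; apply sum_0; auto.
  - rewrite IH, <- sum_add; reflexivity.
Qed.

Lemma sum_split n k f : sum (n + k) f = sum n f + sum k (fun i => f (n + i)).
Proof.
  induction k as [|k IH]; simpl; [now rewrite !Nat.add_0_r|].
  rewrite Nat.add_succ_r; simpl. rewrite IH; lia.
Qed.

Lemma sum_single n f i : i < n -> (forall j, j < n -> j <> i -> f j = 0) -> sum n f = f i.
Proof.
  induction n as [|n IH]; simpl; intros Hi H; [easy|].
  destruct (Nat.eq_dec i n) as [->|Hn].
  - rewrite sum_0; [lia|]. intros j Hj; apply H; lia.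
  - rewrite IH, (H n); auto; lia.
Qed.

Lemma pow2_pos n : 0 < 2 ^ n.
Proof. apply Nat.neq_0_lt_0, Nat.pow_nonzero; lia. Qed.

Lemma pow2_ne n : 2 ^ n <> 0.
Proof. apply Nat.pow_nonzero; lia. Qed.

Lemma pow2_le a b : a <= b -> 2 ^ a <= 2 ^ b.
Proof. apply Nat.pow_le_mono_r; lia. Qed.

Lemma pow2_lt a b : a < b -> 2 ^ a < 2 ^ b.
Proof. apply Nat.pow_lt_mono_r; lia. Qed.

Lemma pow2_gt n : n < 2 ^ n.
Proof. apply Nat.pow_gt_lin_r; lia. Qed.

Lemma lt_pow2_mul a b x y : x < 2 ^ a -> y < 2 ^ b -> x * y < 2 ^ (a + b).
Proof.
  intros Hx Hy; rewrite Nat.pow_add_r; pose proof (pow2_pos a); pose proof (pow2_pos b); nia.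
Qed.

Lemma lnot_low n x : x < 2 ^ n -> Nat.lnot x n = 2 ^ n - 1 - x.
Proof.
  intros Hx. destruct (Nat.eq_dec x 0) as [->|H0].
  - rewrite Nat.lnot_0_l, Nat.ones_equiv; lia.
  - rewrite Nat.lnot_sub_low, Nat.ones_equiv by (apply Nat.log2_lt_pow2; lia). lia.
Qed.

Definition dg (D x k : nat) : nat := (x / 2 ^ (D * k)) mod 2 ^ D.

Definition num (D K : nat) (f : nat -> nat) : nat := sum K (fun i => f i * 2 ^ (D * i)).

Lemma dg_lt D x k : dg D x k < 2 ^ D.
Proof. apply Nat.mod_upper_bound, pow2_ne. Qed.

Lemma dg_le D x k : dg D x k <= x.
Proof.
  unfold dg. etransitivity; [apply Nat.Div0.mod_le|]. apply Nat.Div0.div_le_upper_bound.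
  pose proof (pow2_pos (D * k)); nia.
Qed.

Lemma num_S D K f : num D (S K) f = num D K f + f K * 2 ^ (D * K).
Proof. reflexivity. Qed.

Lemma num_lt D K f : (forall i, i < K -> f i < 2 ^ D) -> num D K f < 2 ^ (D * K).
Proof.
  induction K as [|K IH]; intros H.
  - unfold num; simpl. rewrite Nat.mul_0_r; simpl; lia.
  - rewrite num_S. specialize (IH (fun i Hi => H i (Nat.lt_lt_succ_r _ _ Hi))).
    specialize (H K (Nat.lt_succ_diag_r K)).
    replace (D * S K) with (D + D * K) by lia. rewrite Nat.pow_add_r. nia.
Qed.

Lemma num_ext D K f g : (forall i, i < K -> f i = g i) -> num D K f = num D K g.
Proof. intros H; apply sum_ext; intros i Hi; now rewrite H. Qed.

Lemma dg_num D K f k : (forall i, i < K -> f i < 2 ^ D) -> k < K -> dg D (num D K f) k = f k.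
Proof.
  induction K as [|K IH]; intros H Hk; [easy|].
  assert (H' : forall i, i < K -> f i < 2 ^ D) by auto.
  rewrite num_S. unfold dg.
  destruct (Nat.eq_dec k K) as [->|Hn].
  - rewrite Nat.div_add by apply pow2_ne.
    rewrite Nat.div_small by now apply num_lt. apply Nat.mod_small; auto.
  - replace (D * K) with (D * (K - S k) + D + D * k) by nia.
    rewrite !Nat.pow_add_r.
    replace (f K * (2 ^ (D * (K - S k)) * 2 ^ D * 2 ^ (D * k)))
      with (f K * 2 ^ (D * (K - S k)) * 2 ^ D * 2 ^ (D * k)) by ring.
    rewrite Nat.div_add by apply pow2_ne.
    rewrite Nat.Div0.mod_add.
    apply (IH H'); lia.
Qed.

Lemma dg_num_ge D K f k : (forall i, i < K -> f i < 2 ^ D) -> K <= k -> dg D (num D K f) k = 0.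
Proof.
  intros H Hk. unfold dg. rewrite Nat.div_small; [apply Nat.Div0.mod_0_l|].
  apply Nat.lt_le_trans with (1 := num_lt D K f H). apply pow2_le; nia.
Qed.

Lemma dg_ge D K x k : x < 2 ^ (D * K) -> K <= k -> dg D x k = 0.
Proof.
  intros H Hk. unfold dg. rewrite Nat.div_small; [apply Nat.Div0.mod_0_l|].
  apply Nat.lt_le_trans with (1 := H). apply pow2_le; nia.
Qed.

Lemma num_dg_mod D K x : num D K (dg D x) = x mod 2 ^ (D * K).
Proof.
  induction K as [|K IH].
  - unfold num; simpl. rewrite Nat.mul_0_r; simpl. reflexivity.
  - rewrite num_S, IH. unfold dg.
    replace (D * S K) with (D * K + D) by lia. rewrite Nat.pow_add_r.
    rewrite Nat.Div0.mod_mul_r. ring.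
Qed.

Lemma num_dg D K x : x < 2 ^ (D * K) -> num D K (dg D x) = x.
Proof. intros H; rewrite num_dg_mod; now apply Nat.mod_small. Qed.

Lemma dg_shift D x k c : dg D (x / 2 ^ (D * c)) k = dg D x (c + k).
Proof.
  unfold dg. rewrite Nat.Div0.div_div, <- Nat.pow_add_r. do 3 f_equal. lia.
Qed.

Lemma dg_testbit D x k t : t < D -> Nat.testbit (dg D x k) t = Nat.testbit x (D * k + t).
Proof.
  intros Ht. unfold dg. rewrite <- Nat.land_ones, Nat.land_spec, Nat.ones_spec_low by lia.
  rewrite andb_true_r, <- Nat.shiftr_div_pow2, Nat.shiftr_spec by lia. f_equal; lia.
Qed.

Lemma dg_testbit_high D x k t : D <= t -> Nat.testbit (dg D x k) t = false.
Proof.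
  intros Ht. unfold dg. rewrite <- Nat.land_ones, Nat.land_spec, Nat.ones_spec_high by lia.
  apply andb_false_r.
Qed.

Lemma dg_land D x y k : dg D (Nat.land x y) k = Nat.land (dg D x k) (dg D y k).
Proof.
  apply Nat.bits_inj; intros t. rewrite Nat.land_spec.
  destruct (Nat.lt_ge_cases t D) as [H|H].
  - now rewrite !dg_testbit, Nat.land_spec by assumption.
  - now rewrite !dg_testbit_high by assumption.
Qed.

Lemma dg_ldiff D x y k : dg D (Nat.ldiff x y) k = Nat.ldiff (dg D x k) (dg D y k).
Proof.
  apply Nat.bits_inj; intros t. rewrite Nat.ldiff_spec.
  destruct (Nat.lt_ge_cases t D) as [H|H].
  - now rewrite !dg_testbit, Nat.ldiff_spec by assumption.
  - now rewrite !dg_testbit_high by assumption.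
Qed.

Lemma testbit_small n x t : x < 2 ^ n -> n <= t -> Nat.testbit x t = false.
Proof.
  intros Hx Ht. rewrite <- (Nat.mod_small x (2 ^ n)) by assumption.
  apply Nat.mod_pow2_bits_high; lia.
Qed.

Lemma land_lnot_ldiff n x u : x < 2 ^ n -> Nat.land x (Nat.lnot u n) = Nat.ldiff x u.
Proof.
  intros Hx. apply Nat.bits_inj; intros t. rewrite Nat.land_spec, Nat.ldiff_spec.
  destruct (Nat.lt_ge_cases t n) as [H|H].
  - now rewrite Nat.lnot_spec_low.
  - now rewrite (testbit_small n x t).
Qed.

Lemma dg_ext D K x y : x < 2 ^ (D * K) -> y < 2 ^ (D * K) ->
  (forall k, k < K -> dg D x k = dg D y k) -> x = y.
Proof.
  intros Hx Hy H. rewrite <- (num_dg D K x), <- (num_dg D K y) by assumption.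
  now apply num_ext.
Qed.

Lemma ldiff_ones_0 a L : Nat.ldiff a (2 ^ L - 1) = 0 <-> a < 2 ^ L.
Proof.
  replace (2 ^ L - 1) with (Nat.ones L) by (rewrite Nat.ones_equiv; lia).
  rewrite Nat.ldiff_ones_r, Nat.shiftl_mul_pow2, Nat.shiftr_div_pow2.
  pose proof (pow2_pos L). split; intros H'.
  - apply Nat.eq_mul_0 in H'. destruct H' as [H'|H']; [|lia].
    apply Nat.div_small_iff in H'; lia.
  - rewrite Nat.div_small; auto.
Qed.

Lemma mul_num D K c f : c * num D K f = num D K (fun i => c * f i).
Proof.
  unfold num. rewrite <- sum_mul_l. apply sum_ext; intros; ring.
Qed.

(** The test performed by [psi] on each half of the existential witness. *)
Lemma mask_check D V L n x : L < D -> 0 < V -> D * V <= n -> x < 2 ^ n ->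
  Nat.land x (Nat.lnot ((2 ^ L - 1) * num D V (fun i => Nat.b2n (negb (i =? 0)))) n) = 1 <->
  exists e, e 0 = 1 /\ (forall i, 0 < i < V -> e i < 2 ^ L) /\ x = num D V e.
Proof.
  intros HL HV Hn Hx. rewrite land_lnot_ldiff by assumption.
  pose proof (pow2_lt _ _ HL) as HLD. pose proof (pow2_pos L) as HL0.
  rewrite mul_num. set (mu := fun i => _).
  assert (Hmu : forall i, i < V -> mu i < 2 ^ D).
  { intros i _; unfold mu. destruct (i =? 0); simpl; lia. }
  assert (H1 : 1 < 2 ^ D) by lia.
  assert (E1 : 1 = num D V (fun i => Nat.b2n (i =? 0))).
  { unfold num. rewrite sum_single with (i := 0); [|assumption|].
    - rewrite Nat.mul_0_r; reflexivity.
    - intros [|j] _ Hj; [easy|reflexivity]. }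
  assert (H1d : forall i, i < V -> Nat.b2n (i =? 0) < 2 ^ D).
  { intros i _; destruct (i =? 0); simpl; lia. }
  split.
  - intros H.
    (* Shifting the equation right by [D * V] bits kills both the mask and the 1, so [x] has no bits
       beyond its [V] digits. *)
    assert (Hx' : x < 2 ^ (D * V)).
    { assert (Hs : Nat.shiftr (Nat.ldiff x (num D V mu)) (D * V) = Nat.shiftr 1 (D * V)) by now rewrite H.
      rewrite Nat.shiftr_ldiff in Hs. rewrite !Nat.shiftr_div_pow2 in Hs.
      rewrite (Nat.div_small (num D V mu)) in Hs by now apply num_lt.
      rewrite Nat.ldiff_0_r in Hs. rewrite (Nat.div_small 1) in Hs.
      - apply Nat.div_small_iff in Hs; [assumption|apply pow2_ne].
      - apply Nat.lt_le_trans with (1 := H1). apply pow2_le; nia. }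
    exists (dg D x). rewrite (num_dg D V x Hx').
    assert (Hd : forall k, k < V -> Nat.ldiff (dg D x k) (mu k) = Nat.b2n (k =? 0)).
    { intros k Hk. rewrite <- (dg_num D V mu k Hmu Hk), <- dg_ldiff, H, E1. now apply dg_num. }
    repeat split.
    + specialize (Hd 0 HV). unfold mu in Hd. simpl in Hd.
      rewrite Nat.mul_0_r, Nat.ldiff_0_r in Hd. exact Hd.
    + intros i [Hi HiV]. specialize (Hd i HiV). destruct i; [easy|].
      unfold mu in Hd. simpl negb in Hd. simpl Nat.b2n in Hd. rewrite Nat.mul_1_r in Hd.
      now apply ldiff_ones_0.
  - intros (e & He0 & He & ->).
    assert (HeD : forall i, i < V -> e i < 2 ^ D).
    { intros [|i] Hi; [lia|]. specialize (He (S i) ltac:(lia)); lia. }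
    apply (dg_ext D V).
    + apply Nat.le_lt_trans with (num D V e); [apply Nat.ldiff_le_l|now apply num_lt].
    + apply Nat.lt_le_trans with (1 := H1). apply pow2_le; nia.
    + intros k Hk. rewrite dg_ldiff, !dg_num by assumption.
      rewrite E1, dg_num by assumption. unfold mu. destruct k as [|k].
      * simpl. rewrite Nat.mul_0_r, Nat.ldiff_0_r. assumption.
      * simpl negb. simpl Nat.b2n. rewrite Nat.mul_1_r. apply ldiff_ones_0, He; lia.
Qed.

(** * The formula psi *)

Fixpoint neval (n : nat) (rho : variable -> nat) (t : term) : nat :=
  match t with
  | Var x => rho x
  | Cst c => cst_nat n c
  | Un f t => un_nat n f (neval n rho t)
  | Bin f t u => bin_nat n f (neval n rho t) (neval n rho u)
  end.

(** Boolean, so that a system can later compute the truth value as a number 0 or 1. The value at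
    quantified formulas is a default; only propositional formulas are evaluated. *)
Fixpoint fsb (n : nat) (rho : variable -> nat) (a : formula) : bool :=
  match a with
  | Eq t u => neval n rho t =? neval n rho u
  | Not a => negb (fsb n rho a)
  | And a b => fsb n rho a && fsb n rho b
  | Or a b => fsb n rho a || fsb n rho b
  | Imp a b => implb (fsb n rho a) (fsb n rho b)
  | Iff a b => Bool.eqb (fsb n rho a) (fsb n rho b)
  | All _ _ | Ex _ _ => false
  end.

Lemma eval_neval d rho t :
  proj1_sig (eval (M d) rho t) = neval (2 ^ d) (fun x => proj1_sig (rho x)) t.
Proof.
  induction t; simpl; congruence.
Qed.

Lemma neval_ext n rho rho' t : (forall x, rho x = rho' x) -> neval n rho t = neval n rho' t.
Proof. intros H; induction t; simpl; congruence. Qed.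

Lemma fsb_ext n rho rho' a : (forall x, rho x = rho' x) -> fsb n rho a = fsb n rho' a.
Proof.
  intros H; induction a; simpl; auto; try congruence.
  now rewrite !(neval_ext n rho rho').
Qed.

Lemma neval_lt d rho t : (forall x, rho x < 2 ^ 2 ^ d) -> neval (2 ^ d) rho t < 2 ^ 2 ^ d.
Proof.
  intros H; induction t as [x|c|f t IH|f t IHt u IHu]; simpl; auto.
  - apply cst_nat_lt.
  - now apply un_nat_lt.
  - now apply bin_nat_lt.
Qed.

Lemma sat_fsb d rho a : propositional a ->
  (sat (M d) rho a <-> fsb (2 ^ d) (fun x => proj1_sig (rho x)) a = true).
Proof.
  induction a; simpl; intros H; try tauto;
    try (specialize (IHa1 (proj1 H)); specialize (IHa2 (proj2 H))).
  - rewrite Nat.eqb_eq, <- !eval_neval. split; [now intros ->|apply universe_eq].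
  - specialize (IHa H). destruct (fsb _ _ a); simpl; intuition congruence.
  - rewrite andb_true_iff; tauto.
  - rewrite orb_true_iff; tauto.
  - destruct (fsb _ _ a1), (fsb _ _ a2); simpl; intuition congruence.
  - destruct (fsb _ _ a1), (fsb _ _ a2); simpl; intuition congruence.
Qed.

Fixpoint tnum (i : nat) : term :=
  match i with 0 => Cst c_zero | S i => Bin f_add (tnum i) (Cst c_one) end.

Definition tq : term := Bin f_div (Cst c_n) (tnum 16).
Definition tdec (t : term) : term := Bin f_add t (Cst c_minus_one).

(** The [i]-th of the sixteen [n / 16]-bit fields of [y]. *)
Definition tfield (y : variable) (i : nat) : term :=
  Bin f_cap (Bin f_div (Var y) (Un f_pow (Bin f_mul tq (tnum i)))) (tdec (Un f_pow tq)).

(** The witness packs two copies of the vector of unknowns: the low half with digits of [D] bits,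
    the high half with digits of [D * V] bits. Field 4 is [2 ^ (D * V)]. *)
Definition tleft (y : variable) : term := Bin f_cap (Var (S y)) (tdec (tfield y 4)).
Definition tright (y : variable) : term := Bin f_div (Var (S y)) (tfield y 4).
(** The product of the two halves has all products of two unknowns as its digits. Field 5 or 6 lists
    coefficients in reverse order, so that multiplying by it collects a linear combination of these
    products in one digit, which fields 7 and 8 cut out. *)
Definition tdigit (y : variable) (i : nat) : term :=
  Bin f_cap (Bin f_div (Bin f_mul (Bin f_mul (tleft y) (tright y)) (tfield y i)) (tfield y 7))
            (tdec (tfield y 8)).

(** The first two tests check that each half starts with 1 and has entries below [2 ^ L], where
    field 2 is [2 ^ L]. The third forbids odd bits in the marked unknowns: [(2 ^ L - 1) / 3 * 2] is
    [10...10] in binary. The last one tests all equations at once. *)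
Definition body (y : variable) : formula :=
  And (Eq (Bin f_cap (tleft y) (Un f_compl (Bin f_mul (tdec (tfield y 2)) (tfield y 0)))) (Cst c_one))
 (And (Eq (Bin f_cap (tright y) (Un f_compl (Bin f_mul (tdec (tfield y 2)) (tfield y 1)))) (Cst c_one))
 (And (Eq (Bin f_cap (tleft y)
            (Bin f_mul (Bin f_mul (Bin f_div (tdec (tfield y 2)) (tnum 3)) (tnum 2)) (tfield y 3)))
          (Cst c_zero))
      (Eq (tdigit y 5) (tdigit y 6)))).

Definition psi (y : variable) : formula := Ex (S y) (body y).

(** Variables other than the witness all receive [Y], in keeping with the constant assignments under
    which [P_d] is evaluated. *)
Definition two_env (y : variable) (Y x : nat) : variable -> nat :=
  fun z => if Nat.eqb z (S y) then x else Y.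

Definition psin (y : variable) (n Y : nat) : Prop :=
  exists x, x < 2 ^ n /\ fsb n (two_env y Y x) (body y) = true.

Lemma psi_single y : single_existential (psi y).
Proof. exists (S y), (body y). split; [|reflexivity]. simpl; tauto. Qed.

Lemma psi_only_free y : only_free y (psi y).
Proof.
  intros x H. unfold psi in H. destruct H as [Hx H]. revert H.
  unfold body, tdigit, tleft, tright, tfield, tdec, tq. cbn. intuition congruence.
Qed.

Lemma sat_psi d rho y (Y : M d) : (forall x, rho x = Y) ->
  (sat (M d) rho (psi y) <-> psin y (2 ^ d) (proj1_sig Y)).
Proof.
  intros Hr. unfold psi, psin. cbn [sat].
  assert (Hb : propositional (body y)) by (simpl; tauto).
  split.
  - intros [v Hv]. exists (proj1_sig v). split; [exact (proj2_sig v)|].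
    apply (sat_fsb d _ _ Hb) in Hv. rewrite <- Hv. apply fsb_ext. intros z.
    unfold update, two_env. destruct (Nat.eqb z (S y)); [reflexivity|now rewrite Hr].
  - intros (x & Hx & H). exists (exist _ x Hx). apply (sat_fsb d _ _ Hb).
    rewrite <- H. apply fsb_ext. intros z.
    unfold update, two_env. destruct (Nat.eqb z (S y)); [reflexivity|now rewrite Hr].
Qed.

Lemma neval_tnum n rho i : i < 2 ^ n -> neval n rho (tnum i) = i.
Proof.
  induction i as [|i IH]; intros H; [reflexivity|].
  simpl. rewrite IH by lia. rewrite Nat.mod_small; lia.
Qed.

Lemma neval_tdec n rho t : 1 <= neval n rho t < 2 ^ n -> neval n rho (tdec t) = neval n rho t - 1.
Proof.
  intros H. cbn [tdec neval bin_nat cst_nat].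
  replace (neval n rho t + (2 ^ n - 1)) with (neval n rho t - 1 + 1 * 2 ^ n) by lia.
  rewrite Nat.Div0.mod_add. apply Nat.mod_small; lia.
Qed.

Lemma pow_min a n : a < n -> Nat.min (2 ^ a) (2 ^ n - 1) = 2 ^ a.
Proof. intros H. pose proof (pow2_lt _ _ H). lia. Qed.

Section Body.
Variables (y : variable) (n q Y x : nat) (f : nat -> nat).
Hypothesis (Hn : n = 16 * q) (Hq : 2 <= q) (Hf : forall i, i < 9 -> f i < 2 ^ q).
Hypothesis HY : Y = num q 9 f.
Hypothesis (Hx : x < 2 ^ n).
Hypothesis (H2 : 1 <= f 2) (H4 : 1 <= f 4) (H7 : 1 <= f 7) (H8 : 1 <= f 8).

Let rho := two_env y Y x.

Lemma small_lt k : k <= 32 -> k < 2 ^ n.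
Proof. intros Hk. pose proof (pow2_gt n). lia. Qed.

Lemma neval_tq : neval n rho tq = q.
Proof.
  unfold tq. cbn [neval bin_nat cst_nat]. rewrite neval_tnum by (apply small_lt; lia).
  cbn [Nat.eqb]. subst n. rewrite Nat.mul_comm. apply Nat.div_mul; lia.
Qed.

Lemma neval_tfield i : i < 9 -> neval n rho (tfield y i) = f i.
Proof.
  intros Hi. unfold tfield. cbn [neval bin_nat].
  rewrite neval_tdec; cbn [neval un_nat bin_nat];
    rewrite !neval_tq, (pow_min q) by lia.
  2:{ split; [apply pow2_pos|apply pow2_lt; lia]. }
  rewrite neval_tnum by (apply small_lt; lia).
  rewrite (Nat.mod_small (q * i)) by (pose proof (pow2_gt n); nia).
  rewrite (pow_min (q * i)) by nia.
  destruct (Nat.eqb_spec (2 ^ (q * i)) 0) as [E|_]; [now apply pow2_ne in E|].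
  replace (rho y) with Y.
  2:{ unfold rho, two_env. destruct (Nat.eqb_spec y (S y)); [lia|reflexivity]. }
  replace (2 ^ q - 1) with (Nat.ones q) by (rewrite Nat.ones_equiv; lia).
  rewrite Nat.land_ones. change ((Y / 2 ^ (q * i)) mod 2 ^ q) with (dg q Y i).
  rewrite HY. now apply dg_num.
Qed.

Lemma field_lt i : i < 9 -> f i < 2 ^ n.
Proof. intros Hi. apply Nat.lt_le_trans with (1 := Hf i Hi). apply pow2_le; lia. Qed.

Lemma mul_small a b : a < 2 ^ q -> b < 2 ^ q -> a * b < 2 ^ n.
Proof.
  intros Ha Hb. apply Nat.lt_le_trans with (1 := lt_pow2_mul _ _ _ _ Ha Hb). apply pow2_le; lia.
Qed.

(** The masks are products of two [q]-bit numbers, so they are not truncated. The reductions modulo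
    [2 ^ n] survive only in the last clause, since the halves of an arbitrary [x] may be long. *)
Lemma body_spec : fsb n rho (body y) = true <->
  let XL := Nat.land x (f 4 - 1) in let XR := x / f 4 in
  Nat.land XL (Nat.lnot ((f 2 - 1) * f 0) n) = 1 /\
  Nat.land XR (Nat.lnot ((f 2 - 1) * f 1) n) = 1 /\
  Nat.land XL ((f 2 - 1) / 3 * 2 * f 3) = 0 /\
  Nat.land ((XL * XR mod 2 ^ n * f 5) mod 2 ^ n / f 7) (f 8 - 1) =
  Nat.land ((XL * XR mod 2 ^ n * f 6) mod 2 ^ n / f 7) (f 8 - 1).
Proof.
  assert (Fl := field_lt).
  assert (TL : neval n rho (tleft y) = Nat.land x (f 4 - 1)).
  { unfold tleft. cbn [neval bin_nat]. rewrite neval_tdec; rewrite neval_tfield by lia.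
    - unfold rho, two_env. now rewrite Nat.eqb_refl.
    - split; [assumption|apply Fl; lia]. }
  assert (TR : neval n rho (tright y) = x / f 4).
  { unfold tright. cbn [neval bin_nat]. rewrite neval_tfield by lia.
    destruct (Nat.eqb_spec (f 4) 0); [lia|].
    unfold rho, two_env. now rewrite Nat.eqb_refl. }
  assert (TD : forall i, i < 9 -> neval n rho (tdigit y i) =
    Nat.land ((Nat.land x (f 4 - 1) * (x / f 4) mod 2 ^ n * f i) mod 2 ^ n / f 7) (f 8 - 1)).
  { intros i Hi. unfold tdigit. cbn [neval bin_nat]. rewrite neval_tdec; rewrite !neval_tfield by lia.
    - rewrite TL, TR. destruct (Nat.eqb_spec (f 7) 0); [lia|]. reflexivity.
    - split; [assumption|apply Fl; lia]. }
  assert (T2 : neval n rho (tdec (tfield y 2)) = f 2 - 1).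
  { rewrite neval_tdec; rewrite neval_tfield by lia; [reflexivity|]. split; [assumption|apply Fl; lia]. }
  assert (B2 : f 2 - 1 < 2 ^ q) by (specialize (Hf 2 ltac:(lia)); lia).
  unfold body. cbn [fsb neval bin_nat un_nat cst_nat].
  rewrite !andb_true_iff, !Nat.eqb_eq, !TD, TL, TR, T2, !neval_tfield, !neval_tnum by (try apply small_lt; lia).
  rewrite !(Nat.mod_small ((f 2 - 1) * f _)) by (apply mul_small; [assumption|apply Hf; lia]).
  change (if 3 =? 0 then 0 else (f 2 - 1) / 3) with ((f 2 - 1) / 3).
  assert (B3 : (f 2 - 1) / 3 * 2 <= f 2 - 1).
  { pose proof (Nat.Div0.mul_div_le (f 2 - 1) 3). lia. }
  rewrite (Nat.mod_small ((f 2 - 1) / 3 * 2)) by (specialize (Fl 2 ltac:(lia)); lia).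
  rewrite (Nat.mod_small ((f 2 - 1) / 3 * 2 * f 3)) by (apply mul_small; [lia|apply Hf; lia]).
  reflexivity.
Qed.
End Body.

(** * Encoding quadratic systems *)

(** A linear form [sum 2^g + sum v_k 2^g] in the inputs [v]. *)
Definition lin := list (nat * option nat).

Definition oval (v : nat -> nat) (o : option nat) : nat :=
  match o with None => 1 | Some k => v k end.

Definition ev (v : nat -> nat) (l : lin) : nat :=
  list_sum (map (fun t => oval v (snd t) * 2 ^ fst t) l).

Definition lshift (s : nat) (l : lin) : lin := map (fun t => (fst t + s, snd t)) l.

Lemma list_sum_map_le {A} (f g : A -> nat) l :
  (forall a, In a l -> f a <= g a) -> list_sum (map f l) <= list_sum (map g l).
Proof.
  induction l as [|a l IH]; simpl; intros H; [lia|].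
  specialize (IH (fun b Hb => H b (or_intror Hb))). specialize (H a (or_introl eq_refl)). lia.
Qed.

Lemma list_sum_map_const {A} c (l : list A) : list_sum (map (fun _ => c) l) = length l * c.
Proof. induction l; simpl; lia. Qed.

Lemma list_sum_map_mul {A} c (f : A -> nat) l :
  list_sum (map (fun a => c * f a) l) = c * list_sum (map f l).
Proof. induction l; simpl; lia. Qed.

Lemma map_eq_in {A} (f g : A -> nat) l : map f l = map g l -> forall a, In a l -> f a = g a.
Proof.
  induction l as [|a l IH]; simpl; [easy|].
  intros H; injection H as Ha Hl. intros b [<-|Hb]; auto.
Qed.

Lemma ev_app v l k : ev v (l ++ k) = ev v l + ev v k.
Proof. unfold ev. now rewrite map_app, list_sum_app. Qed.

Lemma ev_shift v s l : ev v (lshift s l) = ev v l * 2 ^ s.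
Proof.
  unfold ev, lshift. rewrite map_map. induction l as [|t l IH]; simpl; [reflexivity|].
  simpl in IH. rewrite IH, Nat.pow_add_r. ring.
Qed.

Lemma ev_fields v q K (F : nat -> lin) :
  ev v (concat (map (fun i => lshift (q * i) (F i)) (seq 0 K))) = num q K (fun i => ev v (F i)).
Proof.
  induction K as [|K IH]; [reflexivity|].
  rewrite seq_S, map_app, concat_app, ev_app, IH, num_S. f_equal.
  simpl. now rewrite app_nil_r, ev_shift.
Qed.

Lemma ev_marks v D V p :
  ev v (map (fun i => (D * i, None)) (filter p (seq 0 V))) = num D V (fun i => Nat.b2n (p i)).
Proof.
  induction V as [|V IH]; [reflexivity|].
  rewrite seq_S, filter_app, map_app, ev_app, IH, num_S. f_equal.
  simpl. destruct (p V); unfold ev; simpl; lia.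
Qed.

(** [(c, k, o)] stands for [2^c * p_k], times an input when [o = Some _]. *)
Definition bmono := (nat * nat * option nat)%type.

Definition bval (p v : nat -> nat) (m : bmono) : nat :=
  let '(c, k, o) := m in oval v o * 2 ^ c * p k.

Definition bsum (p v : nat -> nat) (l : list bmono) : nat := list_sum (map (bval p v) l).

(** One sum holding all sides: the side number [t] becomes the digit [t] in base [2 ^ W], so that a
    single comparison tests every equation. *)
Fixpoint cof (W t : nat) (E : list (list bmono)) : list bmono :=
  match E with
  | [] => []
  | l :: E => map (fun m => let '(c, k, o) := m in (c + W * t, k, o)) l ++ cof W (S t) E
  end.

Fixpoint hv (W : nat) (A : list nat) : nat :=
  match A with [] => 0 | a :: A => a + 2 ^ W * hv W A end.

(** The order is reversed so that, after multiplication by [num D K p], every coefficient meets its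
    [p k] in the digit [K]. *)
Definition clist (D K : nat) (l : list bmono) : lin :=
  map (fun m => let '(c, k, o) := m in (c + D * (K - k), o)) l.

Lemma bsum_app p v l k : bsum p v (l ++ k) = bsum p v l + bsum p v k.
Proof. unfold bsum. now rewrite map_app, list_sum_app. Qed.

Lemma bsum_scale p v s l :
  bsum p v (map (fun m => let '(c, k, o) := m in (c + s, k, o)) l) = 2 ^ s * bsum p v l.
Proof.
  unfold bsum. rewrite map_map, <- list_sum_map_mul. f_equal. apply map_ext.
  intros [[c k] o]. simpl. rewrite Nat.pow_add_r. ring.
Qed.

Lemma bsum_cof p v W t E : bsum p v (cof W t E) = 2 ^ (W * t) * hv W (map (bsum p v) E).
Proof.
  revert t; induction E as [|l E IH]; intros t; cbn [cof map hv]; [unfold bsum; simpl; lia|].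
  rewrite bsum_app, bsum_scale, IH, Nat.mul_succ_r, Nat.pow_add_r. ring.
Qed.

Lemma hv_lt W A : (forall a, In a A -> a < 2 ^ W) -> hv W A < 2 ^ (W * length A).
Proof.
  induction A as [|a A IH]; simpl; intros H; [rewrite Nat.mul_0_r; simpl; lia|].
  specialize (IH (fun b Hb => H b (or_intror Hb))). specialize (H a (or_introl eq_refl)).
  rewrite Nat.mul_succ_r, Nat.add_comm, Nat.pow_add_r, Nat.add_comm. nia.
Qed.

Lemma hv_inj W A B : length A = length B -> (forall a, In a A -> a < 2 ^ W) ->
  (forall b, In b B -> b < 2 ^ W) -> hv W A = hv W B -> A = B.
Proof.
  revert B; induction A as [|a A IH]; intros [|b B]; simpl; intros HL HA HB H; try easy.
  assert (Ha := HA a (or_introl eq_refl)). assert (Hb := HB b (or_introl eq_refl)).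
  assert (a = b).
  { rewrite <- (Nat.mod_small a (2 ^ W)), <- (Nat.mod_small b (2 ^ W)) by assumption.
    rewrite <- (Nat.Div0.mod_add a (hv W A)), <- (Nat.Div0.mod_add b (hv W B)).
    f_equal. lia. }
  subst b. f_equal. apply IH; auto. apply (Nat.mul_cancel_l _ _ (2 ^ W) (pow2_ne W)). lia.
Qed.

Lemma bsum_le p v l cnt L P : length l <= cnt ->
  (forall c k o, In (c, k, o) l -> c <= L /\ oval v o <= 2 ^ L /\ p k <= 2 ^ P) ->
  bsum p v l <= cnt * 2 ^ (2 * L + P).
Proof.
  intros Hl H. etransitivity; [|apply Nat.mul_le_mono_r, Hl].
  rewrite <- list_sum_map_const. apply list_sum_map_le.
  intros [[c k] o] Hin. destruct (H c k o Hin) as (H1 & H2 & H3). cbn [bval].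
  replace (2 * L + P) with (L + L + P) by lia. rewrite !Nat.pow_add_r.
  apply Nat.mul_le_mono; [|assumption]. apply Nat.mul_le_mono; [assumption|now apply pow2_le].
Qed.

Lemma num_split D K p k : k < K ->
  exists hi, num D K p = num D k p + 2 ^ (D * k) * p k + 2 ^ (D * (k + 1)) * hi.
Proof.
  intros Hk. unfold num. replace K with (k + 1 + (K - k - 1)) by lia.
  rewrite sum_split. exists (sum (K - k - 1) (fun i => p (k + 1 + i) * 2 ^ (D * i))).
  rewrite <- sum_mul_l.
  rewrite (sum_ext _ (fun i => p (k + 1 + i) * 2 ^ (D * (k + 1 + i)))
    (fun i => 2 ^ (D * (k + 1)) * (p (k + 1 + i) * 2 ^ (D * i)))).
  - rewrite Nat.add_1_r. simpl. lia.
  - intros i _. rewrite (Nat.mul_add_distr_l D (k + 1) i), Nat.pow_add_r. ring.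
Qed.

(** All digits under the top one are together worth less than one unit of it. This bounds what a
    coefficient spills below the wanted digit in [digit_prod]. *)
Lemma num_low D p P k : P < D -> (forall i, i < k -> p i <= 2 ^ P) ->
  num D k p * 2 ^ D <= 2 ^ (P + 1) * 2 ^ (D * k).
Proof.
  intros HP Hp. destruct k as [|k]; [unfold num; simpl; lia|].
  assert (num D k p < 2 ^ (D * k)).
  { apply num_lt. intros i Hi. apply Nat.le_lt_trans with (2 ^ P); [apply Hp; lia|now apply pow2_lt]. }
  specialize (Hp k (Nat.lt_succ_diag_r k)).
  rewrite num_S. replace (D * S k) with (D * k + D) by lia. rewrite (Nat.pow_add_r 2 (D * k)).
  rewrite (Nat.pow_add_r 2 P 1), Nat.pow_1_r. pose proof (pow2_pos P).
  rewrite Nat.mul_assoc. apply Nat.mul_le_mono_r. nia.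
Qed.

(** A convolution: the coefficient of [p k] sits at position [K - k]. The bound on the total mass of
    the coefficients keeps everything below the digit [K] under [2 ^ (D * K)] and the digit itself
    under [2 ^ D], so that no carry enters or leaves it. *)
Lemma digit_prod D K p v C P : P < D -> (forall i, i < K -> p i <= 2 ^ P) ->
  (forall c k o, In (c, k, o) C -> k < K) ->
  bsum (fun _ => 1) v C * 2 ^ (P + 1) < 2 ^ D ->
  dg D (num D K p * ev v (clist D K C)) K = bsum p v C.
Proof.
  intros HP Hp HC HB.
  assert (Hex : exists Lo Hi,
    num D K p * ev v (clist D K C) = Lo + 2 ^ (D * K) * bsum p v C + 2 ^ (D * K) * 2 ^ D * Hi /\
    Lo * 2 ^ D <= bsum (fun _ => 1) v C * 2 ^ (P + 1) * 2 ^ (D * K) /\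
    bsum p v C <= bsum (fun _ => 1) v C * 2 ^ P).
  { clear HB. induction C as [|[[c k] o] C IH].
    - exists 0, 0. unfold ev, bsum. simpl. lia.
    - destruct IH as (Lo & Hi & E & HLo & Hb).
      { intros c' k' o' Hin; apply (HC c' k' o'); now right. }
      assert (Hk : k < K) by (apply (HC c k o); now left).
      destruct (num_split D K p k Hk) as [hi Hs].
      set (a := oval v o * 2 ^ c).
      assert (Hl := num_low D p P k HP (fun i Hi' => Hp i (Nat.lt_trans _ _ _ Hi' Hk))).
      assert (E1 : ev v (clist D K ((c, k, o) :: C)) = a * 2 ^ (D * (K - k)) + ev v (clist D K C)).
      { unfold ev, clist; simpl. rewrite Nat.pow_add_r. unfold a; ring. }
      assert (E2 : bsum p v ((c, k, o) :: C) = a * p k + bsum p v C) by reflexivity.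
      assert (E3 : bsum (fun _ => 1) v ((c, k, o) :: C) = a + bsum (fun _ => 1) v C).
      { unfold bsum; simpl; unfold a; lia. }
      assert (E4 : 2 ^ (D * K) = 2 ^ (D * k) * 2 ^ (D * (K - k))).
      { rewrite <- Nat.pow_add_r. f_equal. nia. }
      exists (Lo + a * (num D k p * 2 ^ (D * (K - k)))), (Hi + a * hi).
      rewrite E1, E2, E3. split; [|split].
      + rewrite Nat.mul_add_distr_l, E, Hs.
        replace (2 ^ (D * (k + 1))) with (2 ^ (D * k) * 2 ^ D) by (rewrite <- Nat.pow_add_r; f_equal; lia).
        rewrite E4. ring.
      + rewrite !Nat.mul_add_distr_r.
        assert (a * (num D k p * 2 ^ (D * (K - k))) * 2 ^ D <= a * 2 ^ (P + 1) * 2 ^ (D * K)).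
        { rewrite E4.
          replace (a * (num D k p * 2 ^ (D * (K - k))) * 2 ^ D)
            with (a * 2 ^ (D * (K - k)) * (num D k p * 2 ^ D)) by ring.
          replace (a * 2 ^ (P + 1) * (2 ^ (D * k) * 2 ^ (D * (K - k))))
            with (a * 2 ^ (D * (K - k)) * (2 ^ (P + 1) * 2 ^ (D * k))) by ring.
          now apply Nat.mul_le_mono_l. }
        lia.
      + specialize (Hp k Hk). nia. }
  destruct Hex as (Lo & Hi & E & HLo & Hb).
  pose proof (pow2_pos D). pose proof (pow2_pos (D * K)). pose proof (pow2_pos P).
  rewrite Nat.pow_add_r, Nat.pow_1_r in *.
  assert (HLo' : Lo < 2 ^ (D * K)) by nia.
  unfold dg. rewrite E.
  replace (Lo + 2 ^ (D * K) * bsum p v C + 2 ^ (D * K) * 2 ^ D * Hi)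
    with (Lo + (bsum p v C + Hi * 2 ^ D) * 2 ^ (D * K)) by ring.
  rewrite Nat.div_add, Nat.div_small by (apply pow2_ne || assumption).
  rewrite Nat.add_0_l, Nat.Div0.mod_add. apply Nat.mod_small. nia.
Qed.

Definition mono := (nat * option nat * option nat)%type.
Definition mval (w : nat -> nat) (m : mono) : nat :=
  let '(c, a, b) := m in 2 ^ c * oval w a * oval w b.
Definition msum (w : nat -> nat) (l : list mono) : nat := list_sum (map (mval w) l).

(** The odd-numbered bits of [x] vanish ([x < 2 ^ L], [L] even). *)
Definition Alt (L x : nat) : Prop := Nat.land x ((2 ^ L - 1) / 3 * 2) = 0.

(** Quadratic equations between [nv] unknowns; [alts] are the unknowns subject to
    [Alt], and a link [(i, k)] equates the unknown [i] with the input [k]. *)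
Record sys := Sys {
  nv : nat;
  eqs : list (list mono * list mono);
  alts : list nat;
  links : list (nat * nat)
}.

Definition holds (s : sys) (L : nat) (v w : nat -> nat) : Prop :=
  (forall e, In e (eqs s) -> msum w (fst e) = msum w (snd e)) /\
  (forall i, In i (alts s) -> Alt L (w i)) /\
  (forall l, In l (links s) -> w (fst l) = v (snd l)).

Definition ref_ok (n : nat) (r : option nat) : Prop :=
  match r with None => True | Some i => i < n end.
Definition mono_ok (n L : nat) (m : mono) : Prop :=
  let '(c, a, b) := m in c <= L /\ ref_ok n a /\ ref_ok n b.

Definition wf (s : sys) (L : nat) : Prop :=
  (forall e, In e (eqs s) -> Forall (mono_ok (nv s) L) (fst e) /\ Forall (mono_ok (nv s) L) (snd e)) /\
  (forall i, In i (alts s) -> i < nv s) /\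
  (forall l, In l (links s) -> fst l < nv s).

Definition esize (e : list mono * list mono) : nat := 1 + length (fst e) + length (snd e).

(** The weight 4 of a link makes up for the equation that replaces it once its
    input is quantified. *)
Definition ssize (s : sys) : nat :=
  nv s + list_sum (map esize (eqs s)) + length (alts s) + 4 * length (links s).

(** Entry 0 of the packed vector is the constant 1, which makes constants and linear monomials
    products of two entries as well. *)
Definition idx (r : option nat) : nat := match r with None => 0 | Some i => S i end.

Section Encode.
Variables (s : sys) (L : nat).
Let V := S (nv s).
Let cv (m : mono) : bmono := let '(c, a, b) := m in (c, idx a + V * idx b, None).

(** The second group, compared with that of [rhs], forces the two copies of the unknowns to agree;
    the third expresses the links. Inputs occur only in the last group of [rhs], multiplied by the
    product number 0, which is 1: hence the code is linear in the inputs. *)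
Definition lhs : list (list bmono) :=
  map (fun e => map cv (fst e)) (eqs s) ++
  map (fun i => [(0, S i, None)]) (seq 0 (nv s)) ++
  map (fun l => [(0, S (fst l), None)]) (links s).
Definition rhs : list (list bmono) :=
  map (fun e => map cv (snd e)) (eqs s) ++
  map (fun i => [(0, V * S i, None)]) (seq 0 (nv s)) ++
  map (fun l => [(0, 0, Some (snd l))]) (links s).

Variables (Sz q : nat).
(** [W] bits hold one side: at most [2 * Sz] terms of at most [2 ^ (4 * L)]. [D] bits hold up to
    [4 * Sz] sides and [2 * L + 2] guard bits against carries from products of two unknowns. *)
Let W := 4 * L + 4 * Sz.
Let D := W * (4 * Sz) + 2 * L + 2.
Let isalt (k : nat) : bool := match k with 0 => false | S i => existsb (Nat.eqb i) (alts s) end.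

(** The nine parameters read by [body], written as sparse linear forms; only field 6 contains
    inputs. *)
Definition fields (i : nat) : lin :=
  match i with
  | 0 => map (fun i => (D * i, None)) (filter (fun i => negb (i =? 0)) (seq 0 V))
  | 1 => map (fun i => (D * V * i, None)) (filter (fun i => negb (i =? 0)) (seq 0 V))
  | 2 => [(L, None)]
  | 3 => map (fun i => (D * i, None)) (filter isalt (seq 0 V))
  | 4 => [(D * V, None)]
  | 5 => clist D (V * V) (cof W 0 lhs)
  | 6 => clist D (V * V) (cof W 0 rhs)
  | 7 => [(D * (V * V), None)]
  | _ => [(D, None)]
  end.

Definition code : lin := concat (map (fun i => lshift (q * i) (fields i)) (seq 0 9)).

Hypothesis (Hwf : wf s L) (Hsz : ssize s <= Sz) (HS1 : 1 <= Sz) (HSL : Sz <= L).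
Hypothesis Hq : 200 * L * (Sz * Sz * Sz) <= q.

Lemma eqs_len : list_sum (map esize (eqs s)) <= Sz /\ length (eqs s) <= list_sum (map esize (eqs s)).
Proof.
  split; [unfold ssize in Hsz; lia|]. induction (eqs s) as [|e l IH]; [reflexivity|].
  change (list_sum (map esize (e :: l))) with (esize e + list_sum (map esize l)).
  cbn [length]. unfold esize at 1. lia.
Qed.

Lemma V_le : V <= 2 * Sz.
Proof. unfold ssize in Hsz; unfold V; lia. Qed.

Lemma lhs_len : length lhs <= 4 * Sz.
Proof.
  unfold lhs. rewrite !length_app, !length_map, length_seq.
  pose proof eqs_len. unfold ssize in Hsz. lia.
Qed.

Lemma rhs_len : length rhs = length lhs.
Proof. unfold lhs, rhs. now rewrite !length_app, !length_map. Qed.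

(** Origin of the constant 200: [D] is at most [36 * L * Sz] and [V * V + 1] at most
    [5 * (Sz * Sz)], which gives 180. *)
Lemma D_bound : D * (V * V + 1) <= q.
Proof.
  pose proof V_le. assert (W <= 8 * L) by (unfold W; lia).
  assert (D <= 36 * L * Sz) by (unfold D; nia).
  assert (V * V + 1 <= 5 * (Sz * Sz)) by nia.
  apply Nat.le_trans with (36 * L * Sz * (5 * (Sz * Sz))); [now apply Nat.mul_le_mono|nia].
Qed.

Definition good (v : nat -> nat) (l : list bmono) : Prop :=
  length l <= 2 * Sz /\
  forall c k o, In (c, k, o) l -> k < V * V /\ c <= L /\ oval v o <= 2 ^ L.

Lemma idx_lt r : ref_ok (nv s) r -> idx r < V.
Proof. destruct r; simpl; unfold V; lia. Qed.

Lemma good_cv v l : length l <= Sz -> Forall (mono_ok (nv s) L) l -> good v (map cv l).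
Proof.
  intros Hl HF. split; [rewrite length_map; lia|].
  intros c k o Hin. apply in_map_iff in Hin. destruct Hin as ([[c' a] b] & E & Hin).
  rewrite Forall_forall in HF. specialize (HF _ Hin). destruct HF as (Hc & Ha & Hb).
  apply idx_lt in Ha, Hb. unfold cv in E. inversion E; subst. pose proof (pow2_pos L).
  cbn [oval]; split; [nia|lia].
Qed.

Lemma side_len e : In e (eqs s) -> length (fst e) <= Sz /\ length (snd e) <= Sz.
Proof.
  intros H. destruct eqs_len as [H1 _].
  assert (Hin : In (esize e) (map esize (eqs s))) by now apply in_map.
  assert (esize e <= list_sum (map esize (eqs s))).
  { clear -Hin. induction (map esize (eqs s)) as [|a l IH]; simpl in *; [easy|].
    destruct Hin as [->|Hin]; [lia|]. specialize (IH Hin); lia. }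
  unfold esize in *; lia.
Qed.

Lemma good_lhs v l : In l lhs -> good v l.
Proof.
  pose proof (pow2_pos L). unfold lhs. rewrite !in_app_iff, !in_map_iff.
  intros [(e & <- & He)|[(i & <- & Hi)|(lk & <- & Hl)]].
  - apply good_cv; [now apply side_len|now apply Hwf].
  - apply in_seq in Hi. split; [simpl; lia|]. intros c k o [E|[]]; inversion E; subst.
    cbn [oval]; split; [unfold V; nia|lia].
  - apply Hwf in Hl. split; [simpl; lia|]. intros c k o [E|[]]; inversion E; subst.
    cbn [oval]; split; [unfold V; nia|lia].
Qed.

Lemma good_rhs v l : (forall i, v i < 2 ^ L) -> In l rhs -> good v l.
Proof.
  pose proof (pow2_pos L). intros Hv. unfold rhs. rewrite !in_app_iff, !in_map_iff.
  intros [(e & <- & He)|[(i & <- & Hi)|(lk & <- & Hl)]].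
  - apply good_cv; [now apply side_len|now apply Hwf].
  - apply in_seq in Hi. split; [simpl; lia|]. intros c k o [E|[]]; inversion E; subst.
    cbn [oval]; split; [unfold V; nia|lia].
  - split; [simpl; lia|]. intros c k o [E|[]]; inversion E; subst.
    specialize (Hv (snd lk)). cbn [oval]; split; [unfold V; nia|lia].
Qed.

Lemma good_lt v p l P : good v l -> P <= 2 * L -> (forall k, k < V * V -> p k <= 2 ^ P) ->
  bsum p v l < 2 ^ W.
Proof.
  intros [Hl H] HP Hp.
  apply Nat.le_lt_trans with (2 * Sz * 2 ^ (2 * L + P)).
  - apply bsum_le; [assumption|]. intros c k o Hin. destruct (H c k o Hin) as (A & B & C).
    split; [assumption|]. split; [assumption|auto].
  - unfold W. rewrite (Nat.add_comm (4 * L)), (Nat.pow_add_r 2 (4 * Sz)).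
    assert (2 * Sz < 2 ^ (4 * Sz)) by (pose proof (pow2_gt (4 * Sz)); lia).
    assert (2 ^ (2 * L + P) <= 2 ^ (4 * L)) by (apply pow2_le; lia).
    pose proof (pow2_pos (2 * L + P)). nia.
Qed.

Lemma cof_In W' t E c k o : In (c, k, o) (cof W' t E) -> exists l c', In l E /\ In (c', k, o) l.
Proof.
  revert t; induction E as [|l E IH]; intros t; simpl; [easy|].
  rewrite in_app_iff, in_map_iff. intros [([[c' k'] o'] & E1 & Hin)|Hin].
  - inversion E1; subst. exists l, c'. auto.
  - destruct (IH _ Hin) as (l' & c' & H1 & H2). exists l', c'. auto.
Qed.

Lemma cof_total v E : length E <= 4 * Sz -> (forall l, In l E -> good v l) ->
  bsum (fun _ => 1) v (cof W 0 E) * 2 ^ (2 * L + 1) < 2 ^ D.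
Proof.
  intros HE Hg. rewrite bsum_cof, Nat.mul_0_r, Nat.mul_1_l.
  assert (H : hv W (map (bsum (fun _ => 1) v) E) < 2 ^ (W * length (map (bsum (fun _ => 1) v) E))).
  { apply hv_lt. intros a Ha. apply in_map_iff in Ha. destruct Ha as (l & <- & Hl).
    apply good_lt with (P := 0); [now apply Hg|lia|]. intros; simpl; lia. }
  rewrite length_map in H.
  assert (2 ^ (W * length E) <= 2 ^ (W * (4 * Sz))) by (apply pow2_le; nia).
  apply Nat.lt_le_trans with (2 ^ (W * (4 * Sz)) * 2 ^ (2 * L + 1)).
  - apply Nat.mul_lt_mono_pos_r; [apply pow2_pos|lia].
  - rewrite <- Nat.pow_add_r. apply pow2_le. unfold D. lia.
Qed.

Lemma ev_clist_le v C : ev v (clist D (V * V) C) <= 2 ^ (D * (V * V)) * bsum (fun _ => 1) v C.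
Proof.
  unfold ev, clist, bsum. rewrite map_map, <- list_sum_map_mul.
  apply list_sum_map_le. intros [[c k] o] _. cbn [fst snd bval].
  rewrite Nat.pow_add_r, Nat.mul_assoc, Nat.mul_1_r, (Nat.mul_comm (2 ^ (D * (V * V)))).
  apply Nat.mul_le_mono_l, pow2_le, Nat.mul_le_mono_l, Nat.le_sub_l.
Qed.

Lemma ev_clist_lt v C : bsum (fun _ => 1) v C < 2 ^ D -> ev v (clist D (V * V) C) < 2 ^ q.
Proof.
  intros H. apply Nat.lt_le_trans with (2 ^ (D * (V * V + 1))); [|apply pow2_le, D_bound].
  apply Nat.le_lt_trans with (1 := ev_clist_le v C).
  rewrite Nat.mul_add_distr_l, Nat.mul_1_r, Nat.pow_add_r.
  apply Nat.mul_lt_mono_pos_l; [apply pow2_pos|assumption].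
Qed.

Section Eval.
Variable v : nat -> nat.
Hypothesis Hv : forall i, v i < 2 ^ L.

Lemma cof_lt E : length E <= 4 * Sz -> (forall l, In l E -> good v l) ->
  bsum (fun _ => 1) v (cof W 0 E) < 2 ^ D.
Proof.
  intros H1 H2. pose proof (cof_total v E H1 H2). pose proof (pow2_pos (2 * L + 1)). nia.
Qed.

Lemma marks_lt D' p : 1 <= D' -> D' * V <= q -> ev v (map (fun i => (D' * i, None)) (filter p (seq 0 V))) < 2 ^ q.
Proof.
  intros H1 H2. rewrite ev_marks. apply Nat.lt_le_trans with (2 ^ (D' * V)); [|now apply pow2_le].
  apply num_lt. intros i _. apply Nat.lt_le_trans with (2 ^ 1); [destruct (p i); simpl; lia|now apply pow2_le].
Qed.

Lemma ev_one g : ev v [(g, None)] = 2 ^ g.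
Proof. unfold ev; simpl; lia. Qed.

Lemma D_ge : 2 * L + 2 <= D /\ D * V <= q /\ D * V * V < q.
Proof. pose proof D_bound. assert (1 <= V) by (unfold V; lia). unfold D in *; nia. Qed.

Lemma fields_lt i : i < 9 -> ev v (fields i) < 2 ^ q.
Proof.
  intros Hi. pose proof D_ge as (HD1 & HD2 & HD3). pose proof (V_le) as HV.
  assert (HV1 : 1 <= V) by (unfold V; lia).
  destruct i as [|[|[|[|[|[|[|[|[|i]]]]]]]]]; [..|lia]; cbn [fields];
    rewrite ?ev_one; try (apply pow2_lt; nia).
  - apply marks_lt; nia.
  - apply marks_lt; nia.
  - apply marks_lt; nia.
  - apply ev_clist_lt, cof_lt; [apply lhs_len|apply good_lhs].
  - apply ev_clist_lt, cof_lt; [rewrite rhs_len; apply lhs_len|intros; now apply good_rhs].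
Qed.

Definition pr (e e' : nat -> nat) (k : nat) : nat := e (k mod V) * e' (k / V).

Lemma pr_idx e e' i j : i < V -> pr e e' (i + V * j) = e i * e' j.
Proof.
  intros Hi. unfold pr. rewrite (Nat.mul_comm V), Nat.Div0.mod_add, Nat.mod_small by assumption.
  rewrite Nat.div_add, Nat.div_small by (unfold V in *; lia). reflexivity.
Qed.

(** The digits of the right factor are [V] times as wide, so the digit [i + V * j] of the product is
    [e i * e' j], with no overlap of positions. *)
Lemma num_prod e e' : num D V e * num (D * V) V e' = num D (V * V) (pr e e').
Proof.
  assert (H : forall K, num D V e * num (D * V) K e' = num D (K * V) (pr e e')).
  { induction K as [|K IH]; [unfold num; simpl; lia|].
    rewrite num_S, Nat.mul_add_distr_l, IH.
    replace (S K * V) with (K * V + V) by lia.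
    unfold num at 3. rewrite sum_split. fold (num D (K * V) (pr e e')). f_equal.
    unfold num. rewrite <- sum_mul_r. apply sum_ext. intros i Hi.
    replace (K * V + i) with (i + V * K) by lia. rewrite pr_idx by assumption.
    replace (D * (i + V * K)) with (D * i + D * V * K) by ring. rewrite Nat.pow_add_r. ring. }
  apply H.
Qed.

Lemma msum_bsum w l : Forall (mono_ok (nv s) L) l ->
  bsum (pr (fun k => oval w (match k with 0 => None | S i => Some i end))
           (fun k => oval w (match k with 0 => None | S i => Some i end))) v (map cv l) = msum w l.
Proof.
  intros H. unfold bsum, msum. rewrite map_map. f_equal. apply map_ext_in.
  intros [[c a] b] Hin. rewrite Forall_forall in H. destruct (H _ Hin) as (_ & Ha & Hb).
  unfold cv, bval. cbn [oval]. rewrite pr_idx by now apply idx_lt.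
  unfold mval. destruct a, b; simpl; lia.
Qed.

Lemma V_pos : 0 < V. Proof. unfold V; lia. Qed.

(** Since [e 0 = e' 0 = 1], the products with indices [i] and [V * j] are the entries [e i] and
    [e' j] themselves; the two auxiliary groups of equations therefore speak of single entries. *)
Lemma bilinear_iff e e' : e 0 = 1 -> e' 0 = 1 ->
  (map (bsum (pr e e') v) lhs = map (bsum (pr e e') v) rhs <->
   (forall i, i < nv s -> e (S i) = e' (S i)) /\
   (forall q, In q (eqs s) -> bsum (pr e e') v (map cv (fst q)) = bsum (pr e e') v (map cv (snd q))) /\
   (forall l, In l (links s) -> e (S (fst l)) = v (snd l))).
Proof.
  intros He He'.
  assert (P0 : forall i, i < V -> pr e e' i = e i).
  { intros i Hi. replace i with (i + V * 0) at 1 by lia. rewrite pr_idx by assumption. lia. }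
  assert (P1 : forall j, pr e e' (V * j) = e' j).
  { intros j. replace (V * j) with (0 + V * j) at 1 by lia. rewrite pr_idx by apply V_pos. lia. }
  unfold lhs, rhs. rewrite !map_app, !map_map.
  split.
  - intros H.
    assert (H1 := f_equal (firstn (length (eqs s))) H).
    rewrite !firstn_app, !length_map, Nat.sub_diag in H1. simpl firstn in H1.
    rewrite !app_nil_r, !firstn_all2 in H1 by (rewrite length_map; lia).
    rewrite H1 in H. apply app_inv_head in H.
    assert (H2 := f_equal (firstn (nv s)) H).
    rewrite !firstn_app, !length_map, !length_seq, Nat.sub_diag in H2. simpl firstn in H2.
    rewrite !app_nil_r, !firstn_all2 in H2 by (rewrite length_map, length_seq; lia).
    rewrite H2 in H. apply app_inv_head in H.
    pose proof (map_eq_in _ _ _ H1) as H1'. pose proof (map_eq_in _ _ _ H2) as H2'.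
    pose proof (map_eq_in _ _ _ H) as H'. clear H H1 H2. rename H1' into H1, H2' into H2, H' into H.
    repeat split.
    + intros i Hi. specialize (H2 i). rewrite in_seq in H2. specialize (H2 ltac:(lia)).
      unfold bsum in H2; cbn [map list_sum fold_right bval oval] in H2.
      change (S (i + nv s * S i)) with (V * S i) in H2.
      rewrite P1, P0 in H2 by (unfold V; lia). simpl in H2. lia.
    + exact H1.
    + intros l Hl. specialize (H l Hl). assert (Hl' : fst l < nv s) by now apply Hwf.
      unfold bsum in H; cbn [map list_sum fold_right bval oval] in H.
      rewrite !P0 in H by (unfold V; lia). simpl in H. lia.
  - intros (H2 & H1 & H3). f_equal; [now apply map_ext_in|]. f_equal; apply map_ext_in.
    + intros i Hi. apply in_seq in Hi. unfold bsum; cbn [map list_sum fold_right bval oval].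
      rewrite P1, P0 by (unfold V; lia). rewrite H2 by lia. reflexivity.
    + intros l Hl. assert (Hl' : fst l < nv s) by now apply Hwf. specialize (H3 l Hl).
      unfold bsum; cbn [map list_sum fold_right bval oval].
      rewrite !P0 by (unfold V; lia). rewrite He, H3. lia.
Qed.

Lemma alt_check e : (forall i, i < V -> e i < 2 ^ D) ->
  (Nat.land (num D V e) ((2 ^ L - 1) / 3 * 2 * ev v (fields 3)) = 0 <->
   forall i, In i (alts s) -> Alt L (e (S i))).
Proof.
  intros He. cbn [fields]. rewrite ev_marks, mul_num.
  pose proof D_ge as (HD1 & _ & _).
  set (am := (2 ^ L - 1) / 3 * 2).
  assert (Ham : am < 2 ^ D).
  { unfold am. pose proof (Nat.Div0.mul_div_le (2 ^ L - 1) 3). pose proof (pow2_pos L).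
    assert (2 ^ L <= 2 ^ D) by (apply pow2_le; lia). lia. }
  assert (Hm : forall i, i < V -> am * Nat.b2n (isalt i) < 2 ^ D).
  { intros i _. destruct (isalt i); simpl; pose proof (pow2_pos D); lia. }
  assert (Hn : forall k, k < V -> dg D (Nat.land (num D V e) (num D V (fun i => am * Nat.b2n (isalt i)))) k
     = Nat.land (e k) (am * Nat.b2n (isalt k))).
  { intros k Hk. now rewrite dg_land, !dg_num. }
  split.
  - intros H i Hi. assert (Hi' : S i < V) by (apply Hwf in Hi; unfold V; lia).
    specialize (Hn (S i) Hi'). rewrite H in Hn. unfold Alt. fold am.
    replace (isalt (S i)) with true in Hn.
    + simpl Nat.b2n in Hn. rewrite Nat.mul_1_r in Hn. rewrite <- Hn. unfold dg.
      rewrite Nat.Div0.div_0_l. apply Nat.Div0.mod_0_l.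
    + symmetry. apply existsb_exists. exists i. split; [assumption|apply Nat.eqb_refl].
  - intros H. apply (dg_ext D V).
    + apply Nat.le_lt_trans with (num D V e); [apply Nat.land_le_l|now apply num_lt].
    + apply pow2_pos.
    + intros k Hk. rewrite Hn by assumption. unfold dg at 1. rewrite Nat.Div0.div_0_l, Nat.Div0.mod_0_l.
      destruct (isalt k) eqn:E; [|rewrite Nat.mul_0_r; apply Nat.land_0_r].
      destruct k as [|k]; [easy|]. apply existsb_exists in E. destruct E as (i & Hi & E).
      apply Nat.eqb_eq in E; subst i. simpl Nat.b2n. rewrite Nat.mul_1_r. now apply H.
Qed.

Lemma digit_side e e' E : (forall i, i < V -> e i <= 2 ^ L) -> (forall i, i < V -> e' i <= 2 ^ L) ->
  length E <= 4 * Sz -> (forall l, In l E -> good v l) ->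
  dg D (num D (V * V) (pr e e') * ev v (clist D (V * V) (cof W 0 E))) (V * V)
  = hv W (map (bsum (pr e e') v) E).
Proof.
  intros He He' HE Hg. pose proof D_ge as (HD1 & _ & _).
  rewrite digit_prod with (P := 2 * L).
  - rewrite bsum_cof, Nat.mul_0_r, Nat.mul_1_l. reflexivity.
  - lia.
  - intros k Hk. unfold pr. replace (2 * L) with (L + L) by lia. rewrite Nat.pow_add_r.
    apply Nat.mul_le_mono; [apply He, Nat.mod_upper_bound; unfold V; lia|].
    apply He'. apply Nat.Div0.div_lt_upper_bound; lia.
  - intros c k o Hin. apply cof_In in Hin. destruct Hin as (l & c' & Hl & Hin).
    now apply (Hg l Hl) in Hin.
  - now apply cof_total.
Qed.

Lemma pr_le e e' : (forall i, i < V -> e i <= 2 ^ L) -> (forall i, i < V -> e' i <= 2 ^ L) ->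
  forall k, k < V * V -> pr e e' k <= 2 ^ (2 * L).
Proof.
  intros He He' k Hk. unfold pr. replace (2 * L) with (L + L) by lia. rewrite Nat.pow_add_r.
  apply Nat.mul_le_mono; [apply He, Nat.mod_upper_bound; unfold V; lia|].
  apply He'. apply Nat.Div0.div_lt_upper_bound; lia.
Qed.

Lemma digits_iff e e' : (forall i, i < V -> e i <= 2 ^ L) -> (forall i, i < V -> e' i <= 2 ^ L) ->
  (hv W (map (bsum (pr e e') v) lhs) = hv W (map (bsum (pr e e') v) rhs) <->
   map (bsum (pr e e') v) lhs = map (bsum (pr e e') v) rhs).
Proof.
  intros He He'. split; [|congruence]. apply hv_inj.
  - now rewrite !length_map, rhs_len.
  - intros a Ha. apply in_map_iff in Ha. destruct Ha as (l & <- & Hl).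
    apply good_lt with (P := 2 * L); [now apply good_lhs|lia|now apply pr_le].
  - intros a Ha. apply in_map_iff in Ha. destruct Ha as (l & <- & Hl).
    apply good_lt with (P := 2 * L); [now apply good_rhs|lia|now apply pr_le].
Qed.

(** A solution, preceded by 1 and packed twice, is a witness; conversely a witness yields two
    copies, which the equations force to coincide, and hence a solution. *)
Lemma code_iff y n : n = 16 * q ->
  ((exists w, (forall i, i < nv s -> w i < 2 ^ L) /\ holds s L v w) <-> psin y n (ev v code)).
Proof.
  intros Hn. pose proof D_ge as (HD1 & HD2 & HD3). pose proof V_pos as HV0.
  assert (Hq2 : 2 <= q) by nia.
  set (f := fun i => ev v (fields i)).
  assert (Hf : forall i, i < 9 -> f i < 2 ^ q) by (intros; now apply fields_lt).
  assert (HY : ev v code = num q 9 f) by apply ev_fields.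
  assert (F2 : f 2 = 2 ^ L) by apply ev_one.
  assert (F4 : f 4 = 2 ^ (D * V)) by apply ev_one.
  assert (F7 : f 7 = 2 ^ (D * (V * V))) by apply ev_one.
  assert (F8 : f 8 = 2 ^ D) by apply ev_one.
  assert (F0 : f 0 = num D V (fun i => Nat.b2n (negb (i =? 0)))) by apply ev_marks.
  assert (F1 : f 1 = num (D * V) V (fun i => Nat.b2n (negb (i =? 0)))) by apply ev_marks.
  assert (HDn : D * V <= n) by lia. assert (HDVn : D * V * V <= n) by lia.
  (* The meaning of [body] for an arbitrary [x], with the two copies still independent. *)
  assert (Hspec : forall x, x < 2 ^ n ->
    (fsb n (two_env y (ev v code) x) (body y) = true <->
     exists e e', e 0 = 1 /\ (forall i, 0 < i < V -> e i < 2 ^ L) /\ x mod 2 ^ (D * V) = num D V e /\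
       e' 0 = 1 /\ (forall i, 0 < i < V -> e' i < 2 ^ L) /\ x / 2 ^ (D * V) = num (D * V) V e' /\
       (forall i, In i (alts s) -> Alt L (e (S i))) /\
       map (bsum (pr e e') v) lhs = map (bsum (pr e e') v) rhs)).
  { intros x Hx.
    rewrite (body_spec y n q _ x f Hn Hq2 Hf HY Hx) by
      (rewrite ?F2, ?F4, ?F7, ?F8; apply pow2_pos).
    cbv zeta. rewrite F2, F4, F7, F8, F0, F1.
    replace (2 ^ (D * V) - 1) with (Nat.ones (D * V)) by (rewrite Nat.ones_equiv; lia).
    replace (2 ^ D - 1) with (Nat.ones D) by (rewrite Nat.ones_equiv; lia).
    rewrite !Nat.land_ones.
    assert (Hxl : x mod 2 ^ (D * V) < 2 ^ n).
    { apply Nat.lt_le_trans with (2 ^ (D * V)); [apply Nat.mod_upper_bound, pow2_ne|now apply pow2_le]. }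
    assert (Hxr : x / 2 ^ (D * V) < 2 ^ n).
    { apply Nat.le_lt_trans with x; [|assumption]. apply Nat.Div0.div_le_upper_bound.
      pose proof (pow2_pos (D * V)); nia. }
    rewrite (mask_check D V L n (x mod _)) by (assumption || lia).
    rewrite (mask_check (D * V) V L n (x / _)) by (assumption || nia).
    assert (Hle : forall e : nat -> nat, e 0 = 1 -> (forall i, 0 < i < V -> e i < 2 ^ L) ->
      forall i, i < V -> e i <= 2 ^ L).
    { intros e e0 He [|i] Hi; [rewrite e0; apply pow2_pos|]. specialize (He (S i) ltac:(lia)); lia. }
    assert (HltD : forall e : nat -> nat, e 0 = 1 -> (forall i, 0 < i < V -> e i < 2 ^ L) ->
      forall i, i < V -> e i < 2 ^ D).
    { intros e e0 He i Hi. apply Nat.le_lt_trans with (2 ^ L); [now apply Hle|]. apply pow2_lt; lia. }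
    (* Three factors of at most [q] bits stay below [2 ^ n] because [n = 16 * q], so both reductions
       disappear. *)
    assert (Hdig : forall e e', e 0 = 1 -> (forall i, 0 < i < V -> e i < 2 ^ L) ->
       e' 0 = 1 -> (forall i, 0 < i < V -> e' i < 2 ^ L) -> forall c, c < 2 ^ q ->
       (num D V e * num (D * V) V e' mod 2 ^ n * c) mod 2 ^ n / 2 ^ (D * (V * V)) mod 2 ^ D =
       dg D (num D (V * V) (pr e e') * c) (V * V)).
    { intros e e' e0 He e0' He' c Hc.
      assert (B1 : num D V e < 2 ^ q).
      { apply Nat.lt_le_trans with (2 ^ (D * V)); [apply num_lt; now apply HltD|now apply pow2_le]. }
      assert (B2 : num (D * V) V e' < 2 ^ q).
      { apply Nat.lt_le_trans with (2 ^ (D * V * V)); [apply num_lt|apply pow2_le; lia].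
        intros i Hi. apply Nat.lt_le_trans with (2 ^ D); [now apply HltD|apply pow2_le; nia]. }
      assert (B3 := lt_pow2_mul _ _ _ _ B1 B2). assert (B4 := lt_pow2_mul _ _ _ _ B3 Hc).
      rewrite (Nat.mod_small (num D V e * num (D * V) V e') (2 ^ n)).
      2:{ apply Nat.lt_le_trans with (1 := B3). apply pow2_le; lia. }
      rewrite (Nat.mod_small _ (2 ^ n)).
      2:{ apply Nat.lt_le_trans with (1 := B4). apply pow2_le; lia. }
      rewrite num_prod. reflexivity. }
    split.
    - intros ((e & e0 & He & Ee) & (e' & e0' & He' & Ee') & Ha & Hd).
      exists e, e'. repeat (split; [assumption|]).
      rewrite Ee in Ha. split; [exact (proj1 (alt_check e (HltD e e0 He)) Ha)|].
      rewrite Ee, Ee' in Hd. rewrite !Hdig in Hd by (assumption || apply Hf; lia).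
      unfold f in Hd. cbn [fields] in Hd.
      rewrite !digit_side in Hd; auto using lhs_len, good_lhs, good_rhs.
      2:{ rewrite rhs_len; apply lhs_len. }
      apply digits_iff in Hd; auto.
    - intros (e & e' & e0 & He & Ee & e0' & He' & Ee' & Ha & Hd).
      split; [exists e; auto|]. split; [exists e'; auto|].
      rewrite Ee, Ee'. split; [exact (proj2 (alt_check e (HltD e e0 He)) Ha)|].
      rewrite !Hdig by (assumption || apply Hf; lia). unfold f. cbn [fields].
      rewrite !digit_side; auto using lhs_len, good_lhs, good_rhs.
      2:{ rewrite rhs_len; apply lhs_len. }
      now rewrite Hd. }
  split.
  - intros (w & Hw & He & Ha & Hl).
    set (e := fun k => oval w (match k with 0 => None | S i => Some i end)).
    assert (Hb : forall i, 0 < i < V -> e i < 2 ^ L).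
    { intros [|i] Hi; [lia|]. apply Hw. unfold V in Hi; lia. }
    assert (HbD : forall i, i < V -> e i < 2 ^ D).
    { intros [|i] Hi; [apply (pow2_lt 0 D); lia|].
      apply Nat.lt_trans with (2 ^ L); [apply Hb; lia|apply pow2_lt; lia]. }
    assert (B1 : num D V e < 2 ^ (D * V)) by now apply num_lt.
    assert (B2 : num (D * V) V e < 2 ^ (D * V * V)).
    { apply num_lt. intros i Hi. apply Nat.lt_le_trans with (2 ^ D); [now apply HbD|apply pow2_le; nia]. }
    exists (num D V e + num (D * V) V e * 2 ^ (D * V)).
    assert (Hx : num D V e + num (D * V) V e * 2 ^ (D * V) < 2 ^ n).
    { apply Nat.lt_le_trans with (2 ^ (D * V * V + D * V)); [rewrite Nat.pow_add_r; nia|apply pow2_le; lia]. }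
    split; [exact Hx|]. apply Hspec; [exact Hx|].
    exists e, e. rewrite Nat.Div0.mod_add, Nat.mod_small, Nat.div_add, Nat.div_small
      by (assumption || apply pow2_ne).
    repeat (split; [first [reflexivity|assumption]|]).
    apply bilinear_iff; [reflexivity|reflexivity|]. split; [auto|]. split; [|exact Hl].
    intros p Hp. unfold e. rewrite !msum_bsum by now apply Hwf. now apply He.
  - intros (x & Hx & H). apply Hspec in H; [|exact Hx].
    destruct H as (e & e' & e0 & He & _ & e0' & He' & _ & Ha & Hd).
    apply bilinear_iff in Hd; [|assumption|assumption]. destruct Hd as (H1 & H2 & H3).
    exists (fun i => e (S i)). split; [intros i Hi; apply He; unfold V; lia|].
    split; [|split; [exact Ha|exact H3]].
    intros p Hp. specialize (H2 p Hp).
    set (w := fun i => e (S i)).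
    rewrite <- !(msum_bsum w) by now apply Hwf.
    assert (Hpr : forall l, Forall (mono_ok (nv s) L) l -> bsum (pr (fun k => oval w (match k with 0 => None | S i => Some i end))
           (fun k => oval w (match k with 0 => None | S i => Some i end))) v (map cv l) = bsum (pr e e') v (map cv l)).
    { intros l Hl. unfold bsum. rewrite !map_map. f_equal. apply map_ext_in.
      intros [[c a] b] Hin. rewrite Forall_forall in Hl. destruct (Hl _ Hin) as (_ & Ra & Rb).
      apply idx_lt in Ra, Rb. unfold cv, bval. rewrite !pr_idx by assumption.
      f_equal. f_equal.
      - destruct (idx a); simpl; auto.
      - destruct (idx b) as [|j]; simpl; auto. unfold w. apply H1. unfold V in Rb; lia. }
    rewrite !Hpr by now apply Hwf. exact H2.
Qed.

End Eval.

Lemma filter_len {A} (p : A -> bool) l : length (filter p l) <= length l.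
Proof. induction l as [|a l IH]; simpl; [lia|]. destruct (p a); simpl; lia. Qed.

Lemma cof_len W' t E : length (cof W' t E) = list_sum (map (@length bmono) E).
Proof.
  revert t; induction E as [|l E IH]; intros t; simpl; [reflexivity|].
  now rewrite length_app, length_map, IH.
Qed.

Lemma sides_len : list_sum (map (@length bmono) lhs) <= 2 * Sz /\ list_sum (map (@length bmono) rhs) <= 2 * Sz.
Proof.
  unfold lhs, rhs. rewrite !map_app, !list_sum_app, !map_map. simpl length.
  rewrite !list_sum_map_const, !length_seq.
  assert (H : forall l : list (list mono * list mono),
    list_sum (map (fun e => length (map cv (fst e))) l) <= list_sum (map esize l) /\
    list_sum (map (fun e => length (map cv (snd e))) l) <= list_sum (map esize l)).
  { intros l. split; apply list_sum_map_le; intros e _; rewrite length_map; unfold esize; lia. }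
  specialize (H (eqs s)). unfold ssize in Hsz. lia.
Qed.

Lemma code_len : length code <= 20 * Sz.
Proof.
  unfold code. cbn [seq map concat]. unfold lshift.
  rewrite !length_app, !length_map. cbn [fields length].
  unfold clist. rewrite !length_map, !cof_len.
  pose proof sides_len. pose proof V_le.
  pose proof (filter_len (fun i => negb (i =? 0)) (seq 0 V)).
  pose proof (filter_len isalt (seq 0 V)). rewrite length_seq in *. lia.
Qed.

Lemma code_lt v n : n = 16 * q -> (forall i, v i < 2 ^ L) -> ev v code < 2 ^ n.
Proof.
  intros Hn Hv. unfold code. rewrite ev_fields.
  apply Nat.lt_le_trans with (2 ^ (q * 9)); [|apply pow2_le; lia].
  apply num_lt. intros i Hi. now apply fields_lt.
Qed.
End Encode.

Lemma ev_term_le v l t : In t l -> oval v (snd t) * 2 ^ fst t <= ev v l.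
Proof.
  unfold ev. induction l as [|a l IH]; simpl; [easy|]. intros [->|H]; [lia|]. specialize (IH H); lia.
Qed.

(** The number of terms is linear in the size although the code has [2 ^ d] bits: [E_flip] needs
    this to compute codes, [diagonal] to describe one. The constant 4000 covers the 200 bits of each
    of the 16 fields. *)
Lemma encode y s L Sz d : wf s L -> ssize s <= Sz -> 1 <= Sz -> Sz <= L ->
  4000 * L * (Sz * Sz * Sz) <= 2 ^ d ->
  exists l : lin, length l <= 20 * Sz /\ (forall t, In t l -> fst t < 2 ^ d) /\
    forall v, (forall i, v i < 2 ^ L) ->
      ev v l < 2 ^ 2 ^ d /\
      ((exists w, (forall i, i < nv s -> w i < 2 ^ L) /\ holds s L v w) <-> psin y (2 ^ d) (ev v l)).
Proof.
  intros Hwf Hsz HS HSL Hd.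
  assert (Hd4 : 4 <= d).
  { destruct (Nat.le_gt_cases 4 d) as [|H]; [assumption|].
    assert (2 ^ d <= 16) by (apply (pow2_le d 4); lia).
    assert (0 < L * (Sz * Sz * Sz)) by (repeat apply Nat.mul_pos_pos; lia). lia. }
  set (q := 2 ^ (d - 4)).
  assert (Hn : 2 ^ d = 16 * q).
  { unfold q. change 16 with (2 ^ 4). rewrite <- Nat.pow_add_r. f_equal; lia. }
  assert (Hq : 200 * L * (Sz * Sz * Sz) <= q) by lia.
  assert (Hlt : forall v, (forall i, v i < 2 ^ L) -> ev v (code s L Sz q) < 2 ^ 2 ^ d).
  { intros v Hv. apply code_lt; auto. }
  exists (code s L Sz q). split; [now apply code_len|]. split.
  (* With all inputs equal to 1 a single term is [2 ^ fst t], and the bound on the whole form bounds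
     its exponent. *)
  - intros t Ht. specialize (Hlt (fun _ => 1)).
    assert (H1 : 1 < 2 ^ L) by (apply (pow2_lt 0 L); lia).
    specialize (Hlt (fun _ => H1)). apply (ev_term_le (fun _ => 1)) in Ht.
    apply Nat.pow_lt_mono_r_iff with (a := 2); [lia|].
    destruct (snd t); simpl in Ht; lia.
  - intros v Hv. split; [auto|]. now apply code_iff.
Qed.

(** * Relations defined by systems *)

Definition scons (x : nat) (v : nat -> nat) : nat -> nat :=
  fun i => match i with 0 => x | S i => v i end.
Definition etl (v : nat -> nat) : nat -> nat := fun i => v (S i).
Notation "x .: v" := (scons x v) (at level 55, right associativity).

Definition bounded (m : nat) (v : nat -> nat) : Prop := forall i, v i < 2 ^ m.

Lemma bounded_scons m x v : x < 2 ^ m -> bounded m v -> bounded m (x .: v).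
Proof. intros Hx Hv [|i]; simpl; auto. Qed.

Lemma bounded_ren m v (r : nat -> nat) : bounded m v -> bounded m (fun i => v (r i)).
Proof. intros Hv i; apply Hv. Qed.

Lemma bounded_le m m' v : m <= m' -> bounded m v -> bounded m' v.
Proof. intros H Hv i. apply Nat.lt_le_trans with (1 := Hv i). now apply pow2_le. Qed.

(** [R], restricted to [m]-bit inputs, is the solvability of a system of size at
    most [K] with [L]-bit unknowns. *)
Definition E (m L K : nat) (R : (nat -> nat) -> Prop) : Prop :=
  exists s, wf s L /\ ssize s <= K /\
    forall v, bounded m v -> (R v <-> exists w, (forall i, i < nv s -> w i < 2 ^ L) /\ holds s L v w).

Lemma E_iff m L K (R R' : (nat -> nat) -> Prop) :
  (forall v, bounded m v -> (R v <-> R' v)) -> E m L K R -> E m L K R'.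
Proof.
  intros H (s & Hwf & Hs & HR). exists s. split; [assumption|]. split; [assumption|].
  intros v Hv. rewrite <- H by assumption. now apply HR.
Qed.

Lemma E_size m L K K' R : K <= K' -> E m L K R -> E m L K' R.
Proof. intros H (s & Hwf & Hs & HR). exists s. split; [assumption|]. split; [lia|assumption]. Qed.

Lemma E_dom m m' L K R : m' <= m -> E m L K R -> E m' L K R.
Proof.
  intros H (s & Hwf & Hs & HR). exists s. split; [assumption|]. split; [assumption|].
  intros v Hv. apply HR. now apply bounded_le with m'.
Qed.

Lemma E_ren m L K R (r : nat -> nat) : E m L K R -> E m L K (fun v => R (fun i => v (r i))).
Proof.
  intros (s & (W1 & W2 & W3) & Hs & HR).
  exists (Sys (nv s) (eqs s) (alts s) (map (fun l => (fst l, r (snd l))) (links s))).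
  split; [|split].
  - split; [exact W1|]. split; [exact W2|]. simpl. intros l Hl. apply in_map_iff in Hl.
    destruct Hl as (l' & <- & Hl). exact (W3 l' Hl).
  - unfold ssize in *; simpl. now rewrite length_map.
  - intros v Hv. rewrite HR by exact (bounded_ren m v r Hv).
    unfold holds; simpl. split; intros (w & Hw & H1 & H2 & H3); exists w; repeat (split; [assumption|]).
    + intros l Hl. apply in_map_iff in Hl. destruct Hl as (l' & <- & Hl). exact (H3 l' Hl).
    + intros l Hl. apply (H3 (fst l, r (snd l))). apply in_map_iff. now exists l.
Qed.

Lemma oval_ext n w w' r : (forall i, i < n -> w i = w' i) -> ref_ok n r -> oval w r = oval w' r.
Proof. destruct r; simpl; auto. Qed.

Lemma msum_ext n L w w' l : (forall i, i < n -> w i = w' i) -> Forall (mono_ok n L) l -> msum w l = msum w' l.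
Proof.
  intros H HF. unfold msum. f_equal. apply map_ext_in. intros [[c a] b] Hin.
  rewrite Forall_forall in HF. destruct (HF _ Hin) as (_ & Ha & Hb). simpl.
  now rewrite (oval_ext n w w' a), (oval_ext n w w' b).
Qed.

Lemma holds_ext s L v w w' : wf s L -> (forall i, i < nv s -> w i = w' i) -> holds s L v w -> holds s L v w'.
Proof.
  intros (W1 & W2 & W3) H (H1 & H2 & H3). split; [|split].
  - intros e He. destruct (W1 e He) as [Wa Wb].
    rewrite <- (msum_ext _ _ w w' _ H Wa), <- (msum_ext _ _ w w' _ H Wb). auto.
  - intros i Hi. rewrite <- H; auto.
  - intros l Hl. rewrite <- H; auto.
Qed.

Definition rsh (k : nat) (r : option nat) : option nat := option_map (Nat.add k) r.
Definition msh (k : nat) (m : mono) : mono := let '(c, a, b) := m in (c, rsh k a, rsh k b).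
Definition esh (k : nat) (e : list mono * list mono) := (map (msh k) (fst e), map (msh k) (snd e)).

Lemma msum_sh k w l : msum w (map (msh k) l) = msum (fun i => w (k + i)) l.
Proof.
  unfold msum. rewrite map_map. f_equal. apply map_ext. intros [[c a] b].
  destruct a, b; reflexivity.
Qed.

Lemma mono_sh k n L l : Forall (mono_ok n L) l -> Forall (mono_ok (k + n) L) (map (msh k) l).
Proof.
  intros H. apply Forall_map. revert H. apply Forall_impl. intros [[c a] b] (Hc & Ha & Hb).
  destruct a, b; simpl in *; repeat split; lia.
Qed.

Lemma mono_up n n' L l : n <= n' -> Forall (mono_ok n L) l -> Forall (mono_ok n' L) l.
Proof.
  intros H. apply Forall_impl. intros [[c a] b] (Hc & Ha & Hb).
  destruct a, b; simpl in *; repeat split; lia.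
Qed.

Definition sand (s t : sys) : sys :=
  Sys (nv s + nv t) (eqs s ++ map (esh (nv s)) (eqs t))
      (alts s ++ map (Nat.add (nv s)) (alts t))
      (links s ++ map (fun l => (nv s + fst l, snd l)) (links t)).

Lemma sand_wf s t L : wf s L -> wf t L -> wf (sand s t) L.
Proof.
  intros (A1 & A2 & A3) (B1 & B2 & B3). split; [|split]; simpl.
  - intros e He. apply in_app_iff in He. destruct He as [He|He].
    + destruct (A1 e He). split; apply mono_up with (nv s); auto; lia.
    + apply in_map_iff in He. destruct He as (e' & <- & He). destruct (B1 e' He).
      split; now apply mono_sh.
  - intros i Hi. apply in_app_iff in Hi. destruct Hi as [Hi|Hi]; [specialize (A2 i Hi); lia|].
    apply in_map_iff in Hi. destruct Hi as (j & <- & Hj). specialize (B2 j Hj). lia.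
  - intros l Hl. apply in_app_iff in Hl. destruct Hl as [Hl|Hl]; [specialize (A3 l Hl); lia|].
    apply in_map_iff in Hl. destruct Hl as (j & <- & Hj). specialize (B3 j Hj). simpl. lia.
Qed.

Lemma sand_size s t : ssize (sand s t) = ssize s + ssize t.
Proof.
  unfold ssize; simpl. rewrite !length_app, !length_map, map_app, list_sum_app, map_map.
  rewrite (map_ext (fun x => esize (esh (nv s) x)) esize); [lia|].
  intros e. unfold esize, esh; simpl. now rewrite !length_map.
Qed.

Lemma sand_holds s t L v w : holds (sand s t) L v w <->
  holds s L v w /\ holds t L v (fun i => w (nv s + i)).
Proof.
  unfold holds; simpl. split.
  - intros (H1 & H2 & H3). split; (split; [|split]).
    + intros e He. apply H1, in_app_iff; auto.
    + intros i Hi. apply H2, in_app_iff; auto.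
    + intros l Hl. apply H3, in_app_iff; auto.
    + intros e He. specialize (H1 (esh (nv s) e)). simpl in H1. rewrite !msum_sh in H1.
      apply H1, in_app_iff. right. now apply in_map.
    + intros i Hi. apply H2, in_app_iff. right. now apply in_map.
    + intros l Hl. apply (H3 (nv s + fst l, snd l)), in_app_iff. right.
      apply in_map_iff. now exists l.
  - intros ((A1 & A2 & A3) & (B1 & B2 & B3)). split; [|split].
    + intros e He. apply in_app_iff in He. destruct He as [He|He]; [auto|].
      apply in_map_iff in He. destruct He as (e' & <- & He). simpl. rewrite !msum_sh. auto.
    + intros i Hi. apply in_app_iff in Hi. destruct Hi as [Hi|Hi]; [auto|].
      apply in_map_iff in Hi. destruct Hi as (j & <- & Hj). auto.
    + intros l Hl. apply in_app_iff in Hl. destruct Hl as [Hl|Hl]; [auto|].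
      apply in_map_iff in Hl. destruct Hl as (j & <- & Hj). simpl. auto.
Qed.

Lemma E_and m L K1 K2 R1 R2 : E m L K1 R1 -> E m L K2 R2 -> E m L (K1 + K2) (fun v => R1 v /\ R2 v).
Proof.
  intros (s & Ws & Hs & HRs) (t & Wt & Ht & HRt). exists (sand s t).
  split; [now apply sand_wf|]. split; [rewrite sand_size; lia|].
  intros v Hv. rewrite HRs, HRt by assumption. split.
  - intros ((w1 & B1 & H1) & (w2 & B2 & H2)).
    exists (fun i => if i <? nv s then w1 i else w2 (i - nv s)). split.
    + simpl. intros i Hi. destruct (Nat.ltb_spec i (nv s)); [auto|apply B2; lia].
    + apply sand_holds. split.
      * apply (holds_ext s L v w1); [assumption| |assumption].
        intros i Hi. destruct (Nat.ltb_spec i (nv s)); [reflexivity|lia].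
      * apply (holds_ext t L v w2); [assumption| |assumption].
        intros i Hi. destruct (Nat.ltb_spec (nv s + i) (nv s)); [lia|].
        f_equal; lia.
  - intros (w & B & H). apply sand_holds in H. destruct H as [H1 H2]. simpl in B. split.
    + exists w. split; [intros i Hi; apply B; lia|assumption].
    + exists (fun i => w (nv s + i)). split; [intros i Hi; apply B; lia|assumption].
Qed.

Lemma list_sum_cons a l : list_sum (a :: l) = a + list_sum l.
Proof. reflexivity. Qed.

(** The quantified input becomes the unknown [nv s]; the next unknown is the slack in
    [x + slack + 1 = 2 ^ m], which says [x < 2 ^ m]. Links to input 0 turn into equations, the
    others are renumbered. *)
Definition sex (m : nat) (s : sys) : sys :=
  Sys (nv s + 2)
      ((([(0, Some (nv s), None); (0, Some (S (nv s)), None); (0, None, None)], [(m, None, None)])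
        :: map (fun l => ([(0, Some (fst l), None)], [(0, Some (nv s), None)]))
               (filter (fun l => snd l =? 0) (links s))) ++ eqs s)
      (alts s)
      (map (fun l => (fst l, pred (snd l))) (filter (fun l => negb (snd l =? 0)) (links s))).

Lemma filter_split {A} (p : A -> bool) l :
  length (filter p l) + length (filter (fun a => negb (p a)) l) = length l.
Proof. induction l as [|a l IH]; simpl; [reflexivity|]. destruct (p a); simpl; lia. Qed.

(** The cost 7 is two unknowns and one equation of size 5; a link of weight 4 pays for the equation
    of size 3 that replaces it. *)
Lemma E_ex m L K R : m <= L -> E m L K R ->
  E m L (K + 7) (fun v => exists x, x < 2 ^ m /\ R (x .: v)).
Proof.
  intros Hm (s & (W1 & W2 & W3) & Hs & HR). exists (sex m s). split; [|split].
  - split; [|split]; simpl.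
    + intros e [<-|He]; [simpl; split; repeat constructor; simpl; lia|].
      apply in_app_iff in He. destruct He as [He|He].
      * apply in_map_iff in He. destruct He as (l & <- & Hl). apply filter_In in Hl.
        specialize (W3 l (proj1 Hl)). simpl; split; repeat constructor; simpl; lia.
      * destruct (W1 e He). split; apply mono_up with (nv s); auto; lia.
    + intros i Hi. specialize (W2 i Hi); lia.
    + intros l Hl. apply in_map_iff in Hl. destruct Hl as (l' & <- & Hl). apply filter_In in Hl.
      specialize (W3 l' (proj1 Hl)). simpl; lia.
  - unfold ssize in *.
    assert (He : list_sum (map esize (eqs (sex m s))) =
      5 + 3 * length (filter (fun l => snd l =? 0) (links s)) + list_sum (map esize (eqs s))).
    { cbn [sex eqs app map]. rewrite list_sum_cons, map_app, map_map, list_sum_app.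
      rewrite (map_ext _ (fun _ => 3)) by reflexivity. rewrite list_sum_map_const.
      match goal with |- esize ?e + _ = _ => change (esize e) with 5 end.
      rewrite Nat.add_assoc, (Nat.mul_comm _ 3). reflexivity. }
    rewrite He. cbn [sex nv alts links]. rewrite length_map.
    pose proof (filter_split (fun l => snd l =? 0) (links s)). lia.
  - intros v Hv. split.
    + intros (x & Hx & H). apply HR in H; [|now apply bounded_scons].
      destruct H as (w & B & H1 & H2 & H3).
      exists (fun i => if i <? nv s then w i else if i =? nv s then x else 2 ^ m - 1 - x).
      assert (Hw : forall i, i < nv s -> w i = (if i <? nv s then w i else if i =? nv s then x else 2 ^ m - 1 - x)).
      { intros i Hi. destruct (Nat.ltb_spec i (nv s)); [reflexivity|lia]. }
      pose proof (pow2_le _ _ Hm). split; [|split; [|split]]; simpl.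
      * intros i Hi. destruct (Nat.ltb_spec i (nv s)); [auto|]. destruct (i =? nv s); lia.
      * intros e [<-|He].
        -- unfold msum; cbn [map list_sum fold_right fst snd mval oval].
           rewrite Nat.ltb_irrefl, Nat.eqb_refl. destruct (Nat.ltb_spec (S (nv s)) (nv s)); [lia|].
           destruct (Nat.eqb_spec (S (nv s)) (nv s)); [lia|].
           simpl (2 ^ 0). lia.
        -- apply in_app_iff in He. destruct He as [He|He].
           ++ apply in_map_iff in He. destruct He as (l & <- & Hl). apply filter_In in Hl.
              destruct Hl as [Hl E0]. apply Nat.eqb_eq in E0. specialize (H3 l Hl). rewrite E0 in H3.
              unfold msum; simpl. rewrite Nat.ltb_irrefl, Nat.eqb_refl, <- Hw, H3 by auto. reflexivity.
           ++ destruct (W1 e He) as [Wa Wb].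
              rewrite <- (msum_ext _ _ w _ _ Hw Wa), <- (msum_ext _ _ w _ _ Hw Wb). auto.
      * intros i Hi. rewrite <- Hw by auto. auto.
      * intros l Hl. apply in_map_iff in Hl. destruct Hl as ([i k] & <- & Hl). apply filter_In in Hl.
        destruct Hl as [Hl E0]. simpl in *. specialize (H3 _ Hl). specialize (W3 _ Hl). simpl in *.
        rewrite <- Hw by assumption. rewrite H3. destruct k; [easy|reflexivity].
    + intros (w & B & H1 & H2 & H3). simpl in *.
      exists (w (nv s)).
      assert (Hx := H1 _ (or_introl eq_refl)). unfold msum in Hx; simpl in Hx.
      assert (Hx' : w (nv s) < 2 ^ m) by lia.
      split; [exact Hx'|]. apply HR; [now apply bounded_scons|].
      exists w. split; [intros i Hi; apply B; lia|]. split; [|split].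
      * intros e He. apply H1. right. apply in_app_iff; auto.
      * exact H2.
      * intros [i k] Hl. simpl. destruct k as [|k]; simpl.
        -- specialize (H1 ([(0, Some i, None)], [(0, Some (nv s), None)])).
           unfold msum in H1; simpl in H1. rewrite !Nat.add_0_r, !Nat.mul_1_r in H1. apply H1. right.
           apply in_app_iff. left. apply in_map_iff. exists (i, 0). split; [reflexivity|].
           apply filter_In. auto.
        -- apply (H3 (i, k)). apply in_map_iff. exists (i, S k). split; [reflexivity|].
           apply filter_In. auto.
Qed.

(** Each of the [r] inputs costs 5: an unknown and a link of weight 4. *)
Lemma E_eq m L r l1 l2 : m <= L -> Forall (mono_ok r L) l1 -> Forall (mono_ok r L) l2 ->
  E m L (5 * r + 1 + length l1 + length l2) (fun v => msum v l1 = msum v l2).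
Proof.
  intros Hm H1 H2. exists (Sys r [(l1, l2)] [] (map (fun i => (i, i)) (seq 0 r))). split; [|split].
  - split; [|split]; simpl.
    + intros e [<-|[]]. auto.
    + easy.
    + intros l Hl. apply in_map_iff in Hl. destruct Hl as (i & <- & Hi). apply in_seq in Hi. simpl; lia.
  - unfold ssize; simpl. rewrite length_map, length_seq. unfold esize; simpl. lia.
  - intros v Hv. unfold holds; simpl. split.
    + intros H. exists v. split; [intros i _; now apply (bounded_le m L)|]. split; [|split].
      * intros e [<-|[]]. exact H.
      * easy.
      * intros l Hl. apply in_map_iff in Hl. destruct Hl as (i & <- & Hi). reflexivity.
    + intros (w & B & Hw & _ & Hl). specialize (Hw _ (or_introl eq_refl)). simpl in Hw.
      assert (Hwv : forall i, i < r -> w i = v i).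
      { intros i Hi. apply (Hl (i, i)). apply in_map_iff. exists i. split; [reflexivity|].
        apply in_seq; lia. }
      rewrite <- (msum_ext _ _ w v _ Hwv H1), <- (msum_ext _ _ w v _ Hwv H2). exact Hw.
Qed.

Lemma E_alt m L : m <= L -> E m L 6 (fun v => Alt L (v 0)).
Proof.
  intros Hm. exists (Sys 1 [] [0] [(0, 0)]). split; [|split].
  - split; [|split]; simpl; [easy| |]; [intros i [<-|[]]|intros l [<-|[]]]; simpl; lia.
  - unfold ssize; simpl; lia.
  - intros v Hv. unfold holds; simpl. split.
    + intros H. exists v. split; [intros i _; now apply (bounded_le m L)|].
      split; [easy|]. split; [intros i [<-|[]]; exact H|intros l [<-|[]]; reflexivity].
    + intros (w & _ & _ & Ha & Hl). specialize (Ha 0 (or_introl eq_refl)).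
      specialize (Hl _ (or_introl eq_refl)). simpl in Hl. now rewrite <- Hl.
Qed.

Definition mk (c : nat) : mono := (c, None, None).
Definition mv (i : nat) : mono := (0, Some i, None).
Definition mp (i j : nat) : mono := (0, Some i, Some j).
Definition mcv (c i : nat) : mono := (c, Some i, None).
Definition mcp (c i j : nat) : mono := (c, Some i, Some j).

Ltac msimp := unfold msum, mk, mv, mp, mcv, mcp;
  cbn [map list_sum fold_right mval oval scons];
  rewrite ?Nat.pow_0_r, ?Nat.mul_1_r, ?Nat.mul_1_l, ?Nat.add_0_r.
Ltac okm := repeat constructor; simpl; lia.

Ltac eeq r l1 l2 := apply (E_eq _ _ r l1 l2); [lia|okm|okm].

Lemma div_le a b : a / b <= a.
Proof.
  destruct (Nat.eq_dec b 0) as [->|Hb]; [simpl; lia|]. apply Nat.Div0.div_le_upper_bound; nia.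
Qed.

(** * Arithmetic operations as solvability relations *)

Section Graphs.
Variable L : nat.
Hypothesis HL1 : 1 <= L.

Lemma one_lt : 1 < 2 ^ L.
Proof. apply (pow2_lt 0 L); lia. Qed.

(** The intermediate values are quantified existentially; the bounds ensure that they are found
    among the [L]-bit numbers. *)
Lemma E_comp2 K K1 K2 (Q : nat -> nat -> nat -> Prop) (f1 f2 : (nat -> nat) -> nat) :
  E L L K (fun v => Q (v 0) (v 1) (v 2)) ->
  E L L K1 (fun v => v 0 = f1 (etl v)) -> E L L K2 (fun v => v 0 = f2 (etl v)) ->
  (forall v, bounded L v -> f1 v < 2 ^ L) -> (forall v, bounded L v -> f2 v < 2 ^ L) ->
  E L L (K + K1 + K2 + 14) (fun v => Q (v 0) (f1 (etl v)) (f2 (etl v))).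
Proof.
  intros HQ H1 H2 B1 B2.
  apply (E_ren _ _ _ _ (fun i => match i with 0 => 2 | 1 => 0 | S (S j) => S j end)) in HQ.
  apply (E_ren _ _ _ _ (fun i => match i with 0 => 0 | S j => 3 + j end)) in H1.
  apply (E_ren _ _ _ _ (fun i => match i with 0 => 1 | S j => 3 + j end)) in H2.
  pose proof (E_and _ _ _ _ _ _ HQ (E_and _ _ _ _ _ _ H1 H2)) as H.
  apply E_ex in H; [|lia]. apply E_ex in H; [|lia].
  apply (E_size _ _ (K + (K1 + K2) + 7 + 7)); [lia|]. revert H. apply E_iff.
  intros v Hv. split.
  - intros (x & _ & z & _ & Hq & Ez & Ex). change (Q (v 0) z x) in Hq.
    change (z = f1 (etl v)) in Ez. change (x = f2 (etl v)) in Ex. now rewrite <- Ez, <- Ex.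
  - intros Hq. exists (f2 (etl v)). split; [apply B2; intros i; apply Hv|].
    exists (f1 (etl v)). split; [apply B1; intros i; apply Hv|]. split; [exact Hq|]. split; reflexivity.
Qed.

Lemma E_comp1 K K1 (Q : nat -> nat -> Prop) (f1 : (nat -> nat) -> nat) :
  E L L K (fun v => Q (v 0) (v 1)) -> E L L K1 (fun v => v 0 = f1 (etl v)) ->
  (forall v, bounded L v -> f1 v < 2 ^ L) ->
  E L L (K + K1 + 7) (fun v => Q (v 0) (f1 (etl v))).
Proof.
  intros HQ H1 B1.
  apply (E_ren _ _ _ _ (fun i => match i with 0 => 1 | S j => 0 end)) in HQ.
  apply (E_ren _ _ _ _ (fun i => match i with 0 => 0 | S j => 2 + j end)) in H1.
  pose proof (E_and _ _ _ _ _ _ HQ H1) as H.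
  apply E_ex in H; [|lia]. revert H. apply E_iff.
  intros v Hv. split.
  - intros (x & _ & Hq & Ex). change (Q (v 0) x) in Hq. change (x = f1 (etl v)) in Ex. now rewrite <- Ex.
  - intros Hq. exists (f1 (etl v)). split; [apply B1; intros i; apply Hv|]. split; [exact Hq|reflexivity].
Qed.

Lemma E_lt n : n <= L -> E L L 22 (fun v => v 0 < 2 ^ n).
Proof.
  intros Hn. eapply E_size; [|eapply E_iff; [|eapply E_ex; [lia|eeq 2 [mv 0; mv 1; mk 0] [mk n]]]]; [simpl; lia|].
  intros v Hv. msimp. pose proof (pow2_le _ _ Hn) as Hp. split.
  - intros (x & _ & H). lia.
  - intros H. exists (2 ^ n - 1 - v 0). lia.
Qed.

Lemma E_modn n : n <= L -> E L L 60 (fun v => v 0 = v 1 mod 2 ^ n).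
Proof.
  intros Hn. eapply E_size; [|eapply E_iff; [|eapply E_ex; [lia|eapply E_and;
    [eeq 3 [mv 2] [mv 1; mcv n 0]|apply (E_ren _ _ _ _ (fun i => S i) (E_lt n Hn))]]]]; [simpl; lia|].
  intros v Hv. msimp. split.
  - intros (h & _ & H1 & H2). apply (Nat.mod_unique _ _ h); [exact H2|lia].
  - intros ->. exists (v 1 / 2 ^ n). split; [|split].
    + apply Nat.le_lt_trans with (2 := Hv 1). apply Nat.Div0.div_le_upper_bound.
      pose proof (pow2_pos n); nia.
    + pose proof (Nat.div_mod (v 1) (2 ^ n) (pow2_ne n)). lia.
    + apply Nat.mod_upper_bound, pow2_ne.
Qed.

Lemma E_add : E L L 30 (fun v => v 0 = v 1 + v 2).
Proof.
  eapply E_size; [|eapply E_iff; [|eeq 3 [mv 0] [mv 1; mv 2]]]; [simpl; lia|].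
  intros v Hv. msimp. reflexivity.
Qed.

Lemma E_mul : E L L 30 (fun v => v 0 = v 1 * v 2).
Proof.
  eapply E_size; [|eapply E_iff; [|eeq 3 [mv 0] [mp 1 2]]]; [simpl; lia|].
  intros v Hv. msimp. reflexivity.
Qed.

Lemma E_const c : c <= L -> E L L 10 (fun v => v 0 = 2 ^ c).
Proof.
  intros Hc. eapply E_size; [|eapply E_iff; [|eeq 1 [mv 0] [mk c]]]; [simpl; lia|].
  intros v Hv. msimp. reflexivity.
Qed.

Lemma E_zero : E L L 10 (fun v => v 0 = 0).
Proof.
  eapply E_size; [|eapply E_iff; [|eeq 1 [mv 0] (@nil mono)]]; [simpl; lia|].
  intros v Hv. msimp. reflexivity.
Qed.

Lemma E_ones c : c <= L -> E L L 10 (fun v => v 0 = 2 ^ c - 1).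
Proof.
  intros Hc. eapply E_size; [|eapply E_iff; [|eeq 1 [mv 0; mk 0] [mk c]]]; [simpl; lia|].
  intros v Hv. msimp. pose proof (pow2_pos c). lia.
Qed.

Lemma E_var i : E L L 20 (fun v => v 0 = v (S i)).
Proof.
  assert (H : E L L 20 (fun v => v 0 = v 1)).
  { eapply E_size; [|eapply E_iff; [|eeq 2 [mv 0] [mv 1]]]; [simpl; lia|].
    intros v Hv. msimp. reflexivity. }
  exact (E_ren _ _ _ _ (fun j => match j with 0 => 0 | _ => S i end) H).
Qed.

(** With [z] the result, [z * z = z] makes it a bit, [z * v 1 = 0] makes it 0 for a nonzero
    argument, and [z + v 1 = 1 + x] excludes that both vanish. *)
Lemma E_isz : E L L 80 (fun v => v 0 = Nat.b2n (v 1 =? 0)).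
Proof.
  eapply E_size; [|eapply E_iff; [|eapply E_ex; [lia|eapply E_and; [eeq 3 [mp 1 1] [mv 1]|
    eapply E_and; [eeq 3 [mp 1 2] (@nil mono)|eeq 3 [mv 1; mv 2] [mk 0; mv 0]]]]]]; [simpl; lia|].
  intros v Hv. msimp. pose proof (Hv 1). destruct (Nat.eqb_spec (v 1) 0) as [E0|E0]; simpl Nat.b2n.
  - rewrite E0. split; [intros (x & _ & H1 & _ & H2); nia|]. intros ->. exists 0. lia.
  - split; [intros (x & _ & H1 & H2 & H3); nia|]. intros ->. exists (v 1 - 1). lia.
Qed.

(** With [t] the bit that says [b = 0], the last equation is [r + 1 + slack = b + t * r + t]: it
    means [r < b] when [t = 0] and holds with slack 0 when [t = 1]. In the latter case [t * z = 0]
    enforces the default quotient 0. *)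
Lemma E_div : E L L 400 (fun v => v 0 = v 1 / v 2).
Proof.
  (* indices: 0 = t, 1 = r, 2 = slack, 3, 4, 5 = z, a, b *)
  eapply E_size; [|eapply E_iff; [|eapply E_ex; [lia|eapply E_ex; [lia|eapply E_ex; [lia|
    eapply E_and; [apply (E_ren _ _ _ _ (fun i => match i with 0 => 0 | _ => 5 end) E_isz)|
    eapply E_and; [eeq 6 [mp 3 5; mv 1] [mv 4]|
    eapply E_and; [eeq 6 [mp 0 3] (@nil mono)|eeq 6 [mv 1; mk 0; mv 2] [mv 5; mp 0 1; mv 0]]]]]]]]];
    [simpl; lia|].
  intros v Hv. msimp. pose proof (Hv 1) as A1. pose proof (Hv 2) as A2. split.
  - intros (s & _ & r & _ & t & _ & Ht & H1 & H2 & H3).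
    destruct (Nat.eqb_spec (v 2) 0) as [E0|E0]; simpl in Ht; subst t.
    + rewrite E0. simpl. lia.
    + apply Nat.div_unique with r; lia.
  - intros H. destruct (Nat.eqb_spec (v 2) 0) as [E0|E0].
    + rewrite E0 in H. simpl in H. exists 0. split; [lia|]. exists (v 1). split; [lia|]. exists 1.
      pose proof one_lt. rewrite H, E0. simpl. lia.
    + exists (v 2 - 1 - v 1 mod v 2). split; [lia|]. exists (v 1 mod v 2).
      pose proof (Nat.mod_upper_bound (v 1) (v 2) E0). split; [lia|]. exists 0.
      pose proof (Nat.div_mod (v 1) (v 2) E0). simpl. rewrite H. repeat split; lia.
Qed.

Lemma E_mod : E L L 500 (fun v => v 0 = v 1 mod v 2).
Proof.
  eapply E_size; [|eapply E_iff; [|eapply E_ex; [lia|eapply E_and;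
    [apply (E_ren _ _ _ _ (fun i => match i with 0 => 0 | S j => S (S j) end) E_div)|
     eeq 4 [mv 2] [mp 0 3; mv 1]]]]]; [simpl; lia|].
  intros v Hv. msimp. split.
  - intros (q & _ & -> & H). destruct (Nat.eq_dec (v 2) 0) as [E0|E0].
    + rewrite E0 in *. rewrite Nat.mod_0_r. lia.
    + pose proof (Nat.div_mod (v 1) (v 2) E0). lia.
  - intros ->. exists (v 1 / v 2). split; [|split; [reflexivity|]].
    + apply Nat.le_lt_trans with (2 := Hv 1), div_le.
    + destruct (Nat.eq_dec (v 2) 0) as [E0|E0]; [rewrite E0, Nat.mod_0_r; lia|].
      pose proof (Nat.div_mod (v 1) (v 2) E0). lia.
Qed.

(** Two slacks give the upper-bound property; their product being 0 says that one bound is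
    attained. *)
Lemma E_max : E L L 200 (fun v => v 0 = Nat.max (v 1) (v 2)).
Proof.
  eapply E_size; [|eapply E_iff; [|eapply E_ex; [lia|eapply E_ex; [lia|
    eapply E_and; [eeq 5 [mv 2] [mv 3; mv 0]|eapply E_and; [eeq 5 [mv 2] [mv 4; mv 1]|
      eeq 5 [mp 0 1] (@nil mono)]]]]]]; [simpl; lia|].
  intros v Hv. msimp. pose proof (Hv 1). pose proof (Hv 2). split.
  - intros (s & _ & t & _ & H1 & H2 & H3). assert (H4 : t * s = 0) by lia. apply Nat.eq_mul_0 in H4. lia.
  - intros E0. exists (v 0 - v 2). split; [lia|]. exists (v 0 - v 1). split; [lia|].
    split; [lia|]. split; [lia|].
    enough ((v 0 - v 1) * (v 0 - v 2) = 0) by lia. apply Nat.eq_mul_0. lia.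
Qed.

Lemma E_min : E L L 200 (fun v => v 0 = Nat.min (v 1) (v 2)).
Proof.
  eapply E_size; [|eapply E_iff; [|eapply E_ex; [lia|eapply E_ex; [lia|
    eapply E_and; [eeq 5 [mv 3] [mv 2; mv 0]|eapply E_and; [eeq 5 [mv 4] [mv 2; mv 1]|
      eeq 5 [mp 0 1] (@nil mono)]]]]]]; [simpl; lia|].
  intros v Hv. msimp. pose proof (Hv 1). pose proof (Hv 2). split.
  - intros (s & _ & t & _ & H1 & H2 & H3). assert (H4 : t * s = 0) by lia. apply Nat.eq_mul_0 in H4. lia.
  - intros E0. exists (v 2 - v 0). split; [lia|]. exists (v 1 - v 0). split; [lia|].
    split; [lia|]. split; [lia|].
    enough ((v 1 - v 0) * (v 2 - v 0) = 0) by lia. apply Nat.eq_mul_0. lia.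
Qed.

(** Square-and-multiply from the top bit [b] of the exponent: [a = a' + 2 ^ t * b], and [z] is [z']
    or [2 ^ 2 ^ t * z'], written without subtraction as [z + b * z' = z' + 2 ^ 2 ^ t * b * z']. The
    size is linear in the length of the exponent. *)
Lemma E_pow2 t : 2 ^ t <= L -> E L L (300 * (t + 1)) (fun v => v 0 = 2 ^ v 1 /\ v 1 < 2 ^ t).
Proof.
  induction t as [|t IH]; intros Ht.
  - eapply E_size; [|eapply E_iff; [|eapply E_and; [eeq 2 [mv 0] [mk 0]|eeq 2 [mv 1] (@nil mono)]]]; [simpl; lia|].
    intros v Hv. msimp. simpl. split; intros [H1 H2].
    + rewrite H2. simpl. lia.
    + assert (E1 : v 1 = 0) by lia. rewrite E1 in *. simpl in H1. lia.
  - rewrite Nat.pow_succ_r' in Ht. specialize (IH ltac:(lia)).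
    pose proof (pow2_gt t) as Hgt.
    (* indices: 0 = b, 1 = z', 2 = a', 3 = z, 4 = a *)
    eapply E_size; [|eapply E_iff; [|eapply E_ex; [lia|eapply E_ex; [lia|eapply E_ex; [lia|
      eapply E_and; [apply (E_ren _ _ _ _ (fun i => S i) IH)|
      eapply E_and; [eeq 5 [mp 0 0] [mv 0]|
      eapply E_and; [eeq 5 [mv 4] [mv 2; mcv t 0]|
                     eeq 5 [mv 3; mp 0 1] [mv 1; mcp (2 ^ t) 0 1]]]]]]]]]; [simpl length; lia|].
    intros v Hv. msimp. split.
    + intros (a' & _ & z' & _ & b & _ & (H1 & H2) & H3 & H4 & H5).
      cbn [scons] in H1, H2.
      assert (E4 : v 1 = a' + 2 ^ t * b) by lia.
      assert (E5 : v 0 + b * z' = z' + 2 ^ 2 ^ t * (b * z')) by lia.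
      assert (Hb : b = 0 \/ b = 1) by nia. clear H3 H4 H5. rewrite Nat.pow_succ_r'. destruct Hb; subst b.
      * rewrite Nat.mul_0_r, Nat.add_0_r in E4. subst a'. split; lia.
      * rewrite E4, Nat.mul_1_r, Nat.pow_add_r, <- H1. split; nia.
    + intros [H1 H2]. rewrite Nat.pow_succ_r' in H2.
      assert (HL : forall x, x < 2 ^ t -> x < 2 ^ L /\ 2 ^ x < 2 ^ L).
      { intros x Hx. pose proof (pow2_gt L). split; [|apply pow2_lt]; lia. }
      pose proof one_lt.
      destruct (Nat.lt_ge_cases (v 1) (2 ^ t)) as [Hc|Hc].
      * destruct (HL _ Hc). exists (v 1). split; [lia|]. exists (2 ^ v 1). split; [lia|]. exists 0.
        rewrite H1. repeat split; lia.
      * destruct (HL (v 1 - 2 ^ t) ltac:(lia)). exists (v 1 - 2 ^ t). split; [lia|].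
        exists (2 ^ (v 1 - 2 ^ t)). split; [lia|]. exists 1.
        repeat split; try lia. rewrite H1.
        replace (v 1) with (2 ^ t + (v 1 - 2 ^ t)) at 1 by lia. rewrite Nat.pow_add_r. lia.
Qed.

(** * Bitwise conjunction by carry-free addition *)

Definition emask (j : nat) : nat := (2 ^ (2 * j) - 1) / 3.

Lemma emask_S j : emask (S j) = 2 * (2 * emask j) + 1.
Proof.
  assert (H : forall j, exists k, 2 ^ (2 * j) = 3 * k + 1).
  { clear j. intros j. induction j as [|j [k IH]]; [exists 0; reflexivity|].
    exists (4 * k + 1). replace (2 * S j) with (2 + 2 * j) by lia. rewrite Nat.pow_add_r, IH. simpl. lia. }
  destruct (H j) as [k Hk]. unfold emask.
  replace (2 * S j) with (2 + 2 * j) by lia. rewrite Nat.pow_add_r, Hk. change (2 ^ 2) with 4.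
  replace (4 * (3 * k + 1) - 1) with ((4 * k + 1) * 3) by lia.
  replace (3 * k + 1 - 1) with (k * 3) by lia. rewrite !Nat.div_mul by lia. lia.
Qed.

Lemma emask_bits j t : Nat.testbit (emask j) t = Nat.even t && (t <? 2 * j).
Proof.
  revert t. induction j as [|j IH]; intros t.
  - rewrite andb_false_r. apply Nat.bits_0.
  - rewrite emask_S. destruct t as [|[|t]].
    + now rewrite Nat.testbit_odd_0.
    + rewrite Nat.testbit_odd_succ', Nat.testbit_even_0. reflexivity.
    + rewrite Nat.testbit_odd_succ', Nat.testbit_even_succ', IH.
      change (Nat.even (S (S t))) with (Nat.even t). f_equal.
      destruct (Nat.ltb_spec t (2 * j)), (Nat.ltb_spec (S (S t)) (2 * S j)); lia.
Qed.

Hypothesis HL : Nat.Even L.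

Definition alt (x : nat) : Prop := forall t, Nat.even t = false -> Nat.testbit x t = false.

Lemma Alt_alt x : x < 2 ^ L -> (Alt L x <-> alt x).
Proof.
  intros Hx. destruct HL as [j Hj]. unfold Alt. rewrite Hj. change ((2 ^ (2 * j) - 1) / 3) with (emask j).
  rewrite Nat.mul_comm. split.
  - intros H t Ht. apply (f_equal (fun x => Nat.testbit x t)) in H.
    rewrite Nat.land_spec, Nat.bits_0 in H. destruct t as [|t]; [easy|].
    rewrite Nat.testbit_even_succ', emask_bits in H.
    rewrite Nat.even_succ, <- Nat.negb_even in Ht. apply negb_false_iff in Ht. rewrite Ht, andb_true_l in H.
    destruct (Nat.ltb_spec t (2 * j)) as [Hl|Hl]; [now rewrite andb_true_r in H|].
    apply (testbit_small L); lia.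
  - intros H. apply Nat.bits_inj. intros t. rewrite Nat.land_spec, Nat.bits_0.
    destruct (Nat.even t) eqn:Et; [|now rewrite H].
    destruct t as [|t]; [rewrite Nat.testbit_even_0; apply andb_false_r|].
    rewrite Nat.testbit_even_succ', emask_bits.
    rewrite Nat.even_succ, <- Nat.negb_even in Et. apply negb_true_iff in Et. rewrite Et. apply andb_false_r.
Qed.

Lemma alt_disjoint x z : alt x -> alt z -> Nat.land x (2 * z) = 0.
Proof.
  intros Hx Hz. apply Nat.bits_inj. intros t. rewrite Nat.land_spec, Nat.bits_0.
  destruct (Nat.even t) eqn:Et; [|now rewrite Hx].
  destruct t as [|t]; [rewrite Nat.testbit_even_0; apply andb_false_r|].
  rewrite Nat.testbit_even_succ', Hz; [apply andb_false_r|].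
  rewrite Nat.even_succ, <- Nat.negb_even in Et. now apply negb_true_iff in Et.
Qed.

Lemma alt_pair_bits x z t : alt x -> alt z -> Nat.testbit (x + 2 * z) t =
  if Nat.even t then Nat.testbit x t else Nat.testbit z (pred t).
Proof.
  intros Hx Hz. rewrite Nat.add_nocarry_lxor by now apply alt_disjoint. rewrite Nat.lxor_spec.
  destruct (Nat.even t) eqn:Et.
  - destruct t as [|t]; [now rewrite Nat.testbit_even_0, xorb_false_r|].
    rewrite Nat.testbit_even_succ', Hz; [apply xorb_false_r|].
    rewrite Nat.even_succ, <- Nat.negb_even in Et. now apply negb_true_iff in Et.
  - rewrite Hx by assumption. destruct t as [|t]; [easy|].
    rewrite Nat.testbit_even_succ'. apply xorb_false_l.
Qed.

Lemma alt_land x z : alt x -> alt (Nat.land x z).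
Proof. intros H t Ht. rewrite Nat.land_spec, H by assumption. reflexivity. Qed.

Lemma add_lxor_land a b : a + b = Nat.lxor a b + 2 * Nat.land a b.
Proof.
  revert b. induction a as [a IH] using lt_wf_ind. intros b.
  destruct (Nat.eq_dec a 0) as [->|Ha].
  - rewrite Nat.lxor_0_l, Nat.land_0_l. lia.
  - pose proof (Nat.div2_odd a) as Ea. pose proof (Nat.div2_odd b) as Eb.
    assert (Hlt : Nat.div2 a < a) by (apply Nat.lt_div2; lia).
    specialize (IH _ Hlt (Nat.div2 b)).
    pose proof (Nat.div2_odd (Nat.lxor a b)) as Ex. pose proof (Nat.div2_odd (Nat.land a b)) as En.
    rewrite !Nat.div2_div in *.
    assert (X1 : Nat.lxor a b / 2 = Nat.lxor (a / 2) (b / 2)).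
    { rewrite <- !Nat.div2_div, !Nat.div2_spec. apply Nat.shiftr_lxor. }
    assert (X2 : Nat.land a b / 2 = Nat.land (a / 2) (b / 2)).
    { rewrite <- !Nat.div2_div, !Nat.div2_spec. apply Nat.shiftr_land. }
    rewrite X1 in Ex. rewrite X2 in En.
    rewrite <- !Nat.bit0_odd, Nat.lxor_spec in Ex. rewrite <- !Nat.bit0_odd, Nat.land_spec in En.
    rewrite <- Nat.bit0_odd in Ea, Eb.
    destruct (Nat.testbit a 0), (Nat.testbit b 0); simpl Nat.b2n in *; simpl xorb in *; simpl andb in *; simpl Nat.b2n in *; lia.
Qed.

Lemma alt_lxor x z : alt x -> alt z -> alt (Nat.lxor x z).
Proof. intros Hx Hz t Ht. rewrite Nat.lxor_spec, Hx, Hz by assumption. reflexivity. Qed.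

(** Even bits come from the first summand and odd bits from the second, so the decomposition is
    unique. *)
Lemma alt_inj x z x' z' : alt x -> alt z -> alt x' -> alt z' -> x + 2 * z = x' + 2 * z' -> z = z'.
Proof.
  intros Hx Hz Hx' Hz' H. apply Nat.bits_inj. intros t.
  destruct (Nat.even t) eqn:Et; [|now rewrite Hz, Hz'].
  pose proof (f_equal (fun x => Nat.testbit x (S t)) H) as Hb. cbv beta in Hb.
  rewrite !alt_pair_bits in Hb by assumption.
  rewrite Nat.even_succ, <- Nat.negb_even, Et in Hb. exact Hb.
Qed.

Lemma alt_split x : x < 2 ^ L -> exists x0 x1, x0 < 2 ^ L /\ x1 < 2 ^ L /\ alt x0 /\ alt x1 /\ x = x0 + 2 * x1.
Proof.
  intros Hx. destruct HL as [j Hj].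
  exists (Nat.land x (emask j)), (Nat.land (x / 2) (emask j)).
  assert (He : alt (emask j)) by (intros t Ht; now rewrite emask_bits, Ht).
  assert (A0 : alt (Nat.land x (emask j))) by (rewrite Nat.land_comm; now apply alt_land).
  assert (A1 : alt (Nat.land (x / 2) (emask j))) by (rewrite Nat.land_comm; now apply alt_land).
  split; [apply Nat.le_lt_trans with (2 := Hx), Nat.land_le_l|].
  split; [apply Nat.le_lt_trans with (2 := Hx); etransitivity; [apply Nat.land_le_l|apply Nat.Div0.div_le_upper_bound; lia]|].
  split; [exact A0|]. split; [exact A1|].
  apply Nat.bits_inj. intros t. rewrite alt_pair_bits, !Nat.land_spec, !emask_bits by assumption.
  destruct (Nat.even t) eqn:Et.
  - rewrite andb_true_l. destruct (Nat.ltb_spec t (2 * j)); [now rewrite andb_true_r|].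
    rewrite andb_false_r. apply (testbit_small L); lia.
  - destruct t as [|t]; [easy|]. simpl pred.
    rewrite Nat.even_succ, <- Nat.negb_even in Et. apply negb_false_iff in Et. rewrite Et.
    rewrite <- Nat.div2_div, Nat.testbit_div2, andb_true_l.
    destruct (Nat.ltb_spec t (2 * j)); [now rewrite andb_true_r|].
    rewrite andb_false_r. apply (testbit_small L); lia.
Qed.

Lemma land_pair x0 x1 z0 z1 : alt x0 -> alt x1 -> alt z0 -> alt z1 ->
  Nat.land (x0 + 2 * x1) (z0 + 2 * z1) = Nat.land x0 z0 + 2 * Nat.land x1 z1.
Proof.
  intros. apply Nat.bits_inj. intros t.
  rewrite Nat.land_spec, !alt_pair_bits by (try apply alt_land; assumption).
  rewrite !Nat.land_spec. now destruct (Nat.even t).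
Qed.

Lemma E_half : E L L 70 (fun v => Alt L (v 0) /\ Alt L (v 1) /\ v 2 = v 0 + 2 * v 1).
Proof.
  eapply E_size; [|eapply E_iff; [|eapply E_and; [apply E_alt; lia|eapply E_and;
    [apply (E_ren _ _ _ _ (fun i => S i) (E_alt L L (Nat.le_refl L)))|
     eeq 3 [mv 2] [mv 0; mcv 1 1]]]]]; [simpl; lia|].
  intros v Hv. msimp. rewrite Nat.pow_1_r. reflexivity.
Qed.

(** Numbers with vanishing odd bits are added without carries, so that the high bits
    of the sum are the bitwise conjunction. *)
Lemma E_halfadd : E L L 110 (fun v => Alt L (v 0) /\ Alt L (v 1) /\ v 2 + v 3 = v 0 + 2 * v 1).
Proof.
  eapply E_size; [|eapply E_iff; [|eapply E_and; [apply E_alt; lia|eapply E_and;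
    [apply (E_ren _ _ _ _ (fun i => S i) (E_alt L L (Nat.le_refl L)))|
     eeq 4 [mv 2; mv 3] [mv 0; mcv 1 1]]]]]; [simpl; lia|].
  intros v Hv. msimp. rewrite Nat.pow_1_r. reflexivity.
Qed.

Definition ren3 (a b c : nat) : nat -> nat :=
  fun i => match i with 0 => a | 1 => b | 2 => c | S (S (S j)) => j end.
Definition ren4 (a b c d : nat) : nat -> nat :=
  fun i => match i with 0 => a | 1 => b | 2 => c | 3 => d | S (S (S (S j))) => j end.

(** Both arguments are split into even and odd bits. In each part [a + b] is the exclusive or plus
    twice the conjunction, both alternating, and uniqueness of such a decomposition identifies the
    guessed high part with the conjunction. *)
Lemma E_land : E L L 900 (fun v => v 0 = Nat.land (v 1) (v 2)).
Proof.
  (* indices: 0 1 = a, 2 3 = b, 4 5 = low sum, 6 7 = high sum, 8 9 10 = z a b *)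
  eapply E_size; [|eapply E_iff; [|do 8 (eapply E_ex; [lia|]);
    eapply E_and; [apply (E_ren _ _ _ _ (ren3 0 1 9) E_half)|
    eapply E_and; [apply (E_ren _ _ _ _ (ren3 2 3 10) E_half)|
    eapply E_and; [apply (E_ren _ _ _ _ (ren4 4 5 0 2) E_halfadd)|
    eapply E_and; [apply (E_ren _ _ _ _ (ren4 6 7 1 3) E_halfadd)|
                   apply (E_ren _ _ _ _ (ren3 5 7 8) E_half)]]]]]]; [simpl; lia|].
  intros v Hv. cbn [ren3 ren4 scons]. pose proof (Hv 0) as B0. pose proof (Hv 1) as B1. pose proof (Hv 2) as B2.
  assert (Key : forall a b e c, a < 2 ^ L -> b < 2 ^ L -> e < 2 ^ L -> c < 2 ^ L -> alt a -> alt b ->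
    Alt L e -> Alt L c -> a + b = e + 2 * c -> c = Nat.land a b).
  { intros a b e c Ha Hb He Hc Aa Ab Ae Ac H. apply Alt_alt in Ae, Ac; try assumption.
    rewrite add_lxor_land in H. symmetry. revert H.
    apply alt_inj; auto using alt_lxor, alt_land. }
  split.
  - intros (c1 & C1 & e1 & D1 & c0 & C0 & e0 & D0 & b1 & Hb1 & b0 & Hb0 & a1 & Ha1 & a0 & Ha0 &
      (Aa0 & Aa1 & Ea) & (Ab0 & Ab1 & Eb) & (Ae0 & Ac0 & E0) & (Ae1 & Ac1 & E1) & (_ & _ & Ez)).
    pose proof (proj1 (Alt_alt _ Ha0) Aa0). pose proof (proj1 (Alt_alt _ Ha1) Aa1).
    pose proof (proj1 (Alt_alt _ Hb0) Ab0). pose proof (proj1 (Alt_alt _ Hb1) Ab1).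
    rewrite Ez, Ea, Eb, land_pair by assumption.
    rewrite (Key a0 b0 e0 c0), (Key a1 b1 e1 c1) by assumption. reflexivity.
  - intros Hz. destruct (alt_split _ B1) as (a0 & a1 & Ha0 & Ha1 & Aa0 & Aa1 & Ea).
    destruct (alt_split _ B2) as (b0 & b1 & Hb0 & Hb1 & Ab0 & Ab1 & Eb).
    assert (LX : forall a b, a < 2 ^ L -> b < 2 ^ L -> Nat.lxor a b < 2 ^ L).
    { intros a b Ha Hb. destruct (Nat.eq_dec (Nat.lxor a b) 0) as [->|Hn]; [apply pow2_pos|].
      destruct (Nat.lt_ge_cases (Nat.lxor a b) (2 ^ L)) as [|Hge]; [assumption|exfalso].
      pose proof (Nat.bit_log2 _ Hn) as Hb2. rewrite Nat.lxor_spec in Hb2.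
      assert (L <= Nat.log2 (Nat.lxor a b)) by (apply Nat.log2_le_pow2; lia).
      rewrite !(testbit_small L) in Hb2 by assumption. easy. }
    assert (LA : forall a b, a < 2 ^ L -> Nat.land a b < 2 ^ L).
    { intros a b Ha. apply Nat.le_lt_trans with (2 := Ha), Nat.land_le_l. }
    exists (Nat.land a1 b1). split; [now apply LA|]. exists (Nat.lxor a1 b1). split; [now apply LX|].
    exists (Nat.land a0 b0). split; [now apply LA|]. exists (Nat.lxor a0 b0). split; [now apply LX|].
    exists b1. split; [assumption|]. exists b0. split; [assumption|].
    exists a1. split; [assumption|]. exists a0. split; [assumption|].
    rewrite !Alt_alt by auto.
    repeat split; auto using alt_lxor, alt_land, add_lxor_land.
    rewrite Hz, Ea, Eb. now apply land_pair.
Qed.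
End Graphs.

(** * Simulating formulas and eliminating negations *)

(** Induction step for sizes of the form [(2 ^ h - 1) * A] along a binary tree: two subtrees and the
    cost [c] of their common root. *)
Lemma geo_step2 X1 X2 X A c : 1 <= X1 <= X -> 1 <= X2 <= X -> c <= A ->
  c + (X1 - 1) * A + (X2 - 1) * A <= (2 * X - 1) * A.
Proof.
  intros H1 H2 Hc. assert ((X1 - 1) * A <= (X - 1) * A) by (apply Nat.mul_le_mono_r; lia).
  assert ((X2 - 1) * A <= (X - 1) * A) by (apply Nat.mul_le_mono_r; lia).
  replace (2 * X - 1) with ((X - 1) + (X - 1) + 1) by lia. rewrite !Nat.mul_add_distr_r. lia.
Qed.

Lemma geo_step1 X A c : 1 <= X -> c <= A -> c + (X - 1) * A <= (2 * X - 1) * A.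
Proof. intros H Hc. pose proof (geo_step2 X 1 X A c). lia. Qed.

Section Formulas.
Variable d : nat.
Let n := 2 ^ d.
(** Four times the length of the numbers leaves room for products of two of them and for the sums of
    such products in [E_eqt]. *)
Let L := 2 ^ (d + 2).

Lemma L_4n : L = 4 * n.
Proof. unfold L, n. rewrite Nat.add_comm. apply Nat.pow_add_r. Qed.

Lemma n_pos : 1 <= n.
Proof. apply pow2_pos. Qed.

Lemma L_one : 1 <= L.
Proof. apply pow2_pos. Qed.

Lemma L_even : Nat.Even L.
Proof. exists (2 ^ (d + 1)). unfold L. rewrite <- Nat.pow_succ_r'. f_equal; lia. Qed.

Lemma E_bin f : E L L 1000 (fun v => v 1 < 2 ^ n /\ v 2 < 2 ^ n /\ v 0 = bin_nat n f (v 1) (v 2)).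
Proof.
  pose proof L_4n as HL. pose proof n_pos as Hn. pose proof L_one as HL1. pose proof L_even as HLe.
  assert (Hnl : n <= L) by lia.
  assert (HC : forall K (R : (nat -> nat) -> Prop), K <= 950 -> E L L K R ->
    (forall v, v 1 < 2 ^ n -> v 2 < 2 ^ n -> (R v <-> v 0 = bin_nat n f (v 1) (v 2))) ->
    E L L 1000 (fun v => v 1 < 2 ^ n /\ v 2 < 2 ^ n /\ v 0 = bin_nat n f (v 1) (v 2))).
  { intros K R HK HR Hiff. eapply E_size; [|eapply E_iff; [|eapply E_and;
      [apply (E_ren _ _ _ _ (fun _ => 1) (E_lt L HL1 n Hnl))|eapply E_and;
      [apply (E_ren _ _ _ _ (fun _ => 2) (E_lt L HL1 n Hnl))|exact HR]]]]; [lia|].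
    intros v Hv. specialize (Hiff v). tauto. }
  assert (H2 : 2 ^ (n + n) <= 2 ^ L) by (apply pow2_le; lia).
  rewrite Nat.pow_add_r in H2. pose proof (pow2_gt n) as Hg.
  destruct f; cbn [bin_nat] in *.
  - eapply (HC _ _); [|eapply E_ex; [lia|eapply E_and;
      [apply (E_ren _ _ _ _ (ren3 0 2 3) (E_add L HL1))|
       apply (E_ren _ _ _ _ (fun i => match i with 0 => 1 | _ => 0 end) (E_modn L HL1 n Hnl))]]|]; [lia|].
    intros v H1 H3. cbn [ren3 scons]. split; [intros (t & _ & -> & H); exact H|].
    intros H. exists (v 1 + v 2). split; [nia|auto].
  - eapply (HC _ _); [|eapply E_ex; [lia|eapply E_and;
      [apply (E_ren _ _ _ _ (ren3 0 2 3) (E_mul L HL1))|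
       apply (E_ren _ _ _ _ (fun i => match i with 0 => 1 | _ => 0 end) (E_modn L HL1 n Hnl))]]|]; [lia|].
    intros v H1 H3. cbn [ren3 scons]. split; [intros (t & _ & -> & H); exact H|].
    intros H. exists (v 1 * v 2). split; [nia|auto].
  - eapply (HC _ _); [|apply (E_div L HL1)|]; [lia|].
    intros v _ _. destruct (Nat.eqb_spec (v 2) 0) as [->|_]; reflexivity.
  - eapply (HC _ _); [|apply (E_max L HL1)|]; [lia|]. intros; reflexivity.
  - eapply (HC _ _); [|apply (E_min L HL1)|]; [lia|]. intros; reflexivity.
  - eapply (HC _ _); [|apply (E_land L HL1 HLe)|]; [lia|]. intros; reflexivity.
Qed.

Lemma E_un f : E L L (1000 * (d + 1)) (fun v => v 1 < 2 ^ n /\ v 0 = un_nat n f (v 1)).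
Proof.
  pose proof L_4n as HL. pose proof n_pos as Hn. pose proof L_one as HL1.
  assert (Hnl : n <= L) by lia.
  assert (HC : forall K (R : (nat -> nat) -> Prop), K <= 1000 * (d + 1) - 50 -> E L L K R ->
    (forall v, bounded L v -> v 1 < 2 ^ n -> (R v <-> v 0 = un_nat n f (v 1))) ->
    E L L (1000 * (d + 1)) (fun v => v 1 < 2 ^ n /\ v 0 = un_nat n f (v 1))).
  { intros K R HK HR Hiff. eapply E_size; [|eapply E_iff; [|eapply E_and;
      [apply (E_ren _ _ _ _ (fun _ => 1) (E_lt L HL1 n Hnl))|exact HR]]]; [lia|].
    intros v Hv. specialize (Hiff v Hv). tauto. }
  destruct f; cbn [un_nat] in *.
  - eapply (HC _ _); [|eeq 2 [mv 0; mv 1; mk 0] [mk n]|]; [simpl length; lia|].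
    intros v _ H1. msimp. rewrite lnot_low by assumption. lia.
  (* The argument is [lo + 2 ^ d * h] with [n = 2 ^ d], and [t] is the bit that says [h = 0]. The
     last equation, [z + 1 + 2 ^ n * t = t * 2 ^ lo + 2 ^ n + t], selects [2 ^ lo] for [t = 1] and
     the cut-off value [2 ^ n - 1] for [t = 0]. *)
  - assert (HdL : 2 ^ d <= L) by exact Hnl. pose proof (pow2_gt d) as Hd.
    eapply (HC _ _); [|do 4 (eapply E_ex; [lia|]);
      eapply E_and; [apply (E_ren _ _ _ _ (fun i => match i with 0 => 1 | _ => 2 end) (E_pow2 L HL1 d HdL))|
      eapply E_and; [apply (E_ren _ _ _ _ (fun i => match i with 0 => 0 | _ => 3 end) (E_isz L HL1))|
      eapply E_and; [eeq 6 [mv 5] [mv 2; mcv d 3]|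
                     eeq 6 [mv 4; mk 0; mcv n 0] [mp 0 1; mk n; mv 0]]]]|]; [simpl length; lia|].
    intros v Hv H1. msimp. pose proof (pow2_pos n) as Hp.
    assert (Hdn : 2 ^ d <> 0) by apply pow2_ne. split.
    + intros (h & _ & lo & _ & z' & _ & t & _ & (E1 & E2) & E3 & E4 & E5).
      cbn [scons] in E1, E2, E3.
      assert (E4' : v 1 = lo + 2 ^ d * h) by lia. clear E4.
      destruct (Nat.eqb_spec h 0) as [->|Hh]; simpl in E3; subst t.
      * rewrite Nat.mul_0_r, Nat.add_0_r in E4'. rewrite E4'.
        pose proof (pow2_lt _ _ E2) as E6. fold n in E6. lia.
      * assert (n <= v 1) by (unfold n; nia). assert (2 ^ n <= 2 ^ v 1) by now apply pow2_le. lia.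
    + intros H. set (h := v 1 / 2 ^ d). set (lo := v 1 mod 2 ^ d).
      assert (Hdm : v 1 = 2 ^ d * h + lo) by (now apply Nat.div_mod).
      assert (Hlo : lo < 2 ^ d) by now apply Nat.mod_upper_bound.
      assert (Hnp : 2 ^ n <= 2 ^ L) by now apply pow2_le.
      pose proof (pow2_lt _ _ Hlo) as Hz. fold n in Hz.
      assert (h <= v 1) by nia. pose proof (pow2_gt lo).
      exists h. split; [lia|]. exists lo. split; [lia|]. exists (2 ^ lo). split; [lia|].
      exists (Nat.b2n (h =? 0)). split; [destruct (h =? 0); simpl; [apply (pow2_lt 0 L)|]; lia|].
      cbn [scons]. split; [split; [reflexivity|assumption]|]. split; [reflexivity|]. split; [lia|].
      destruct (Nat.eqb_spec h 0) as [E0|E0]; simpl Nat.b2n.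
      * rewrite E0, Nat.mul_0_r, Nat.add_0_l in Hdm. rewrite Hdm in H. lia.
      * assert (n <= v 1) by (unfold n; nia). assert (2 ^ n <= 2 ^ v 1) by now apply pow2_le. lia.
Qed.

Lemma E_cst c : E L L 20 (fun v => v 0 = cst_nat n c).
Proof.
  pose proof L_4n as HL. pose proof n_pos as Hn. pose proof (pow2_gt d) as Hg. fold n in Hg.
  destruct c; cbn [cst_nat].
  - apply (E_size _ _ 10); [lia|]. exact (E_zero L L_one).
  - apply (E_size _ _ 10); [lia|]. eapply E_iff; [|apply (E_const L L_one 0); lia]. intros; reflexivity.
  - apply (E_size _ _ 10); [lia|]. apply (E_ones L L_one); lia.
  - apply (E_size _ _ 10); [lia|]. unfold n. apply (E_const L L_one). lia.
Qed.

(** For the bit [z] and arguments [x], [y]: [z * x = z * y] gives equality when [z = 1], while [x *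
    x + y * y + z = 2 * x * y + 1 + slack] gives a square of the difference of at least 1 when
    [z = 0]. *)
Lemma E_eqt : E L L 200 (fun v => v 1 < 2 ^ n /\ v 2 < 2 ^ n /\ v 0 = Nat.b2n (v 1 =? v 2)).
Proof.
  pose proof L_4n as HL. pose proof n_pos as Hn. pose proof L_one as HL1.
  assert (Hnl : n <= L) by lia.
  eapply E_size; [|eapply E_iff; [|eapply E_and;
    [apply (E_ren _ _ _ _ (fun _ => 1) (E_lt L HL1 n Hnl))|eapply E_and;
    [apply (E_ren _ _ _ _ (fun _ => 2) (E_lt L HL1 n Hnl))|eapply E_ex; [lia|
     eapply E_and; [eeq 4 [mp 1 1] [mv 1]|
     eapply E_and; [eeq 4 [mp 1 2] [mp 1 3]|
       eeq 4 [mp 2 2; mp 3 3; mv 1] [mcp 1 2 3; mk 0; mv 0]]]]]]]]; [simpl length; lia|].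
  intros v Hv. msimp. cbv beta.
  assert (H2 : 2 ^ (n + n + 1 + 1) <= 2 ^ L) by (apply pow2_le; lia).
  rewrite !Nat.pow_add_r, Nat.pow_1_r in H2.
  split; intros (H3 & H4 & H5); (split; [assumption|]; split; [assumption|]).
  - destruct H5 as (s & _ & A & B & C). rewrite ?Nat.pow_0_r, ?Nat.pow_1_r in *.
    destruct (Nat.eqb_spec (v 1) (v 2)) as [E0|E0]; simpl; [rewrite E0 in *|]; nia.
  - destruct (Nat.eqb_spec (v 1) (v 2)) as [E0|E0]; simpl in H5; rewrite H5.
    + exists 0. rewrite E0, ?Nat.pow_0_r, ?Nat.pow_1_r. split; [apply pow2_pos|]. repeat split; lia.
    + exists (v 1 * v 1 + v 2 * v 2 - 2 * v 1 * v 2 - 1). rewrite ?Nat.pow_0_r, ?Nat.pow_1_r.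
      assert (2 * v 1 * v 2 + 1 <= v 1 * v 1 + v 2 * v 2).
      { destruct (Nat.lt_total (v 1) (v 2)) as [Hl|[Hl|Hl]]; [|lia|].
        - replace (v 2) with (v 1 + (v 2 - v 1)) by lia.
          assert (1 <= (v 2 - v 1) * (v 2 - v 1)) by nia. nia.
        - replace (v 1) with (v 2 + (v 1 - v 2)) by lia.
          assert (1 <= (v 1 - v 2) * (v 1 - v 2)) by nia. nia. }
      split; [|lia]. pose proof (pow2_pos n). nia.
Qed.

Variables (A : nat) (Y : (nat -> nat) -> nat).
Hypothesis HA : 2000 * (d + 1) <= A.
Hypothesis HYlt : forall v, bounded L v -> Y v < 2 ^ n.
Hypothesis HY : E L L A (fun v => v 0 = Y (etl v)).

Lemma nL v : v < 2 ^ n -> v < 2 ^ L.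
Proof. intros H. apply Nat.lt_le_trans with (1 := H). apply pow2_le. rewrite L_4n. lia. Qed.

Lemma bounded_etl v : bounded L v -> bounded L (etl v).
Proof. intros H i; apply H. Qed.

Lemma term_lt t v : bounded L v -> neval n (fun _ => Y v) t < 2 ^ n.
Proof. intros Hv. apply neval_lt. intros _. now apply HYlt. Qed.

Lemma E_term t : E L L ((2 ^ S (term_depth t) - 1) * A) (fun v => v 0 = neval n (fun _ => Y (etl v)) t).
Proof.
  induction t as [x|c|f t IH|f t IHt u IHu]; cbn [term_depth neval].
  - apply (E_size _ _ A); [simpl; lia|exact HY].
  - apply (E_size _ _ 20); [simpl; lia|].
    eapply E_iff; [|exact (E_cst c)]. intros; reflexivity.
  - eapply E_size; [|eapply E_iff; [|eapply (E_comp1 L L_one _ _ (fun z a => a < 2 ^ n /\ z = un_nat n f a)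
      (fun v => neval n (fun _ => Y v) t)); [apply E_un|exact IH|]]].
    + rewrite (Nat.pow_succ_r' _ (S (term_depth t))).
      pose proof (geo_step1 _ A (1000 * (d + 1) + 7) (pow2_pos (S (term_depth t)))). lia.
    + intros v Hv. pose proof (term_lt t (etl v) (bounded_etl v Hv)). tauto.
    + intros v Hv. apply nL, term_lt, Hv.
  - eapply E_size; [|eapply E_iff; [|eapply (E_comp2 L L_one _ _ _ (fun z a b => a < 2 ^ n /\ b < 2 ^ n /\ z = bin_nat n f a b)
      (fun v => neval n (fun _ => Y v) t) (fun v => neval n (fun _ => Y v) u)); [apply E_bin|exact IHt|exact IHu| |]]].
    + set (h := Nat.max (term_depth t) (term_depth u)).
      assert (2 ^ S (term_depth t) <= 2 ^ S h) by (apply pow2_le; lia).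
      assert (2 ^ S (term_depth u) <= 2 ^ S h) by (apply pow2_le; lia).
      rewrite (Nat.pow_succ_r' _ (S h)).
      pose proof (pow2_pos (S (term_depth t))). pose proof (pow2_pos (S (term_depth u))).
      pose proof (geo_step2 (2 ^ S (term_depth t)) (2 ^ S (term_depth u)) (2 ^ S h) A 1014). lia.
    + intros v Hv. pose proof (term_lt t (etl v) (bounded_etl v Hv)).
      pose proof (term_lt u (etl v) (bounded_etl v Hv)). tauto.
    + intros v Hv. apply nL, term_lt, Hv.
    + intros v Hv. apply nL, term_lt, Hv.
Qed.

Lemma b2n_lt b : Nat.b2n b < 2 ^ L.
Proof. pose proof (one_lt L L_one). destruct b; simpl; lia. Qed.

(** [Q] is a quadratic equation which, on arguments 0 and 1, has the value of the connective as its
    only solution. *)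
Lemma E_bool (op : bool -> bool -> bool) (Q : nat -> nat -> nat -> Prop) a b :
  E L L 100 (fun v => Q (v 0) (v 1) (v 2)) ->
  (forall z x y, Q z (Nat.b2n x) (Nat.b2n y) <-> z = Nat.b2n (op x y)) ->
  E L L ((2 ^ S (S (depth a)) - 1) * A) (fun v => v 0 = Nat.b2n (fsb n (fun _ => Y (etl v)) a)) ->
  E L L ((2 ^ S (S (depth b)) - 1) * A) (fun v => v 0 = Nat.b2n (fsb n (fun _ => Y (etl v)) b)) ->
  E L L ((2 ^ S (S (S (Nat.max (depth a) (depth b)))) - 1) * A)
    (fun v => v 0 = Nat.b2n (op (fsb n (fun _ => Y (etl v)) a) (fsb n (fun _ => Y (etl v)) b))).
Proof.
  intros HQ Hop Ha Hb.
  eapply E_size; [|eapply E_iff; [|eapply (E_comp2 L L_one _ _ _ Q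
    (fun v => Nat.b2n (fsb n (fun _ => Y v) a)) (fun v => Nat.b2n (fsb n (fun _ => Y v) b)) HQ Ha Hb)]].
  - set (h := Nat.max (depth a) (depth b)).
    assert (2 ^ S (S (depth a)) <= 2 ^ S (S h)) by (apply pow2_le; lia).
    assert (2 ^ S (S (depth b)) <= 2 ^ S (S h)) by (apply pow2_le; lia).
    rewrite (Nat.pow_succ_r' _ (S (S h))).
    pose proof (pow2_pos (S (S (depth a)))). pose proof (pow2_pos (S (S (depth b)))).
    pose proof (geo_step2 (2 ^ S (S (depth a))) (2 ^ S (S (depth b))) (2 ^ S (S h)) A 114). lia.
  - intros v Hv. apply Hop.
  - intros v _. apply b2n_lt.
  - intros v _. apply b2n_lt.
Qed.

Lemma E_form a : propositional a ->
  E L L ((2 ^ S (S (depth a)) - 1) * A) (fun v => v 0 = Nat.b2n (fsb n (fun _ => Y (etl v)) a)).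
Proof.
  induction a; cbn [propositional depth fsb]; intros Hp; try easy;
    try (specialize (IHa1 (proj1 Hp)); specialize (IHa2 (proj2 Hp))).
  - eapply E_size; [|eapply E_iff; [|eapply (E_comp2 L L_one _ _ _
      (fun z a b => a < 2 ^ n /\ b < 2 ^ n /\ z = Nat.b2n (a =? b))
      (fun v => neval n (fun _ => Y v) t) (fun v => neval n (fun _ => Y v) u)
      E_eqt (E_term t) (E_term u))]].
    + set (h := Nat.max (term_depth t) (term_depth u)).
      assert (2 ^ S (term_depth t) <= 2 ^ S h) by (apply pow2_le; lia).
      assert (2 ^ S (term_depth u) <= 2 ^ S h) by (apply pow2_le; lia).
      rewrite (Nat.pow_succ_r' _ (S h)).
      pose proof (pow2_pos (S (term_depth t))). pose proof (pow2_pos (S (term_depth u))).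
      pose proof (geo_step2 (2 ^ S (term_depth t)) (2 ^ S (term_depth u)) (2 ^ S h) A 1014). lia.
    + intros v Hv. pose proof (term_lt t (etl v) (bounded_etl v Hv)).
      pose proof (term_lt u (etl v) (bounded_etl v Hv)). tauto.
    + intros v Hv. apply nL, term_lt, Hv.
    + intros v Hv. apply nL, term_lt, Hv.
  - specialize (IHa Hp).
    eapply E_size; [|eapply E_iff; [|eapply (E_comp1 L L_one 20 _ (fun z x => z + x = 1)
      (fun v => Nat.b2n (fsb n (fun _ => Y v) a))); [|exact IHa|]]].
    + rewrite (Nat.pow_succ_r' _ (S (S (depth a)))).
      pose proof (geo_step1 _ A 27 (pow2_pos (S (S (depth a))))). lia.
    + intros v Hv. cbv beta. destruct (fsb n (fun _ => Y (etl v)) a); simpl; lia.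
    + eapply E_size; [|eapply E_iff; [|eeq 2 [mv 0; mv 1] [mk 0]]]; [simpl; lia|].
      intros v Hv. msimp. reflexivity.
    + intros v _. apply b2n_lt.
  - apply (E_bool andb (fun z x y => z = x * y)); try assumption.
    + apply (E_size _ _ 30); [lia|apply (E_mul L L_one)].
    + intros z x y. destruct x, y; simpl; lia.
  - apply (E_bool orb (fun z x y => z + x * y = x + y)); try assumption.
    + eapply E_size; [|eapply E_iff; [|eeq 3 [mv 0; mp 1 2] [mv 1; mv 2]]]; [simpl; lia|].
      intros v Hv. msimp. reflexivity.
    + intros z x y. destruct x, y; simpl; lia.
  - apply (E_bool implb (fun z x y => z + x = 1 + x * y)); try assumption.
    + eapply E_size; [|eapply E_iff; [|eeq 3 [mv 0; mv 1] [mk 0; mp 1 2]]]; [simpl; lia|].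
      intros v Hv. msimp. reflexivity.
    + intros z x y. destruct x, y; simpl; lia.
  - apply (E_bool Bool.eqb (fun z x y => z + (x + y) = 1 + 2 * (x * y))); try assumption.
    + pose proof L_one as HL1.
      eapply E_size; [|eapply E_iff; [|eeq 3 [mv 0; mv 1; mv 2] [mk 0; mcp 1 1 2]]]; [simpl; lia|].
      intros v Hv. msimp. rewrite Nat.pow_1_r. lia.
    + intros z x y. destruct x, y; simpl; lia.
Qed.
End Formulas.

(** Reducing the inputs modulo [2 ^ L0] keeps the linear form bounded. *)
Lemma E_ev L L0 l : 1 <= L -> L0 <= L -> (forall t, In t l -> fst t <= L) ->
  (forall v, bounded L0 v -> ev v l < 2 ^ L) ->
  E L L (200 * (length l + 1)) (fun v => v 0 = ev (fun i => etl v i mod 2 ^ L0) l).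
Proof.
  intros HL1 HL0. induction l as [|[g o] l IH]; intros Hg Hb.
  - apply (E_size _ _ 10); [simpl; lia|exact (E_zero L HL1)].
  - assert (Hmb : forall v : nat -> nat, bounded L0 (fun i => v i mod 2 ^ L0)).
    { intros v i. apply Nat.mod_upper_bound, pow2_ne. }
    assert (IH' : E L L (200 * (length l + 1)) (fun v => v 0 = ev (fun i => etl v i mod 2 ^ L0) l)).
    { apply IH; [intros t Ht; apply Hg; now right|].
      intros v Hv. specialize (Hb v Hv). unfold ev in *; simpl in Hb. lia. }
    specialize (Hg (g, o) (or_introl eq_refl)). simpl in Hg.
    eapply E_size; [|eapply E_iff; [|eapply (E_comp2 L HL1 50 60 _ (fun z a b => z = a * 2 ^ g + b)
      (fun v => oval (fun i => v i mod 2 ^ L0) o) (fun v => ev (fun i => v i mod 2 ^ L0) l)); [| |exact IH'| |]]].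
    + simpl length. lia.
    + intros v Hv. reflexivity.
    + eapply E_size; [|eapply E_iff; [|eeq 3 [mv 0] [mcv g 1; mv 2]]]; [simpl; lia|].
      intros v Hv. msimp. lia.
    + destruct o as [k|]; simpl.
      * exact (E_ren _ _ _ _ (fun i => match i with 0 => 0 | _ => S k end) (E_modn L HL1 L0 HL0)).
      * apply (E_size _ _ 10); [lia|]. eapply E_iff; [|apply (E_const L HL1 0); lia]. intros; reflexivity.
    + intros v _. destruct o as [k|]; simpl; [|now apply one_lt].
      apply Nat.lt_le_trans with (2 ^ L0); [apply Nat.mod_upper_bound, pow2_ne|now apply pow2_le].
    + intros v _. specialize (Hb _ (Hmb v)). unfold ev in *; simpl in Hb. lia.
Qed.

Lemma ev_ext v v' l : (forall i, v i = v' i) -> ev v l = ev v' l.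
Proof.
  intros H. unfold ev. f_equal. apply map_ext. intros [g [k|]]; simpl; [now rewrite H|reflexivity].
Qed.

(** The factor 4500 covers the computation of the code, with at most [20 * K] terms of cost 200, and
    the cost of an operation; [2 ^ (k + 2)] is the size of the formula tree; 17 pays for the
    comparison with the bit [b] and its quantifier. *)
Definition flip_size (k d K : nat) : nat := 2 ^ (k + 2) * (4500 * ((d + 1) * K) + 17).

(** [R v] means that [psi] holds at the code of its system for [v], hence that [P] does. The truth
    value of [P] is the unique result of a computation, so it may be compared with either bit:
    [b = false] negates, [b = true] only passes to longer unknowns and a new size bound. *)
Lemma E_flip y P d k m L K R b :
  propositional P -> depth P <= k ->
  (forall Y, Y < 2 ^ 2 ^ d -> (psin y (2 ^ d) Y <-> fsb (2 ^ d) (fun _ => Y) P = true)) ->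
  1 <= K -> K <= L -> m <= L -> 4000 * L * (K * K * K) <= 2 ^ d ->
  E m L K R -> E m (2 ^ (d + 2)) (flip_size k d K) (fun v => if b : bool then R v else ~ R v).
Proof.
  intros HP Hk HH HK HKL Hm Hd (s & Hwf & Hs & HR).
  destruct (encode y s L K d Hwf Hs HK HKL Hd) as (l & Hl & Hg & Henc).
  assert (HLd : L <= 2 ^ d).
  { assert (1 <= K * K * K) by (repeat apply Nat.mul_pos_pos; lia). nia. }
  assert (Hd2 : 2 ^ d <= 2 ^ (d + 2)) by (apply pow2_le; lia).
  assert (HL1 : 1 <= 2 ^ (d + 2)) by apply pow2_pos.
  set (Y := fun v : nat -> nat => ev (fun i => v i mod 2 ^ L) l).
  assert (HYlt : forall v, Y v < 2 ^ 2 ^ d).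
  { intros v. apply Henc. intros i. apply Nat.mod_upper_bound, pow2_ne. }
  set (A := 4500 * ((d + 1) * K)).
  assert (HT : K <= (d + 1) * K /\ d + 1 <= (d + 1) * K) by nia.
  assert (HYE : E (2 ^ (d + 2)) (2 ^ (d + 2)) A (fun v => v 0 = Y (etl v))).
  { eapply E_size; [|apply (E_ev (2 ^ (d + 2)) L l); [assumption|lia| |]].
    - unfold A. lia.
    - intros t Ht. specialize (Hg t Ht). lia.
    - intros v Hv. apply Nat.lt_le_trans with (2 ^ 2 ^ d); [now apply Henc|now apply pow2_le]. }
  assert (HAd : 2000 * (d + 1) <= A) by (unfold A; lia).
  pose proof (E_form d A Y HAd (fun v _ => HYlt v) HYE P HP) as HF.
  assert (HB : E (2 ^ (d + 2)) (2 ^ (d + 2)) 10 (fun v => v 0 = Nat.b2n b)).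
  { destruct b; simpl; [|exact (E_zero _ HL1)]. eapply E_iff; [|apply (E_const _ HL1 0); lia]. intros; reflexivity. }
  pose proof (E_ex _ _ _ _ (Nat.le_refl _) (E_and _ _ _ _ _ _ HF HB)) as HX.
  apply (E_dom _ m) in HX; [|lia].
  eapply E_size; [|eapply E_iff; [|exact HX]].
  - unfold flip_size. assert (2 ^ S (S (depth P)) <= 2 ^ (k + 2)) by (apply pow2_le; lia).
    pose proof (pow2_pos (k + 2)). pose proof (pow2_pos (S (S (depth P)))).
    fold A. rewrite Nat.mul_add_distr_l.
    assert ((2 ^ S (S (depth P)) - 1) * A <= 2 ^ (k + 2) * A) by (apply Nat.mul_le_mono_r; lia). lia.
  - intros v Hv. cbn [scons]. pose proof (bounded_le m L v Hm Hv) as HvL.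
    assert (EY : forall x, Y (etl (x .: v)) = ev v l).
    { intros x. unfold Y. apply ev_ext. intros i. unfold etl; simpl. apply Nat.mod_small, HvL. }
    destruct (Henc v HvL) as [Hlt Hiff]. specialize (HH _ Hlt).
    assert (HRP : R v <-> fsb (2 ^ d) (fun _ => ev v l) P = true) by (rewrite HR by assumption; tauto).
    split.
    + intros (x & _ & E1 & E2). rewrite (EY x) in E1. rewrite E2 in E1.
      destruct b; [apply HRP|rewrite HRP]; destruct (fsb (2 ^ d) (fun _ => ev v l) P); easy.
    + intros H. exists (Nat.b2n b). split; [pose proof (one_lt _ HL1); destruct b; simpl; lia|].
      rewrite EY. split; [|reflexivity]. f_equal.
      destruct b, (fsb (2 ^ d) (fun _ => ev v l) P); try easy.
      * apply HRP in H. easy.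
      * exfalso. now apply H, HRP.
Qed.

(** * The hierarchy of definable relations *)

(** The hypothetical situation to be refuted: up to [d = 2 ^ cx] every [psi] is
    equivalent to a formula of depth at most [cx]. The numbers [cJ], [cw], [cu] bound
    the number of eliminated quantifiers and the resulting growth. *)
Record ctx := Ctx {
  cy : variable;
  cP : nat -> formula;
  cx : nat;
  cdel : nat;
  cJ : nat;
  cw : nat;
  cu : nat;
  c_d : 2 ^ cx = 16 * cdel;
  c_del : 8 <= cdel;
  c_w : 2 * cx + 40 <= cw;
  c_u : 3 * ((cJ + 2) * cw) + 40 <= cu;
  c_lam : (cJ + 2) * cw + 8 <= cdel;
  c_top : 15 * cdel + 8 + (cJ + 2) * cu <= 16 * cdel;
  c_P : forall d, 15 * cdel <= d <= 16 * cdel ->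
    propositional (cP d) /\ depth (cP d) <= cx /\
    forall Y, Y < 2 ^ 2 ^ d -> (psin cy (2 ^ d) Y <-> fsb (2 ^ d) (fun _ => Y) (cP d) = true)
}.

(** The words, that is the inputs at all levels, keep this one length, while the unknowns at level
    [j] have [2 ^ lam c j] bits. *)
Definition cm (c : ctx) : nat := 2 ^ (15 * cdel c + 3).
Definition lam (c : ctx) (j : nat) : nat := 15 * cdel c + 8 + j * cu c.

Definition D (c : ctx) (j : nat) (R : (nat -> nat) -> Prop) : Prop :=
  j <= cJ c -> E (cm c) (2 ^ lam c j) (2 ^ ((j + 1) * cw c)) R.

Lemma cm_le c j : 4 * cm c <= 2 ^ lam c j.
Proof.
  unfold cm, lam. apply Nat.le_trans with (2 ^ (2 + (15 * cdel c + 3))).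
  - rewrite (Nat.pow_add_r 2 2). reflexivity.
  - apply pow2_le. lia.
Qed.

(** The exponent [+ 2] leaves room for a conjunction or a quantifier carried out just before. The
    structure used is number [lam c (S j) - 2], whose computations have unknowns of exactly
    [2 ^ lam c (S j)] bits; [c_w] absorbs the growth in size and [c_u] the length of the code. *)
Lemma D_flip c j R b : S j <= cJ c -> E (cm c) (2 ^ lam c j) (2 ^ ((j + 1) * cw c + 2)) R ->
  E (cm c) (2 ^ lam c (S j)) (2 ^ ((S j + 1) * cw c)) (fun v => if b : bool then R v else ~ R v).
Proof.
  intros Hj HR. set (d := lam c j + cu c - 2).
  pose proof (c_w c) as Hw. pose proof (c_u c) as Hu. pose proof (c_lam c) as Hl.
  pose proof (c_top c) as Ht. pose proof (c_d c) as Hd. pose proof (cm_le c j) as Hm.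
  assert (Hjw : (j + 1) * cw c <= (cJ c + 2) * cw c) by (apply Nat.mul_le_mono_r; lia).
  assert (Hju : (j + 1) * cu c <= (cJ c + 2) * cu c) by (apply Nat.mul_le_mono_r; lia).
  assert (Hlam : lam c j = 15 * cdel c + 8 + j * cu c) by reflexivity.
  assert (Hd2 : lam c (S j) = d + 2).
  { unfold d. unfold lam. lia. }
  destruct (c_P c d) as (HP & Hk & HH); [unfold d; lia|].
  rewrite Hd2. eapply E_size; [|apply (E_flip (cy c) (cP c d) d (cx c) (cm c) (2 ^ lam c j)
    (2 ^ ((j + 1) * cw c + 2)) R b HP Hk HH)]; try assumption.
  - unfold flip_size. assert (d + 1 <= 2 ^ (cx c + 1)).
    { rewrite (Nat.add_1_r (cx c)), Nat.pow_succ_r', Hd. unfold d. lia. }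
    set (K := 2 ^ ((j + 1) * cw c + 2)). pose proof (pow2_pos ((j + 1) * cw c + 2)) as HK. fold K in HK.
    pose proof (pow2_pos (cx c + 1)) as Hx1.
    assert (H1 : (d + 1) * K <= 2 ^ (cx c + 1) * K) by now apply Nat.mul_le_mono_r.
    assert (H2 : 1 <= 2 ^ (cx c + 1) * K) by nia.
    apply Nat.le_trans with (2 ^ (cx c + 2) * (2 ^ 13 * (2 ^ (cx c + 1) * K))).
    + apply Nat.mul_le_mono_l. assert (4517 <= 2 ^ 13) by (simpl; lia).
      apply Nat.le_trans with (4517 * (2 ^ (cx c + 1) * K)); [lia|now apply Nat.mul_le_mono_r].
    + unfold K. rewrite <- !Nat.pow_add_r. apply pow2_le. lia.
  - apply pow2_pos.
  - apply pow2_le. lia.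
  - lia.
  - assert (4000 <= 2 ^ 12) by (simpl; lia).
    apply Nat.le_trans with (2 ^ 12 * 2 ^ lam c j *
      (2 ^ ((j + 1) * cw c + 2) * 2 ^ ((j + 1) * cw c + 2) * 2 ^ ((j + 1) * cw c + 2))).
    + apply Nat.mul_le_mono_r, Nat.mul_le_mono_r. assumption.
    + rewrite <- !Nat.pow_add_r. apply pow2_le. unfold d. lia.
Qed.

Lemma cw_ge c j : 40 <= (j + 1) * cw c.
Proof. pose proof (c_w c). nia. Qed.

Lemma D_iff c j (R R' : (nat -> nat) -> Prop) :
  (forall v, bounded (cm c) v -> (R v <-> R' v)) -> D c j R -> D c j R'.
Proof. intros H HD Hj. apply E_iff with R; auto. Qed.

Lemma D_ren c j R (r : nat -> nat) : D c j R -> D c j (fun v => R (fun i => v (r i))).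
Proof. intros HD Hj. apply E_ren. auto. Qed.

Lemma pow_step a b : 2 ^ a + 2 ^ b <= 2 ^ (Nat.max a b + 1).
Proof.
  rewrite Nat.add_1_r, Nat.pow_succ_r'. pose proof (pow2_le a (Nat.max a b)).
  pose proof (pow2_le b (Nat.max a b)). lia.
Qed.

(** Longer unknowns do not trivially define the same relation, since the unknowns of a system are
    bounded by its [L]; the transfer is the case [b = true] of the flip. *)
Lemma D_up c j R : D c j R -> D c (S j) R.
Proof.
  intros HD Hj. apply (D_flip c j R true Hj). eapply E_size; [|apply HD; lia]. apply pow2_le; lia.
Qed.

Lemma D_le c j j' R : j <= j' -> D c j R -> D c j' R.
Proof. induction 1; [auto|]. intros H'. apply D_up. auto. Qed.

Lemma D_not c j R : D c j R -> D c (S j) (fun v => ~ R v).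
Proof.
  intros HD Hj. apply (D_flip c j R false Hj). eapply E_size; [|apply HD; lia]. apply pow2_le; lia.
Qed.

Lemma D_and c j R1 R2 : D c j R1 -> D c j R2 -> D c (S j) (fun v => R1 v /\ R2 v).
Proof.
  intros H1 H2 Hj. apply (D_flip c j _ true Hj).
  eapply E_size; [|apply E_and; [apply H1; lia|apply H2; lia]].
  etransitivity; [apply pow_step|]. apply pow2_le; lia.
Qed.

Lemma D_ex c j R : D c j R -> D c (S j) (fun v => exists x, x < 2 ^ cm c /\ R (x .: v)).
Proof.
  intros H1 Hj. apply (D_flip c j _ true Hj).
  eapply E_size; [|apply E_ex; [|apply H1; lia]].
  - pose proof (cw_ge c j). assert (2 ^ 3 <= 2 ^ ((j + 1) * cw c)) by (apply pow2_le; lia).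
    rewrite Nat.pow_add_r. simpl in *. lia.
  - pose proof (cm_le c j). lia.
Qed.

Lemma D_base c K R : K <= 2 ^ cw c -> E (2 ^ lam c 0) (2 ^ lam c 0) K R -> D c 0 R.
Proof.
  intros HK HR _. apply (E_dom (2 ^ lam c 0)); [pose proof (cm_le c 0); lia|].
  apply (E_size _ _ K); [|assumption]. rewrite Nat.add_0_l, Nat.mul_1_l. assumption.
Qed.

(** * Definability uniform in a parameter *)

Section Family.
Variables (P : Type) (pc : P -> ctx) (bs : P -> nat).
Let m (p : P) : nat := cm (pc p).

(** The constant [C] is uniform in the family; only the base level [bs] varies. *)
Definition Def (R : P -> (nat -> nat) -> Prop) : Prop :=
  exists C, forall p, D (pc p) (bs p + C) (R p).

Definition GF (f : P -> (nat -> nat) -> nat) : Prop := Def (fun p v => v 0 = f p (etl v)).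

Definition bd (f : P -> (nat -> nat) -> nat) : Prop :=
  forall p v, bounded (m p) v -> f p v < 2 ^ m p.

Lemma Def_ext (R R' : P -> (nat -> nat) -> Prop) :
  (forall p v, bounded (m p) v -> (R p v <-> R' p v)) -> Def R -> Def R'.
Proof. intros H [C HC]. exists C. intros p. apply D_iff with (R p); auto. Qed.

Lemma Def_ren R (r : nat -> nat) : Def R -> Def (fun p v => R p (fun i => v (r i))).
Proof. intros [C HC]. exists C. intros p. exact (D_ren _ _ _ r (HC p)). Qed.

Lemma Def_not R : Def R -> Def (fun p v => ~ R p v).
Proof. intros [C HC]. exists (S C). intros p. rewrite Nat.add_succ_r. now apply D_not. Qed.

Lemma Def_and R1 R2 : Def R1 -> Def R2 -> Def (fun p v => R1 p v /\ R2 p v).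
Proof.
  intros [C1 H1] [C2 H2]. exists (S (Nat.max C1 C2)). intros p. rewrite Nat.add_succ_r.
  apply D_and; [apply D_le with (bs p + C1)|apply D_le with (bs p + C2)]; auto; lia.
Qed.

Lemma Def_or R1 R2 : Def R1 -> Def R2 -> Def (fun p v => R1 p v \/ R2 p v).
Proof.
  intros H1 H2. apply Def_ext with (fun p v => ~ (~ R1 p v /\ ~ R2 p v)).
  - intros p v _. destruct (Classical_Prop.classic (R1 p v)), (Classical_Prop.classic (R2 p v)); tauto.
  - now apply Def_not, Def_and; apply Def_not.
Qed.

Lemma Def_ex R : Def R -> Def (fun p v => exists x, x < 2 ^ m p /\ R p (x .: v)).
Proof. intros [C HC]. exists (S C). intros p. rewrite Nat.add_succ_r. now apply D_ex. Qed.

Lemma Def_bind f R : GF f -> Def R ->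
  Def (fun p v => exists x, x < 2 ^ m p /\ (x = f p v /\ R p (x .: v))).
Proof. intros Hf HR. exact (Def_ex _ (Def_and _ _ Hf HR)). Qed.

Lemma Def_sub f R : GF f -> bd f -> Def R -> Def (fun p v => R p (f p v .: v)).
Proof.
  intros Hf Hb HR. eapply Def_ext; [|exact (Def_bind f R Hf HR)].
  intros p v Hv. simpl. split; [intros (x & _ & -> & H); exact H|].
  intros H. exists (f p v). auto.
Qed.

Lemma Def_base R (K : P -> nat) : (forall p, K p <= 2 ^ cw (pc p)) ->
  (forall p, E (2 ^ lam (pc p) 0) (2 ^ lam (pc p) 0) (K p) (R p)) -> Def R.
Proof.
  intros HK HR. exists 0. intros p. apply D_le with 0; [lia|]. now apply D_base with (K p).
Qed.

Lemma cw_big p K : K <= 1000 -> K <= 2 ^ cw (pc p).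
Proof.
  intros H. pose proof (c_w (pc p)). assert (2 ^ 10 <= 2 ^ cw (pc p)) by (apply pow2_le; lia).
  assert (1000 <= 2 ^ 10) by (simpl; lia). lia.
Qed.

Lemma L0_one p : 1 <= 2 ^ lam (pc p) 0.
Proof. apply pow2_pos. Qed.

Lemma L0_even p : Nat.Even (2 ^ lam (pc p) 0).
Proof.
  exists (2 ^ (lam (pc p) 0 - 1)). rewrite <- Nat.pow_succ_r'. f_equal. unfold lam. lia.
Qed.

Lemma Def_base_c R K : K <= 1000 ->
  (forall p, E (2 ^ lam (pc p) 0) (2 ^ lam (pc p) 0) K (R p)) -> Def R.
Proof. intros HK. apply Def_base. intros p. now apply cw_big. Qed.

Lemma gf_ext f g : (forall p v, bounded (m p) v -> f p v = g p v) -> GF f -> GF g.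
Proof.
  intros H. apply Def_ext. intros p v Hv. rewrite H; [reflexivity|]. intros i; apply Hv.
Qed.

Lemma gf_var i : GF (fun p v => v i).
Proof.
  apply (Def_base_c _ 20); [lia|]. intros p. exact (E_var _ (L0_one p) i).
Qed.

Lemma bd_var i : bd (fun p v => v i).
Proof. intros p v Hv. apply Hv. Qed.

Lemma gf_ren f (r : nat -> nat) : GF f -> GF (fun p v => f p (fun i => v (r i))).
Proof. exact (Def_ren _ (fun i => match i with 0 => 0 | S j => S (r j) end)). Qed.

Lemma gf_pow2c (e : P -> nat) : (forall p, e p <= 2 ^ lam (pc p) 0) -> GF (fun p _ => 2 ^ e p).
Proof.
  intros He. apply (Def_base_c _ 10); [lia|]. intros p. exact (E_const _ (L0_one p) (e p) (He p)).
Qed.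

Lemma gf_0 : GF (fun _ _ => 0).
Proof. apply (Def_base_c _ 10); [lia|]. intros p. exact (E_zero _ (L0_one p)). Qed.

Lemma gf_1 : GF (fun _ _ => 1).
Proof. exact (gf_pow2c (fun _ => 0) (fun p => Nat.le_0_l _)). Qed.

Definition sw : nat -> nat := fun i => match i with 0 => 1 | 1 => 0 | S (S j) => S (S j) end.

Lemma gf_sub f g : GF f -> bd f -> GF g -> GF (fun p v => g p (f p v .: v)).
Proof.
  intros Hf Hb Hg. unfold GF.
  apply (Def_sub (fun p v => f p (etl v)) (fun p v => v 1 = g p (v 0 .: etl (etl v)))).
  - exact (gf_ren f S Hf).
  - intros p v Hv. apply Hb. intros i; apply Hv.
  - eapply Def_ext; [|exact (Def_ren _ sw Hg)].
    intros p v _.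
    assert (Ev : (fun i => v (sw (S i))) = v 0 .: etl (etl v)).
    { apply FunctionalExtensionality.functional_extensionality. now intros [|i]. }
    change (v 1 = g p (fun i => v (sw (S i))) <-> v 1 = g p (v 0 .: etl (etl v))).
    rewrite Ev. reflexivity.
Qed.

Lemma gf_op2 (h : nat -> nat -> nat) f g :
  Def (fun p v => v 0 = h (v 1) (v 2)) -> GF f -> bd f -> GF g -> bd g -> GF (fun p v => h (f p v) (g p v)).
Proof.
  intros Hh Hf Bf Hg Bg. unfold GF.
  apply (Def_sub (fun p v => f p (etl v)) (fun p v => v 1 = h (v 0) (g p (etl (etl v))))).
  - exact (gf_ren f S Hf).
  - intros p v Hv. apply Bf. intros i; apply Hv.
  - apply (Def_sub (fun p v => g p (etl (etl v))) (fun p v => v 2 = h (v 1) (v 0))).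
    + exact (gf_ren g (fun i => S (S i)) Hg).
    + intros p v Hv. apply Bg. intros i; apply Hv.
    + exact (Def_ren _ (fun i => match i with 0 => 2 | 1 => 1 | 2 => 0 | _ => i end) Hh).
Qed.

(** The second argument may be large, provided [h x y = h0 x] for large [y]. *)
Lemma gf_op2_partial (h : nat -> nat -> nat) (h0 : nat -> nat) f g :
  Def (fun p v => v 0 = h (v 1) (v 2)) -> Def (fun p v => v 0 = h0 (v 1)) ->
  (forall p x y, x < 2 ^ m p -> 2 ^ m p <= y -> h x y = h0 x) ->
  GF f -> bd f -> GF g -> GF (fun p v => h (f p v) (g p v)).
Proof.
  intros Hh Hh0 Hbig Hf Bf Hg. unfold GF.
  apply (Def_sub (fun p v => f p (etl v)) (fun p v => v 1 = h (v 0) (g p (etl (etl v))))).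
  - exact (gf_ren f S Hf).
  - intros p v Hv. apply Bf. intros i; apply Hv.
  - assert (Hg' : GF (fun p v => g p (etl (etl v)))) by exact (gf_ren g (fun i => S (S i)) Hg).
    assert (A : Def (fun p v => exists y, y < 2 ^ m p /\ (y = g p (etl (etl v)) /\ v 1 = h (v 0) y))).
    { apply (Def_bind _ (fun p v => v 2 = h (v 1) (v 0)) Hg').
      exact (Def_ren _ (fun i => match i with 0 => 2 | 1 => 1 | 2 => 0 | _ => i end) Hh). }
    assert (B : Def (fun p v => ~ exists y, y < 2 ^ m p /\ y = g p (etl (etl v)))).
    { apply Def_not. exact (Def_ex _ Hg'). }
    assert (C : Def (fun p v => v 1 = h0 (v 0))).
    { exact (Def_ren _ (fun i => match i with 0 => 1 | 1 => 0 | _ => i end) Hh0). }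
    eapply Def_ext; [|exact (Def_or _ _ A (Def_and _ _ B C))].
    intros p v Hv. cbv beta. split.
    + intros [(y & _ & -> & H)|[H1 H2]]; [exact H|].
      rewrite (Hbig p) ; [exact H2|apply Hv|].
      apply Nat.nlt_ge. intros Hlt. apply H1. eauto.
    + intros H. destruct (Nat.lt_ge_cases (g p (etl (etl v))) (2 ^ m p)) as [Hlt|Hge].
      * left. eauto.
      * right. split; [intros (y & Hy & ->); lia|].
        rewrite (Hbig p) in H; [exact H|apply Hv|exact Hge].
Qed.

Lemma Def_op_add : Def (fun p v => v 0 = v 1 + v 2).
Proof. apply (Def_base_c _ 30); [lia|]. intros p. exact (E_add _ (L0_one p)). Qed.
Lemma Def_op_mul : Def (fun p v => v 0 = v 1 * v 2).
Proof. apply (Def_base_c _ 30); [lia|]. intros p. exact (E_mul _ (L0_one p)). Qed.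
Lemma Def_op_div : Def (fun p v => v 0 = v 1 / v 2).
Proof. apply (Def_base_c _ 400); [lia|]. intros p. exact (E_div _ (L0_one p)). Qed.
Lemma Def_op_mod : Def (fun p v => v 0 = v 1 mod v 2).
Proof. apply (Def_base_c _ 500); [lia|]. intros p. exact (E_mod _ (L0_one p)). Qed.
Lemma Def_op_land : Def (fun p v => v 0 = Nat.land (v 1) (v 2)).
Proof. apply (Def_base_c _ 900); [lia|]. intros p. exact (E_land _ (L0_one p) (L0_even p)). Qed.
Lemma Def_op_max : Def (fun p v => v 0 = Nat.max (v 1) (v 2)).
Proof. apply (Def_base_c _ 200); [lia|]. intros p. exact (E_max _ (L0_one p)). Qed.

(** The result is a word, so the exponent is below [cm], a power of two whose own exponent is linear
    in [cdel]; [E_pow2] then has a small size. *)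
Lemma Def_op_pow : Def (fun p v => v 0 = 2 ^ v 1).
Proof.
  apply Def_ext with (fun p v => v 0 = 2 ^ v 1 /\ v 1 < 2 ^ (15 * cdel (pc p) + 3)).
  - intros p v Hv. fold (cm (pc p)). split; [tauto|]. intros H. split; [exact H|].
    pose proof (Hv 0) as H0. rewrite H in H0.
    apply Nat.pow_lt_mono_r_iff in H0; [exact H0|lia].
  - apply Def_base with (fun p => 300 * (15 * cdel (pc p) + 3 + 1)).
    + intros p. pose proof (c_w (pc p)). pose proof (c_d (pc p)). pose proof (c_del (pc p)).
      apply Nat.le_trans with (2 ^ 9 * 2 ^ cx (pc p)).
      * assert (300 <= 2 ^ 9) by (simpl; lia). apply Nat.mul_le_mono; lia.
      * rewrite <- Nat.pow_add_r. apply pow2_le. lia.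
    + intros p. apply (E_pow2 _ (L0_one p)). pose proof (cm_le (pc p) 0). unfold cm in *. lia.
Qed.

Lemma Def_eq0 f : GF f -> Def (fun p v => 0 = f p v).
Proof.
  intros Hf. eapply Def_ext; [|exact (Def_sub (fun _ _ => 0) _ gf_0 (fun p v _ => pow2_pos _) Hf)].
  intros p v _. reflexivity.
Qed.

(** Bounds on [f] and [g] can be dispensed with: if the sum is a word, so are both summands. *)
Lemma gf_add f g : GF f -> GF g -> GF (fun p v => f p v + g p v).
Proof.
  intros Hf Hg. unfold GF.
  assert (Hf' : GF (fun p v => f p (etl v))) by exact (gf_ren f S Hf).
  assert (Hg' : GF (fun p v => g p (etl (etl v)))) by exact (gf_ren g (fun i => S (S i)) Hg).
  assert (A : Def (fun p v => v 2 = v 1 + v 0)).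
  { exact (Def_ren _ (fun i => match i with 0 => 2 | 1 => 1 | 2 => 0 | _ => i end) Def_op_add). }
  eapply Def_ext; [|exact (Def_bind _ _ Hf' (Def_bind _ _ Hg' A))].
  intros p v Hv. cbn [scons etl]. split.
  - intros (x & _ & -> & z & _ & -> & H). exact H.
  - intros H. pose proof (Hv 0). exists (f p (etl v)). split; [lia|]. split; [reflexivity|].
    exists (g p (etl v)). split; [lia|]. split; [reflexivity|exact H].
Qed.

(** If the product is a word, its factors are words unless one of them is 0, in which case the other
    may be arbitrarily long; this case is treated apart. *)
Lemma gf_mul f g : GF f -> GF g -> GF (fun p v => f p v * g p v).
Proof.
  intros Hf Hg. unfold GF.
  assert (Hf' : GF (fun p v => f p (etl v))) by exact (gf_ren f S Hf).
  assert (Hg' : GF (fun p v => g p (etl (etl v)))) by exact (gf_ren g (fun i => S (S i)) Hg).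
  assert (Hg1 : GF (fun p v => g p (etl v))) by exact (gf_ren g S Hg).
  assert (A : Def (fun p v => v 2 = v 1 * v 0)).
  { exact (Def_ren _ (fun i => match i with 0 => 2 | 1 => 1 | 2 => 0 | _ => i end) Def_op_mul). }
  assert (Z : Def (fun p v => 0 = v 0 /\ (0 = f p (etl v) \/ 0 = g p (etl v)))).
  { apply Def_and; [apply Def_eq0, gf_var|]. apply Def_or; now apply Def_eq0. }
  eapply Def_ext; [|exact (Def_or _ _ (Def_bind _ _ Hf' (Def_bind _ _ Hg' A)) Z)].
  intros p v Hv. cbn [scons etl]. split.
  - intros [(x & _ & -> & z & _ & -> & H)|(H & [H1|H1])]; [exact H| |]; rewrite <- H1; lia.
  - intros H. pose proof (Hv 0) as H0.
    destruct (Nat.eq_dec (f p (etl v)) 0) as [E1|E1]; [right; rewrite E1 in H; auto|].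
    destruct (Nat.eq_dec (g p (etl v)) 0) as [E2|E2]; [right; rewrite E2 in H; lia|].
    left. exists (f p (etl v)). split; [nia|]. split; [reflexivity|].
    exists (g p (etl v)). split; [nia|]. split; [reflexivity|exact H].
Qed.

Lemma gf_pow f : GF f -> GF (fun p v => 2 ^ f p v).
Proof.
  intros Hf. unfold GF.
  assert (Hf' : GF (fun p v => f p (etl v))) by exact (gf_ren f S Hf).
  assert (A : Def (fun p v => v 1 = 2 ^ v 0)).
  { exact (Def_ren _ (fun i => match i with 0 => 1 | 1 => 0 | _ => i end) Def_op_pow). }
  eapply Def_ext; [|exact (Def_bind _ _ Hf' A)].
  intros p v Hv. cbn [scons]. split.
  - intros (x & _ & -> & H). exact H.
  - intros H. pose proof (Hv 0). pose proof (pow2_gt (f p (etl v))).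
    exists (f p (etl v)). split; [lia|]. split; [reflexivity|exact H].
Qed.

Lemma Def_id1 : Def (fun p v => v 0 = v 1).
Proof. exact (gf_var 0). Qed.

Lemma gf_div f g : GF f -> bd f -> GF g -> GF (fun p v => f p v / g p v).
Proof.
  apply (gf_op2_partial Nat.div (fun _ => 0) f g Def_op_div gf_0).
  intros p x z Hx Hz. apply Nat.div_small. lia.
Qed.

Lemma gf_mod f g : GF f -> bd f -> GF g -> GF (fun p v => f p v mod g p v).
Proof.
  apply (gf_op2_partial Nat.modulo (fun x => x) f g Def_op_mod Def_id1).
  intros p x z Hx Hz. apply Nat.mod_small. lia.
Qed.

Lemma gf_land f g : GF f -> bd f -> GF g -> bd g -> GF (fun p v => Nat.land (f p v) (g p v)).
Proof. apply gf_op2, Def_op_land. Qed.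

Lemma Def_op_sub : Def (fun p v => v 0 = v 1 - v 2).
Proof.
  apply Def_ext with (fun p v => v 0 + v 2 = Nat.max (v 1) (v 2)); [intros p v _; lia|].
  assert (A : Def (fun p v => v 0 = v 1 + v 3)).
  { exact (Def_ren _ (fun i => match i with 0 => 0 | 1 => 1 | 2 => 3 | _ => i end) Def_op_add). }
  assert (B : Def (fun p v => v 0 = Nat.max (v 2) (v 3))).
  { exact (Def_ren _ (fun i => match i with 0 => 0 | S j => S (S j) end) Def_op_max). }
  eapply Def_ext; [|exact (Def_ex _ (Def_and _ _ A B))].
  intros p v Hv. cbn [scons]. split.
  - intros (x & _ & -> & H). exact H.
  - intros H. exists (v 0 + v 2). split; [|auto]. rewrite H. pose proof (Hv 1). pose proof (Hv 2). lia.
Qed.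

Lemma gf_minus f g : GF f -> bd f -> GF g -> GF (fun p v => f p v - g p v).
Proof.
  apply (gf_op2_partial Nat.sub (fun _ => 0) f g Def_op_sub gf_0).
  intros p x z Hx Hz. lia.
Qed.

Lemma df_eq f g : GF f -> bd f -> GF g -> Def (fun p v => f p v = g p v).
Proof. intros Hf Bf Hg. exact (Def_sub f _ Hf Bf Hg). Qed.

(** Reduced to the vanishing of the truncated difference [(f + 1) - g], because [g] may exceed the
    words. *)
Lemma df_lt f g : GF f -> bd f -> GF g -> Def (fun p v => f p v < g p v).
Proof.
  intros Hf Bf Hg.
  assert (HS : GF (fun p v => (f p v + 1) - g p v)).
  { eapply gf_ext; [|apply (gf_op2_partial (fun x z => (x + 1) - z) (fun _ => 0) f g); try assumption].
    - reflexivity.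
    - apply Def_ext with (fun p v => (v 1 < v 2 /\ v 0 = 0) \/ (~ v 1 < v 2 /\ v 0 = (v 1 - v 2) + 1)).
      { intros p v _. lia. }
      assert (Hlt : Def (fun p v => v 1 < v 2)).
      { apply Def_ext with (fun p v => ~ (0 = v 2 - v 1)); [intros p v _; lia|].
        apply Def_not, Def_eq0, gf_minus; [apply gf_var|apply bd_var|apply gf_var]. }
      apply Def_or; apply Def_and; try exact Hlt; try (apply Def_not; exact Hlt).
      + apply df_eq; [apply gf_var|apply bd_var|apply gf_0].
      + apply df_eq; [apply gf_var|apply bd_var|]. apply gf_add; [|apply gf_1].
        apply gf_minus; [apply gf_var|apply bd_var|apply gf_var].
    - apply gf_0.
    - intros p x z Hx Hz. lia. }
  eapply Def_ext; [|exact (Def_eq0 _ HS)]. intros p v _. cbv beta. lia.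
Qed.

Lemma df_ltb f g : GF f -> bd f -> GF g -> Def (fun p v => (f p v <? g p v) = true).
Proof.
  intros Hf Bf Hg. eapply Def_ext; [|exact (df_lt f g Hf Bf Hg)]. intros p v _. now rewrite Nat.ltb_lt.
Qed.

Lemma df_eqb f g : GF f -> bd f -> GF g -> Def (fun p v => (f p v =? g p v) = true).
Proof.
  intros Hf Bf Hg. eapply Def_ext; [|exact (df_eq f g Hf Bf Hg)]. intros p v _. now rewrite Nat.eqb_eq.
Qed.

Lemma df_andb (b b' : P -> (nat -> nat) -> bool) : Def (fun p v => b p v = true) ->
  Def (fun p v => b' p v = true) -> Def (fun p v => (b p v && b' p v) = true).
Proof.
  intros H H'. eapply Def_ext; [|exact (Def_and _ _ H H')]. intros p v _. now rewrite andb_true_iff.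
Qed.

Lemma gf_if (b : P -> (nat -> nat) -> bool) f g : Def (fun p v => b p v = true) -> GF f -> GF g ->
  GF (fun p v => if b p v then f p v else g p v).
Proof.
  intros Hb Hf Hg. unfold GF.
  assert (Hb' : Def (fun p v => b p (etl v) = true)) by exact (Def_ren _ S Hb).
  eapply Def_ext; [|exact (Def_or _ _ (Def_and _ _ Hb' Hf) (Def_and _ _ (Def_not _ Hb') Hg))].
  intros p v _. cbv beta. destruct (b p (etl v)); intuition congruence.
Qed.

Lemma Def_all N R : GF N -> bd N -> Def R -> Def (fun p v => forall i, i < N p v -> R p (i .: v)).
Proof.
  intros HN BN HR.
  assert (HL : Def (fun p v => v 0 < N p (etl v))).
  { apply df_lt; [apply gf_var|apply bd_var|exact (gf_ren N S HN)]. }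
  eapply Def_ext; [|exact (Def_not _ (Def_ex _ (Def_and _ _ HL (Def_not _ HR))))].
  intros p v Hv. cbv beta. specialize (BN p v Hv). split.
  - intros H i Hi. destruct (Classical_Prop.classic (R p (i .: v))) as [|Hn]; [assumption|].
    exfalso. apply H. exists i. split; [lia|]. split; [exact Hi|exact Hn].
  - intros H (i & _ & Hi & Hn). apply Hn, H, Hi.
Qed.

End Family.

(** * Carries, Fourier transform and division *)

Fixpoint carry (B : nat) (f : nat -> nat) (b : nat) : nat :=
  match b with 0 => 0 | S b => (carry B f b + f b) / 2 ^ B end.

Lemma carry_num B f b : carry B f b = num B b f / 2 ^ (B * b).
Proof.
  induction b as [|b IH]; [unfold num; simpl; rewrite Nat.mul_0_r; reflexivity|].
  cbn [carry]. rewrite IH, num_S.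
  replace (B * S b) with (B * b + B) by lia. rewrite Nat.pow_add_r, <- Nat.Div0.div_div.
  rewrite Nat.div_add by apply pow2_ne. reflexivity.
Qed.

(** The entries of [f] may exceed [2 ^ B]. Entries above [b] contribute multiples of
    [2 ^ (B * (b + 1))], which do not affect the digit [b]. *)
Lemma dg_carry B f T b : b < T -> dg B (num B T f) b = (carry B f b + f b) mod 2 ^ B.
Proof.
  intros Hb. rewrite carry_num. unfold dg.
  replace T with (b + 1 + (T - b - 1)) by lia. unfold num at 1. rewrite sum_split.
  rewrite (sum_ext (T - b - 1) _ (fun i => f (b + 1 + i) * 2 ^ (B * i) * 2 ^ B * 2 ^ (B * b))).
  - rewrite !sum_mul_r, Nat.div_add by apply pow2_ne. rewrite Nat.Div0.mod_add.
    rewrite Nat.add_1_r. cbn [sum]. fold (num B b f).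
    rewrite Nat.div_add by apply pow2_ne. reflexivity.
  - intros i _. replace (B * (b + 1 + i)) with (B * i + B + B * b) by lia. rewrite !Nat.pow_add_r. ring.
Qed.

(** Carry and entry below [2 ^ e] add up to less than twice that, and the division by [2 ^ B] at
    least halves it. *)
Lemma carry_lt B f b e : 1 <= B -> (forall i, i < b -> f i < 2 ^ e) -> carry B f b < 2 ^ e.
Proof.
  intros HB Hf. induction b as [|b IH]; [apply pow2_pos|]. cbn [carry].
  specialize (IH (fun i Hi => Hf i (Nat.lt_lt_succ_r _ _ Hi))). specialize (Hf b (Nat.lt_succ_diag_r b)).
  apply Nat.Div0.div_lt_upper_bound. assert (2 ^ 1 <= 2 ^ B) by now apply pow2_le. simpl in *. nia.
Qed.

Lemma sum_mod Q n f g : (forall i, i < n -> f i mod Q = g i mod Q) -> sum n f mod Q = sum n g mod Q.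
Proof.
  induction n as [|n IH]; simpl; intros H; [reflexivity|].
  rewrite Nat.Div0.add_mod, IH, (H n), <- Nat.Div0.add_mod by auto. reflexivity.
Qed.

Lemma mul_mod_eq Q a b c d : a mod Q = b mod Q -> c mod Q = d mod Q -> (a * c) mod Q = (b * d) mod Q.
Proof. intros H1 H2. rewrite Nat.Div0.mul_mod, H1, H2, <- Nat.Div0.mul_mod. reflexivity. Qed.

Lemma add_mod_eq Q a b c d : a mod Q = b mod Q -> c mod Q = d mod Q -> (a + c) mod Q = (b + d) mod Q.
Proof. intros H1 H2. rewrite Nat.Div0.add_mod, H1, H2, <- Nat.Div0.add_mod. reflexivity. Qed.

(** The coefficients are natural numbers, so the value at 1 bounds each of them; degrees are below
    [D]. *)
Definition Pol (D : nat) (f : nat -> nat) : Prop :=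
  exists c, forall x, f x = sum D (fun i => c i * x ^ i).

Lemma Pol_le D D' f : D <= D' -> Pol D f -> Pol D' f.
Proof.
  intros H [c Hc]. exists (fun i => if i <? D then c i else 0). intros x. rewrite Hc.
  replace D' with (D + (D' - D)) by lia. rewrite sum_split.
  rewrite (sum_0 (D' - D)), Nat.add_0_r.
  - apply sum_ext. intros i Hi. destruct (Nat.ltb_spec i D); [reflexivity|lia].
  - intros i Hi. destruct (Nat.ltb_spec (D + i) D); [lia|reflexivity].
Qed.

Lemma Pol_ext D f g : (forall x, f x = g x) -> Pol D f -> Pol D g.
Proof. intros H [c Hc]. exists c. intros x. now rewrite <- H. Qed.

Lemma Pol_0 D : Pol D (fun _ => 0).
Proof. exists (fun _ => 0). intros x. symmetry. now apply sum_0. Qed.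

Lemma Pol_add D f g : Pol D f -> Pol D g -> Pol D (fun x => f x + g x).
Proof.
  intros [c Hc] [e He]. exists (fun i => c i + e i). intros x. rewrite Hc, He, <- sum_add.
  apply sum_ext; intros; ring.
Qed.

Lemma Pol_shift D k a f : Pol D f -> Pol (k + D) (fun x => a * x ^ k * f x).
Proof.
  intros [c Hc]. exists (fun i => if i <? k then 0 else a * c (i - k)). intros x. rewrite Hc, sum_split.
  rewrite (sum_0 k).
  - rewrite <- sum_mul_l. simpl. apply sum_ext. intros i Hi.
    destruct (Nat.ltb_spec (k + i) k); [lia|]. replace (k + i - k) with i by lia.
    rewrite Nat.pow_add_r. ring.
  - intros i Hi. destruct (Nat.ltb_spec i k); [reflexivity|lia].
Qed.

Lemma Pol_mul D1 D2 f g : Pol D1 f -> Pol D2 g -> Pol (D1 + D2) (fun x => f x * g x).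
Proof.
  intros [c Hc] Hg.
  apply Pol_ext with (fun x => sum D1 (fun i => c i * x ^ i) * g x); [intros x; now rewrite Hc|].
  clear f Hc. induction D1 as [|D1 IH].
  - apply Pol_ext with (fun _ => 0); [reflexivity|]. apply Pol_0.
  - apply Pol_ext with (fun x => sum D1 (fun i => c i * x ^ i) * g x + c D1 * x ^ D1 * g x).
    + intros x. simpl. ring.
    + apply Pol_add; (eapply Pol_le; [|exact IH || exact (Pol_shift D2 D1 (c D1) g Hg)]); lia.
Qed.

Lemma Pol_const a : Pol 1 (fun _ => a).
Proof. exists (fun _ => a). intros x. simpl. lia. Qed.

Lemma Pol_mono k a : Pol (k + 1) (fun x => a * x ^ k).
Proof.
  eapply Pol_ext; [|apply (Pol_shift 1 k a _ (Pol_const 1))]. intros x. simpl. lia.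
Qed.

Lemma Pol_sum s D (F : nat -> nat -> nat) : (forall i, i < s -> Pol D (F i)) ->
  Pol D (fun x => sum s (fun i => F i x)).
Proof.
  induction s as [|s IH]; intros H; [apply Pol_0|]. simpl. apply Pol_add; auto.
Qed.

Lemma Pol_pow D f i : Pol D f -> Pol (i * D + 1) (fun x => f x ^ i).
Proof.
  intros Hf. induction i as [|i IH]; [exact (Pol_const 1)|].
  apply Pol_ext with (fun x => f x * f x ^ i); [reflexivity|].
  eapply Pol_le; [|apply Pol_mul; [exact Hf|exact IH]]. lia.
Qed.

Definition numpoly (B N X x : nat) : nat := sum N (fun b => dg B X b * x ^ b).

Lemma numpoly_Pol B N X : Pol N (numpoly B N X).
Proof. exists (dg B X). reflexivity. Qed.

Lemma numpoly_base B N X : X < 2 ^ (B * N) -> numpoly B N X (2 ^ B) = X.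
Proof.
  intros H. rewrite <- (num_dg B N X H) at 2. apply sum_ext. intros i _. now rewrite <- Nat.pow_mul_r.
Qed.

Lemma numpoly_1 B N X : numpoly B N X 1 <= N * 2 ^ B.
Proof.
  rewrite <- sum_const. apply sum_le. intros i _. rewrite Nat.pow_1_l, Nat.mul_1_r.
  apply Nat.lt_le_incl, dg_lt.
Qed.

(** Modulo [2^a + 1], [2] is a root of unity of order [2 a]. *)
Section DFT.
Variable al : nat.
Let a := 2 ^ al.
Let Q := 2 ^ a + 1.

Lemma Q_gt : 1 < Q.
Proof. unfold Q. pose proof (pow2_pos a). lia. Qed.

Lemma geo_double x i : sum (2 ^ S i) (fun j => x ^ j) = sum (2 ^ i) (fun j => x ^ j) * (1 + x ^ (2 ^ i)).
Proof.
  rewrite Nat.pow_succ_r'. replace (2 * 2 ^ i) with (2 ^ i + 2 ^ i) by lia. rewrite sum_split.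
  rewrite (sum_ext _ (fun j => x ^ (2 ^ i + j)) (fun j => x ^ 2 ^ i * x ^ j)).
  - rewrite sum_mul_l, Nat.mul_add_distr_l, Nat.mul_1_r, (Nat.mul_comm (x ^ 2 ^ i)). reflexivity.
  - intros j _. apply Nat.pow_add_r.
Qed.

(** By [geo_double] the sum is the product of all [1 + x ^ (2 ^ i)] with [i < k], so one divisible
    factor suffices. *)
Lemma geo_div x i k : i < k -> Nat.divide Q (1 + x ^ (2 ^ i)) -> Nat.divide Q (sum (2 ^ k) (fun j => x ^ j)).
Proof.
  induction k as [|k IH]; intros Hi Hd; [lia|]. rewrite geo_double.
  destruct (Nat.eq_dec i k) as [->|Hn]; [now apply Nat.divide_mul_r|].
  apply Nat.divide_mul_l, IH; [lia|assumption].
Qed.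

Lemma pow_odd o : Nat.divide Q (1 + (2 ^ a) ^ (2 * o + 1)).
Proof.
  set (A := 2 ^ a). assert (HA : 1 <= A) by apply pow2_pos.
  (* modulo A + 1, A ^ 2 = (A - 1) (A + 1) + 1 *)
  assert (H2 : forall o, exists k, A ^ (2 * o) = k * Q + 1).
  { clear o. induction o as [|o [k IH]]; [exists 0; reflexivity|].
    replace (2 * S o) with (2 + 2 * o) by lia. rewrite Nat.pow_add_r, IH.
    exists ((A - 1) * (k * Q + 1) + k). unfold Q. fold A.
    replace (A ^ 2) with ((A - 1) * (A + 1) + 1); [ring|]. simpl. nia. }
  destruct (H2 o) as [k Hk]. exists (k * A + 1). rewrite Nat.pow_add_r, Hk, Nat.pow_1_r.
  unfold Q. fold A. ring.
Qed.

Lemma odd_part h : 0 < h -> exists l o, h = 2 ^ l * (2 * o + 1).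
Proof.
  induction h as [h IH] using lt_wf_ind. intros Hh.
  destruct (Nat.Even_or_Odd h) as [[k Hk]|[k Hk]].
  - destruct (IH k ltac:(lia) ltac:(lia)) as (l & o & E). exists (S l), o.
    rewrite Nat.pow_succ_r'. rewrite <- Nat.mul_assoc, <- E. exact Hk.
  - exists 0, k. simpl. lia.
Qed.

(** For [h = 2 ^ l * odd] with [l <= al], the power of [2 ^ h] with exponent [2 ^ (al - l)] is an
    odd power of [2 ^ a], hence -1 modulo [Q]: one factor of the geometric sum vanishes. Primality
    of [Q] is not assumed. *)
Lemma root_sum_0 h : 0 < h -> ~ Nat.divide (2 * a) h ->
  sum (2 * a) (fun j => (2 ^ h) ^ j) mod Q = 0.
Proof.
  intros Hh Hd. apply Nat.Lcm0.mod_divide. unfold a. rewrite <- Nat.pow_succ_r'.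
  destruct (odd_part h Hh) as (l & o & E).
  assert (Hl : l <= al).
  { destruct (Nat.le_gt_cases l al) as [|Hl]; [assumption|exfalso; apply Hd].
    exists (2 ^ (l - S al) * (2 * o + 1)). unfold a. rewrite E, <- Nat.pow_succ_r'.
    replace l with (l - S al + S al) at 1 by lia. rewrite Nat.pow_add_r. ring. }
  apply geo_div with (al - l); [lia|].
  rewrite <- Nat.pow_mul_r. replace (h * 2 ^ (al - l)) with (a * (2 * o + 1)).
  - rewrite Nat.pow_mul_r. apply pow_odd.
  - rewrite E. unfold a. replace al with (l + (al - l)) at 1 by lia. rewrite Nat.pow_add_r. ring.
Qed.

Lemma pow_2a k : 2 ^ (2 * a * k) mod Q = 1.
Proof.
  rewrite Nat.pow_mul_r. transitivity (1 mod Q); [|apply Nat.mod_small, Q_gt].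
  assert (H : 2 ^ (2 * a) mod Q = 1 mod Q).
  { replace (2 * a) with (a + a) by lia. rewrite Nat.pow_add_r. set (A := 2 ^ a).
    assert (1 <= A) by apply pow2_pos.
    replace (A * A) with (1 + (A - 1) * Q); [apply Nat.Div0.mod_add|]. unfold Q. fold A. nia. }
  induction k as [|k IH]; [reflexivity|]. rewrite Nat.pow_succ_r'. exact (mul_mod_eq Q _ 1 _ 1 H IH).
Qed.

Lemma pow_mod_2a e : 2 ^ e mod Q = 2 ^ (e mod (2 * a)) mod Q.
Proof.
  assert (Ha : 2 * a <> 0) by (pose proof (pow2_pos al); unfold a; lia).
  rewrite (Nat.div_mod e (2 * a) Ha) at 1. rewrite Nat.pow_add_r.
  rewrite <- (Nat.mul_1_l (2 ^ (e mod (2 * a)))) at 2. apply mul_mod_eq; [|reflexivity].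
  rewrite pow_2a. symmetry. apply Nat.mod_small, Q_gt.
Qed.

Lemma root_sum_1 k : sum (2 * a) (fun j => (2 ^ (2 * a * k)) ^ j) mod Q = (2 * a) mod Q.
Proof.
  transitivity (sum (2 * a) (fun _ => 1) mod Q); [|now rewrite sum_const, Nat.mul_1_r].
  apply sum_mod. intros j _. rewrite <- Nat.pow_mul_r, <- Nat.mul_assoc, pow_2a.
  symmetry. apply Nat.mod_small, Q_gt.
Qed.

(** Inverse Fourier transform: summing the values against the powers of the inverse root leaves
    [2 * a * c t]. As [2 * a = 2 ^ S al] and [2 ^ (2 * a)] is 1 modulo [Q], the last factor is the
    inverse of [2 * a]. *)
Lemma dft_coef c f t : t < 2 * a -> (forall i, i < 2 * a -> c i < Q) ->
  (forall x, f x = sum (2 * a) (fun i => c i * x ^ i)) ->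
  (sum (2 * a) (fun j => (f (2 ^ j) mod Q) * 2 ^ ((j * (2 * a - t)) mod (2 * a)))
    * 2 ^ (2 * a - S al)) mod Q = c t.
Proof.
  intros Ht Hc Hf.
  assert (Hal : S al <= 2 * a) by (pose proof (pow2_gt al); unfold a; lia).
  assert (E1 : sum (2 * a) (fun j => (f (2 ^ j) mod Q) * 2 ^ ((j * (2 * a - t)) mod (2 * a))) mod Q
     = (c t * (2 * a)) mod Q).
  { transitivity (sum (2 * a) (fun j => sum (2 * a) (fun i => c i * (2 ^ (i + (2 * a - t))) ^ j)) mod Q).
    - apply sum_mod. intros j _. rewrite Hf.
      transitivity ((sum (2 * a) (fun i => c i * (2 ^ j) ^ i) * 2 ^ (j * (2 * a - t))) mod Q).
      + apply mul_mod_eq; [apply Nat.Div0.mod_mod|symmetry; apply pow_mod_2a].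
      + f_equal. rewrite <- sum_mul_r. apply sum_ext. intros i _.
        rewrite <- !Nat.pow_mul_r, <- Nat.mul_assoc, <- Nat.pow_add_r. f_equal. f_equal. nia.
    - rewrite sum_swap.
      rewrite (sum_ext _ _ (fun i => c i * sum (2 * a) (fun j => (2 ^ (i + (2 * a - t))) ^ j))).
      2:{ intros i _. apply sum_mul_l. }
      transitivity (sum (2 * a) (fun i => if i =? t then c t * (2 * a) else 0) mod Q).
      + apply sum_mod. intros i Hi. destruct (Nat.eqb_spec i t) as [->|Hn].
        * apply mul_mod_eq; [reflexivity|]. replace (t + (2 * a - t)) with (2 * a * 1) by lia.
          apply root_sum_1.
        * rewrite Nat.Div0.mod_0_l, Nat.Div0.mul_mod, root_sum_0; [|lia|].
          -- rewrite Nat.mul_0_r. apply Nat.Div0.mod_0_l.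
          -- intros [k Hk]. destruct k as [|[|k]]; nia.
      + rewrite (sum_single _ _ t Ht).
        * now rewrite Nat.eqb_refl.
        * intros j _ Hj. destruct (Nat.eqb_spec j t); [lia|reflexivity]. }
  rewrite (mul_mod_eq _ _ _ _ _ E1 eq_refl).
  replace (c t * (2 * a) * 2 ^ (2 * a - S al)) with (c t * 2 ^ (2 * a * 1)).
  - rewrite (mul_mod_eq Q (c t) (c t) (2 ^ (2 * a * 1)) 1 eq_refl), Nat.mul_1_r.
    + apply Nat.mod_small. auto.
    + rewrite pow_2a. symmetry. apply Nat.mod_small, Q_gt.
  - assert (Ea : 2 ^ S al = 2 * a) by apply Nat.pow_succ_r'.
    assert (Eb : 2 * a * 2 ^ (2 * a - S al) = 2 ^ (2 * a * 1)).
    { rewrite <- Ea at 1. rewrite <- Nat.pow_add_r. f_equal. lia. }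
    rewrite <- Eb, !Nat.mul_assoc. reflexivity.
Qed.
End DFT.

(** The quotient of [T ^ s - X ^ s] by [T - X], in a form suited to iteration. *)
Fixpoint horner (X T s : nat) : nat :=
  match s with 0 => 0 | S s => horner X T s * X + T ^ s end.

Lemma horner_sum X T s : horner X T s = sum s (fun i => T ^ i * X ^ (s - 1 - i)).
Proof.
  induction s as [|s IH]; [reflexivity|]. cbn [horner sum]. rewrite IH, <- sum_mul_r.
  f_equal.
  - apply sum_ext. intros i Hi. replace (S s - 1 - i) with (S (s - 1 - i)) by lia. simpl. ring.
  - replace (S s - 1 - s) with 0 by lia. simpl. lia.
Qed.

Lemma horner_geo X Y s : horner X (X + Y) s * Y + X ^ s = (X + Y) ^ s.
Proof.
  induction s as [|s IH]; [reflexivity|]. cbn [horner Nat.pow]. rewrite <- IH. ring.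
Qed.

(** Replacing [U] by [U + 1/2] absorbs the truncation error of the geometric series. *)
Lemma div_series U W K X M s : 0 < W -> K * W + X = 2 ^ M -> (2 * U + 1) * X ^ s < 2 ^ (M * s) ->
  ((2 * U + 1) * K * horner X (2 ^ M) s) / 2 ^ (M * s + 1) = U / W.
Proof.
  intros HW HK HX. set (Sg := horner X (2 ^ M) s). set (N := 2 ^ (M * s)) in *.
  assert (Hg : Sg * (K * W) + X ^ s = N).
  { unfold Sg, N. rewrite Nat.pow_mul_r, <- HK, (Nat.add_comm _ X). apply horner_geo. }
  set (T := (2 * U + 1) * K * Sg).
  assert (HT : T * W + (2 * U + 1) * X ^ s = (2 * U + 1) * N) by (unfold T; rewrite <- Hg; ring).
  rewrite Nat.pow_add_r, Nat.pow_1_r. fold N.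
  assert (HN : 0 < N) by apply pow2_pos.
  pose proof (Nat.div_mod U W ltac:(lia)) as HU. pose proof (Nat.mod_upper_bound U W ltac:(lia)) as Hr.
  set (q := U / W) in *. set (r := U mod W) in *.
  symmetry. apply Nat.div_unique with (T - N * 2 * q).
  - assert (H1 : T * W < N * 2 * (q + 1) * W).
    { apply Nat.le_lt_trans with ((2 * U + 1) * N); [lia|].
      replace (N * 2 * (q + 1) * W) with (2 * (W * q + W) * N) by ring.
      apply Nat.mul_lt_mono_pos_r; [assumption|lia]. }
    apply Nat.mul_lt_mono_pos_r in H1; [|assumption]. lia.
  - assert (H1 : N * 2 * q * W < T * W).
    { assert (N * 2 * q * W <= 2 * U * N).
      { replace (N * 2 * q * W) with (2 * (W * q) * N) by ring. apply Nat.mul_le_mono_r. lia. }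
      lia. }
    apply Nat.mul_lt_mono_pos_r in H1; [|assumption]. lia.
Qed.

(** A shift by [e] gives [W] exactly [n] bits, and then [x0] is a rounded-down quotient of
    [2 ^ (n + h) - 1]. So [x0 * 2 ^ e] approximates a scaled reciprocal to about [h] bits although
    [x0] is only [h + 2] bits long. *)
Lemma scale_exists W n h : 0 < W -> W < 2 ^ n ->
  exists e x0, e < n /\ x0 < 2 ^ (h + 2) /\ 2 ^ (n + h) <= x0 * 2 ^ e * W + 2 ^ n /\ x0 * 2 ^ e * W < 2 ^ (n + h).
Proof.
  intros HW HWn. destruct (Nat.log2_spec W HW) as [H1 H2].
  assert (Hl : Nat.log2 W < n) by (apply Nat.log2_lt_pow2; assumption).
  set (e := n - 1 - Nat.log2 W). set (W' := 2 ^ e * W).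
  assert (B1 : 2 ^ (n - 1) <= W').
  { unfold W'. replace (n - 1) with (e + Nat.log2 W) by (unfold e; lia). rewrite Nat.pow_add_r.
    now apply Nat.mul_le_mono_l. }
  assert (B2 : W' < 2 ^ n).
  { unfold W'. replace n with (e + S (Nat.log2 W)) by (unfold e; lia). rewrite Nat.pow_add_r.
    apply Nat.mul_lt_mono_pos_l; [apply pow2_pos|assumption]. }
  pose proof (pow2_pos (n - 1)) as P1. pose proof (pow2_pos (n + h)) as P2.
  exists e, ((2 ^ (n + h) - 1) / W').
  pose proof (Nat.div_mod (2 ^ (n + h) - 1) W' ltac:(lia)) as Hd.
  pose proof (Nat.mod_upper_bound (2 ^ (n + h) - 1) W' ltac:(lia)) as Hm.
  set (x0 := (2 ^ (n + h) - 1) / W') in *.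
  replace (x0 * 2 ^ e * W) with (W' * x0) by (unfold W'; ring).
  split; [unfold e; lia|]. split; [|lia].
  unfold x0. apply Nat.Div0.div_lt_upper_bound.
  apply Nat.lt_le_trans with (2 ^ (n - 1) * 2 ^ (h + 2)); [|now apply Nat.mul_le_mono_r].
  rewrite <- Nat.pow_add_r. assert (2 ^ (n + h) <= 2 ^ (n - 1 + (h + 2))) by (apply pow2_le; lia). lia.
Qed.

Lemma ones_num B K : num B K (fun _ => 2 ^ B - 1) = 2 ^ (B * K) - 1.
Proof.
  induction K as [|K IH]; [unfold num; simpl; rewrite Nat.mul_0_r; reflexivity|].
  rewrite num_S, IH. replace (B * S K) with (B + B * K) by lia. rewrite Nat.pow_add_r.
  pose proof (pow2_pos B). pose proof (pow2_pos (B * K)). nia.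
Qed.

Lemma dg_ones B K b : dg B (2 ^ (B * K) - 1) b = if b <? K then 2 ^ B - 1 else 0.
Proof.
  rewrite <- ones_num. assert (H : forall i, i < K -> 2 ^ B - 1 < 2 ^ B).
  { intros. pose proof (pow2_pos B). lia. }
  destruct (Nat.ltb_spec b K); [now rewrite dg_num|now rewrite dg_num_ge].
Qed.

Lemma dg_compl B K X b : X < 2 ^ (B * K) -> b < K -> dg B (2 ^ (B * K) - 1 - X) b = 2 ^ B - 1 - dg B X b.
Proof.
  intros HX Hb.
  assert (E : 2 ^ (B * K) - 1 - X = num B K (fun i => 2 ^ B - 1 - dg B X i)).
  { rewrite <- ones_num, <- (num_dg B K X HX) at 1.
    assert (num B K (fun _ => 2 ^ B - 1) = num B K (dg B X) + num B K (fun i => 2 ^ B - 1 - dg B X i)); [|lia].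
    unfold num. rewrite <- sum_add. apply sum_ext. intros i _.
    pose proof (dg_lt B X i). rewrite <- Nat.mul_add_distr_r. f_equal. lia. }
  rewrite E. rewrite dg_num; [reflexivity| |assumption].
  intros i _. pose proof (pow2_pos B). lia.
Qed.

Lemma dg_mod B K X b : dg B (X mod 2 ^ (B * K)) b = if b <? K then dg B X b else 0.
Proof.
  rewrite <- num_dg_mod. destruct (Nat.ltb_spec b K).
  - apply dg_num; [|assumption]. intros; apply dg_lt.
  - apply dg_num_ge; [|assumption]. intros; apply dg_lt.
Qed.

Lemma dg_pow2 B e b : 1 <= B -> dg B (2 ^ e) b = if b =? e / B then 2 ^ (e mod B) else 0.
Proof.
  intros HB. set (k := e / B).
  assert (E : 2 ^ e = num B (S k) (fun i => if i =? k then 2 ^ (e mod B) else 0)).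
  { unfold num. rewrite (sum_single _ _ k); [|lia|].
    - rewrite Nat.eqb_refl, <- Nat.pow_add_r. f_equal. unfold k.
      pose proof (Nat.div_mod e B ltac:(lia)). lia.
    - intros j _ Hj. destruct (Nat.eqb_spec j k); [lia|reflexivity]. }
  assert (Hl : forall i, i < S k -> (if i =? k then 2 ^ (e mod B) else 0) < 2 ^ B).
  { intros i _. destruct (i =? k); [|apply pow2_pos]. apply pow2_lt, Nat.mod_upper_bound; lia. }
  rewrite E. destruct (Nat.lt_ge_cases b (S k)) as [Hb|Hb].
  - now rewrite dg_num.
  - rewrite dg_num_ge by assumption. destruct (Nat.eqb_spec b k); [lia|reflexivity].
Qed.

Fixpoint iter (g : nat -> nat -> nat) (i0 N s : nat) : nat :=
  match N with 0 => s | S N => g (i0 + N) (iter g i0 N s) end.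

Lemma iter_ext g g' i0 N s (I : nat -> Prop) : I s -> (forall i s, i < i0 + N -> I s -> I (g' i s)) ->
  (forall i s, i < i0 + N -> I s -> g i s = g' i s) -> iter g i0 N s = iter g' i0 N s.
Proof.
  intros Hs HI H. assert (Hb : forall K, K <= N -> I (iter g' i0 K s) /\ iter g i0 K s = iter g' i0 K s).
  { induction K as [|K IH]; intros HK; [auto|]. destruct (IH ltac:(lia)) as [J1 J2]. simpl.
    rewrite J2. split; [apply HI|apply H]; auto; lia. }
  now apply Hb.
Qed.

Lemma iter_inv g i0 N s (I : nat -> Prop) : I s -> (forall i s, i < i0 + N -> I s -> I (g i s)) -> I (iter g i0 N s).
Proof. intros Hs HI. induction N as [|N IH]; simpl; [auto|]. apply HI; [lia|]. apply IH. intros; apply HI; auto; lia. Qed.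

Lemma iter_add g i0 N K s : iter g i0 (N + K) s = iter g (i0 + N) K (iter g i0 N s).
Proof.
  induction K as [|K IH]; simpl; [now rewrite Nat.add_0_r|].
  rewrite Nat.add_succ_r. simpl. rewrite IH. f_equal. lia.
Qed.

Lemma iter_iter g N i0 K s :
  iter (fun i s => iter g (i * N) N s) i0 K s = iter g (i0 * N) (K * N) s.
Proof.
  induction K as [|K IH]; simpl; [reflexivity|].
  rewrite IH, (Nat.add_comm N), iter_add. f_equal. lia.
Qed.

(** * Definability of bounded iteration *)

(** All lengths are powers of [2 ^ cdel]. A long number has [n = 2 ^ (16 * cdel)] bits, that is [cB]
    blocks of [cB] bits. Polynomials in the block base must have at most [2 * ca] coefficients below
    [2 ^ ca]; the division series makes them about [2 ^ (9 * cdel)] long, whence the exponent 10. A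
    state of [cst] bits holds a number below [cB0], a word holds [cN1 + 1] states, and
    [clim = cN1 ^ 4] exceeds [2 * ca]. *)
Definition cB (c : ctx) : nat := 2 ^ (8 * cdel c).
Definition ca (c : ctx) : nat := 2 ^ (10 * cdel c).
Definition cst (c : ctx) : nat := 2 ^ (11 * cdel c).
Definition cN1 (c : ctx) : nat := 2 ^ (3 * cdel c).
Definition clim (c : ctx) : nat := 2 ^ (12 * cdel c).
Definition cQ (c : ctx) : nat := 2 ^ ca c + 1.
Definition cB0 (c : ctx) : nat := 2 ^ (2 * ca c).

Section Numeric.
Variable c : ctx.
Let dl := cdel c.

Lemma B0_ge : 4 <= cB0 c.
Proof. apply (pow2_le 2). pose proof (pow2_pos (10 * cdel c)). unfold ca. lia. Qed.

Lemma tower_le e f : e <= f -> 2 ^ 2 ^ e <= 2 ^ 2 ^ f.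
Proof. intros H. now apply pow2_le, pow2_le. Qed.

Lemma B0_eq : cB0 c = 2 ^ 2 ^ (10 * dl + 1).
Proof. unfold cB0, ca. rewrite Nat.add_1_r, Nat.pow_succ_r'. reflexivity. Qed.

Lemma B0_4 : cB0 c * cB0 c * cB0 c * cB0 c < 2 ^ cm c.
Proof.
  rewrite B0_eq, <- !Nat.pow_add_r. apply pow2_lt. unfold cm. fold dl.
  apply Nat.le_lt_trans with (2 ^ (10 * dl + 3)).
  - replace (10 * dl + 3) with (2 + (10 * dl + 1)) by lia. rewrite (Nat.pow_add_r 2 2). simpl (2 ^ 2). lia.
  - apply pow2_lt. pose proof (c_del c). unfold dl. lia.
Qed.

Lemma B0_st : cB0 c <= 2 ^ cst c.
Proof. rewrite B0_eq. apply tower_le. pose proof (c_del c). unfold dl. lia. Qed.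

Lemma Q_le : cQ c < cB0 c.
Proof.
  unfold cQ, cB0. replace (2 * ca c) with (ca c + ca c) by lia. rewrite Nat.pow_add_r.
  assert (2 ^ 1 <= 2 ^ ca c) by (apply pow2_le, pow2_pos). simpl in *. nia.
Qed.

Lemma lim_le : clim c <= cB0 c.
Proof.
  rewrite B0_eq. apply pow2_le. fold dl. pose proof (pow2_gt (10 * dl)).
  apply Nat.le_trans with (2 ^ (10 * dl)); [|apply pow2_le; lia].
  replace (10 * dl) with (5 + (10 * dl - 5)) by (pose proof (c_del c); unfold dl; lia).
  rewrite Nat.pow_add_r. pose proof (pow2_gt (10 * dl - 5)). simpl (2 ^ 5). unfold dl in *. pose proof (c_del c). lia.
Qed.

Lemma B_le : 2 ^ cB c <= cB0 c.
Proof. rewrite B0_eq. apply tower_le. lia. Qed.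

Lemma a_le : 2 * ca c <= cB0 c.
Proof. apply Nat.lt_le_incl, pow2_gt. Qed.

Lemma cB_le : cB c <= cB0 c.
Proof. apply Nat.le_trans with (2 := B_le). apply Nat.lt_le_incl, pow2_gt. Qed.

Lemma st_bits : cst c * (cN1 c + 1) <= cm c.
Proof.
  unfold cst, cN1, cm. pose proof (c_del c). pose proof (pow2_pos (3 * cdel c)).
  apply Nat.le_trans with (2 ^ (11 * cdel c) * 2 ^ (3 * cdel c + 1)).
  - apply Nat.mul_le_mono_l. rewrite (Nat.pow_add_r 2 (3 * cdel c)), Nat.pow_1_r. lia.
  - rewrite <- Nat.pow_add_r. apply pow2_le. lia.
Qed.

Lemma lim_N1 : clim c = cN1 c * (cN1 c * (cN1 c * cN1 c)).
Proof. unfold clim, cN1. rewrite <- !Nat.pow_add_r. f_equal. lia. Qed.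

Lemma small_lt_m x : x <= cB0 c * cB0 c * cB0 c * cB0 c -> x < 2 ^ cm c.
Proof. intros H. apply Nat.le_lt_trans with (1 := H), B0_4. Qed.

Lemma small2 x : x <= 4 * (cB0 c * cB0 c) -> x < 2 ^ cm c.
Proof.
  intros H. apply small_lt_m. etransitivity; [exact H|]. rewrite <- !Nat.mul_assoc.
  pose proof B0_ge. apply Nat.mul_le_mono; [assumption|].
  rewrite <- (Nat.mul_1_l (cB0 c * cB0 c)) at 1. apply Nat.mul_le_mono_r. lia.
Qed.

Lemma small1 x : x <= 4 * cB0 c -> x < 2 ^ cm c.
Proof. intros H. apply small2. pose proof B0_ge. nia. Qed.

Lemma N1_le : cN1 c <= cB0 c.
Proof.
  apply Nat.le_trans with (2 := lim_le). unfold cN1, clim. apply pow2_le; lia.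
Qed.
End Numeric.

Section Iteration.
Variables (P : Type) (pc : P -> ctx) (bs : P -> nat).
Notation GF := (GF P pc bs).
Notation Def := (Def P pc bs).
Notation bd := (bd P pc).
Notation m p := (cm (pc p)).

Lemma gf_cst k : k <= 16 -> GF (fun p _ => 2 ^ (k * cdel (pc p))).
Proof.
  intros Hk. apply gf_pow2c. intros p. unfold lam. simpl (0 * _). rewrite Nat.add_0_r.
  replace (15 * cdel (pc p) + 8) with (1 + (15 * cdel (pc p) + 7)) by lia. rewrite Nat.pow_add_r.
  pose proof (pow2_gt (15 * cdel (pc p) + 7)). simpl (2 ^ 1). nia.
Qed.

Lemma gf_B : GF (fun p _ => cB (pc p)). Proof. apply (gf_cst 8). lia. Qed.
Lemma gf_a : GF (fun p _ => ca (pc p)). Proof. apply (gf_cst 10). lia. Qed.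
Lemma gf_st : GF (fun p _ => cst (pc p)). Proof. apply (gf_cst 11). lia. Qed.
Lemma gf_N1 : GF (fun p _ => cN1 (pc p)). Proof. apply (gf_cst 3). lia. Qed.
Lemma gf_lim : GF (fun p _ => clim (pc p)). Proof. apply (gf_cst 12). lia. Qed.
Lemma gf_2a : GF (fun p _ => 2 * ca (pc p)).
Proof.
  eapply gf_ext; [|exact (gf_add _ _ _ _ _ gf_a gf_a)]. intros p v _. cbv beta. lia.
Qed.
Lemma gf_Q : GF (fun p _ => cQ (pc p)).
Proof. apply gf_add; [apply gf_pow, gf_a|apply gf_1]. Qed.

Lemma gf_comp2 g f1 f2 c : GF g -> GF f1 -> bd f1 -> GF f2 -> bd f2 ->
  GF (fun p u => g p (f1 p u .: f2 p u .: (fun k => u (c + k)))).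
Proof.
  intros Hg H1 B1 H2 B2.
  assert (G1 : GF (fun p v => g p (v 0 .: v 1 .: (fun k => v (2 + (c + k)))))).
  { eapply gf_ext; [|exact (gf_ren _ _ _ g (fun i => match i with 0 => 0 | 1 => 1 | S (S k) => 2 + (c + k) end) Hg)].
    intros p v _. cbv beta. f_equal. apply functional_extensionality. now intros [|[|i]]. }
  assert (G2 : GF (fun p v => g p (f1 p (etl v) .: v 0 .: (fun k => v (1 + (c + k)))))).
  { apply (gf_sub _ _ _ (fun p v => f1 p (etl v)) _) in G1; [exact G1|exact (gf_ren _ _ _ f1 S H1)|].
    intros p v Hv. apply B1. intros i; apply Hv. }
  exact (gf_sub _ _ _ f2 _ H2 B2 G2).
Qed.

Lemma gf_comp1 g f1 c : GF g -> GF f1 -> bd f1 -> GF (fun p u => g p (f1 p u .: (fun k => u (c + k)))).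
Proof.
  intros Hg H1 B1.
  assert (G1 : GF (fun p v => g p (v 0 .: (fun k => v (1 + (c + k)))))).
  { eapply gf_ext; [|exact (gf_ren _ _ _ g (fun i => match i with 0 => 0 | S k => 1 + (c + k) end) Hg)].
    intros p v _. cbv beta. f_equal. apply functional_extensionality. now intros [|i]. }
  exact (gf_sub _ _ _ f1 _ H1 B1 G1).
Qed.

Lemma gf_dg D f h : GF D -> GF f -> bd f -> GF h -> GF (fun p v => dg (D p v) (f p v) (h p v)).
Proof.
  intros HD Hf Bf Hh. unfold dg. apply gf_mod.
  - apply gf_div; [assumption|assumption|]. now apply gf_pow, gf_mul.
  - intros p v Hv. apply Nat.le_lt_trans with (f p v); [apply div_le|now apply Bf].
  - now apply gf_pow.
Qed.

Lemma bd_dg D f h : bd f -> bd (fun p v => dg (D p v) (f p v) (h p v)).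
Proof. intros Bf p v Hv. apply Nat.le_lt_trans with (f p v); [apply dg_le|now apply Bf]. Qed.

Definition Stepok (g : P -> (nat -> nat) -> nat) : Prop := forall p i s v, bounded (m p) v ->
  i < 2 ^ m p -> s < 2 ^ cst (pc p) -> g p (i .: s .: v) < 2 ^ cst (pc p).

Definition big (g : P -> (nat -> nat) -> nat) (p : P) (u : nat -> nat) : nat :=
  if (u 0 <? clim (pc p)) && (u 1 <? 2 ^ cst (pc p))
  then iter (fun i s => g p (i .: s .: etl (etl u))) (u 0 * cN1 (pc p)) (cN1 (pc p)) (u 1) else 0.

Lemma idx_bound c i0 i : i0 < clim c -> i < cN1 c -> i0 * cN1 c + i < 2 ^ cm c.
Proof.
  intros H1 H2. apply small2. pose proof (lim_le c). pose proof (B0_ge c). pose proof (N1_le c).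
  assert (i0 * cN1 c <= cB0 c * cB0 c) by (apply Nat.mul_le_mono; lia). nia.
Qed.

Lemma big_ok g : Stepok g -> Stepok (big g).
Proof.
  intros Hg p i s v Hv Hi Hs. unfold big. cbn [scons].
  destruct (Nat.ltb_spec i (clim (pc p))) as [H1|H1]; simpl; [|apply pow2_pos].
  destruct (Nat.ltb_spec s (2 ^ cst (pc p))) as [H2|H2]; [|apply pow2_pos].
  apply (iter_inv _ _ _ _ (fun s => s < 2 ^ cst (pc p))); [exact H2|].
  intros j t Hj Ht. apply Hg; [exact Hv| |exact Ht].
  assert (j < i * cN1 (pc p) + cN1 (pc p)) by exact Hj.
  pose proof (pow2_pos (3 * cdel (pc p))) as HN. fold (cN1 (pc p)) in HN.
  pose proof (idx_bound (pc p) i (cN1 (pc p) - 1) H1 ltac:(lia)). lia.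
Qed.

(** The whole run is guessed as one word whose digits are the [cN1 + 1] successive states; that each
    digit follows from the preceding one is a bounded universal statement. *)
Lemma gf_big g : GF g -> Stepok g -> GF (big g).
Proof.
  intros Hg Hok. unfold GF.
  assert (Vr := gf_var P pc bs). assert (Vb := bd_var P pc).
  (* environment t = w, z, i0, s, v ... *)
  assert (A1 : Def (fun p t => dg (cst (pc p)) (t 0) 0 = t 3)).
  { apply df_eq; [apply gf_dg; [apply gf_st|apply Vr|apply Vb|apply gf_0]|apply bd_dg, Vb|apply Vr]. }
  assert (A3 : Def (fun p t => t 1 = dg (cst (pc p)) (t 0) (cN1 (pc p)))).
  { apply df_eq; [apply Vr|apply Vb|apply gf_dg; [apply gf_st|apply Vr|apply Vb|apply gf_N1]]. }
  (* The guards keep the index a word for all inputs, as substitution requires; on the relevant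
     range they are true. *)
  set (ix := fun p (u : nat -> nat) => if (u 3 <? clim (pc p)) && (u 0 <? cN1 (pc p))
     then u 3 * cN1 (pc p) + u 0 else 0).
  assert (Gix : GF ix).
  { apply gf_if.
    - apply df_andb; apply df_ltb; auto using gf_lim, gf_N1.
    - apply gf_add; [apply gf_mul; [apply Vr|apply gf_N1]|apply Vr].
    - apply gf_0. }
  assert (Bix : bd ix).
  { intros p u _. unfold ix. destruct (Nat.ltb_spec (u 3) (clim (pc p))); [|apply pow2_pos].
    destruct (Nat.ltb_spec (u 0) (cN1 (pc p))); [|apply pow2_pos]. simpl. now apply idx_bound. }
  assert (A2 : Def (fun p t => forall i, i < cN1 (pc p) ->
     dg (cst (pc p)) (t 0) (i + 1) = g p (ix p (i .: t) .: dg (cst (pc p)) (t 0) i .: (fun k => t (4 + k))))).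
  { apply (Def_all P pc bs (fun p _ => cN1 (pc p))
      (fun p u => dg (cst (pc p)) (u 1) (u 0 + 1) =
         g p (ix p u .: dg (cst (pc p)) (u 1) (u 0) .: (fun k => u (5 + k))))).
    - apply gf_N1.
    - intros p v _. apply small1. pose proof (N1_le (pc p)). lia.
    - apply df_eq.
      + apply gf_dg; [apply gf_st|apply Vr|apply Vb|apply gf_add; [apply Vr|apply gf_1]].
      + apply bd_dg, Vb.
      + apply gf_comp2; auto.
        * apply gf_dg; [apply gf_st|apply Vr|apply Vb|apply Vr].
        * apply bd_dg, Vb. }
  assert (AE := Def_ex P pc bs _ (Def_and P pc bs _ _ A1 (Def_and P pc bs _ _ A2 A3))).
  assert (AC : Def (fun p v => ((v 1 <? clim (pc p)) && (v 2 <? 2 ^ cst (pc p))) = true)).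
  { apply df_andb; apply df_ltb; auto using gf_lim. apply gf_pow, gf_st. }
  assert (AZ : Def (fun p v => v 0 = 0)) by (apply df_eq; [apply Vr|apply Vb|apply gf_0]).
  eapply Def_ext; [|exact (Def_or P pc bs _ _ (Def_and P pc bs _ _ AC AE)
    (Def_and P pc bs _ _ (Def_not P pc bs _ AC) AZ))].
  intros p v Hv. unfold big. cbn [scons etl].
  change (etl v 0) with (v 1). change (etl v 1) with (v 2).
  destruct (Nat.ltb_spec (v 1) (clim (pc p))) as [H1|H1]; cbn [andb].
  2:{ split; [intros [[H _]|[_ H]]; [easy|exact H]|intros H; right; split; [easy|exact H]]. }
  destruct (Nat.ltb_spec (v 2) (2 ^ cst (pc p))) as [H2|H2].
  2:{ split; [intros [[H _]|[_ H]]; [easy|exact H]|intros H; right; split; [easy|exact H]]. }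
  set (V := fun k => v (3 + k)).
  change (etl (etl (etl v))) with V.
  set (st := fun k => iter (fun i s => g p (i .: s .: V)) (v 1 * cN1 (pc p)) k (v 2)).
  assert (Hst : forall k, k <= cN1 (pc p) -> st k < 2 ^ cst (pc p)).
  { intros k Hk. apply (iter_inv _ _ _ _ (fun s => s < 2 ^ cst (pc p))); [exact H2|].
    intros j t Hj Ht. apply Hok; [intros i; apply Hv| |exact Ht].
    pose proof (pow2_pos (3 * cdel (pc p))) as HN. fold (cN1 (pc p)) in HN.
    pose proof (idx_bound (pc p) (v 1) (cN1 (pc p) - 1) H1 ltac:(lia)). lia. }
  assert (Hix : forall i w, i < cN1 (pc p) -> ix p (i .: w .: v) = v 1 * cN1 (pc p) + i).
  { intros i w Hi. unfold ix. cbn [scons].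
    destruct (Nat.ltb_spec (v 1) (clim (pc p))); [|lia].
    destruct (Nat.ltb_spec i (cN1 (pc p))); [|lia]. reflexivity. }
  split.
  - intros [[_ (w & Hw & E1 & E2 & E3)]|[H _]]; [|easy]. rewrite E3.
    assert (Hk : forall k, k <= cN1 (pc p) -> dg (cst (pc p)) w k = st k).
    { induction k as [|k IH]; intros Hk; [exact E1|].
      specialize (E2 k ltac:(lia)). rewrite Hix in E2 by lia. change ((w .: v) 0) with w in E2.
      rewrite (IH ltac:(lia)), Nat.add_1_r in E2. exact E2. }
    apply Hk. reflexivity.
  - intros Hz. left. split; [reflexivity|].
    exists (num (cst (pc p)) (S (cN1 (pc p))) st).
    assert (Hdg : forall k, k <= cN1 (pc p) -> dg (cst (pc p)) (num (cst (pc p)) (S (cN1 (pc p))) st) k = st k).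
    { intros k Hk. apply dg_num; [|lia]. intros i Hi. apply Hst. lia. }
    split; [|split; [|split]].
    + apply Nat.lt_le_trans with (2 ^ (cst (pc p) * S (cN1 (pc p)))).
      * apply num_lt. intros i Hi. apply Hst. lia.
      * apply pow2_le. pose proof (st_bits (pc p)). lia.
    + cbn [scons]. rewrite Hdg by lia. reflexivity.
    + intros i Hi. cbn [scons]. rewrite Hix, !Hdg by lia. rewrite Nat.add_1_r. reflexivity.
    + cbn [scons]. rewrite Hdg by lia. exact Hz.
Qed.

Lemma big_eq g p i s v : Stepok g -> bounded (m p) v -> i < clim (pc p) -> s < 2 ^ cst (pc p) ->
  big g p (i .: s .: v) = iter (fun i s => g p (i .: s .: v)) (i * cN1 (pc p)) (cN1 (pc p)) s.
Proof.
  intros Hok Hv Hi Hs. unfold big. cbn [scons].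
  destruct (Nat.ltb_spec i (clim (pc p))); [|lia]. destruct (Nat.ltb_spec s (2 ^ cst (pc p))); [|lia].
  reflexivity.
Qed.

Lemma big_iter g p i K s v : Stepok g -> bounded (m p) v -> i + K <= clim (pc p) -> s < 2 ^ cst (pc p) ->
  iter (fun i s => big g p (i .: s .: v)) i K s =
  iter (fun i s => g p (i .: s .: v)) (i * cN1 (pc p)) (K * cN1 (pc p)) s.
Proof.
  intros Hok Hv HK Hs. rewrite <- iter_iter.
  apply (iter_ext _ _ _ _ _ (fun s => s < 2 ^ cst (pc p))); [exact Hs| |].
  - intros j t Hj Ht. rewrite <- big_eq by (assumption || lia). apply big_ok; try assumption.
    apply small1. pose proof (lim_le (pc p)). lia.
  - intros j t Hj Ht. apply big_eq; (assumption || lia).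
Qed.

(** Four nested guesses of [cN1] states each give [clim = cN1 ^ 4] steps. *)
Lemma gf_iter g : GF g -> Stepok g ->
  GF (fun p v => iter (fun i s => g p (i .: s .: v)) 0 (clim (pc p)) 0).
Proof.
  intros Hg Hok.
  assert (K1 := big_ok g Hok). assert (G1 := gf_big g Hg Hok).
  assert (K2 := big_ok _ K1). assert (G2 := gf_big _ G1 K1).
  assert (K3 := big_ok _ K2). assert (G3 := gf_big _ G2 K2).
  assert (G4 := gf_big _ G3 K3).
  assert (Z : GF (fun _ _ => 0)) by apply gf_0.
  assert (BZ : bd (fun _ _ => 0)) by (intros p v _; apply pow2_pos).
  eapply gf_ext; [|exact (gf_comp2 _ _ _ 0 G4 Z BZ Z BZ)].
  intros p v Hv. cbv beta. change (fun k => v (0 + k)) with v.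
  pose proof (pow2_pos (3 * cdel (pc p))) as HN. fold (cN1 (pc p)) in HN.
  pose proof (lim_N1 (pc p)) as HL. pose proof (pow2_pos (cst (pc p))) as H0.
  set (N := cN1 (pc p)) in *.
  assert (L0 : 0 < clim (pc p)) by apply pow2_pos.
  assert (B1 : N <= N * N) by nia. assert (B2 : N * N <= N * (N * N)) by nia.
  assert (B3 : N * (N * N) <= N * (N * (N * N))) by nia.
  rewrite big_eq by assumption. fold N. rewrite Nat.mul_0_l.
  rewrite big_iter by (assumption || (fold N; lia)). fold N. rewrite Nat.mul_0_l.
  rewrite big_iter by (assumption || (fold N; lia)). fold N. rewrite Nat.mul_0_l.
  rewrite big_iter by (assumption || (fold N; lia)). fold N. rewrite Nat.mul_0_l.
  f_equal. rewrite HL. ring.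
Qed.
End Iteration.

(** * Definability of long numbers *)

Lemma le_pow2_mul a b x y : x <= 2 ^ a -> y <= 2 ^ b -> x * y <= 2 ^ (a + b).
Proof. intros. rewrite Nat.pow_add_r. now apply Nat.mul_le_mono. Qed.

Lemma num_bound B T f e : 1 <= B -> (forall i, i < T -> f i < 2 ^ e) -> num B T f < 2 ^ (e + B * T).
Proof.
  intros HB Hf. induction T as [|T IH]; [unfold num; simpl; apply pow2_pos|].
  specialize (IH (fun i Hi => Hf i (Nat.lt_lt_succ_r _ _ Hi))). specialize (Hf T (Nat.lt_succ_diag_r T)).
  rewrite num_S. replace (e + B * S T) with (B + (e + B * T)) by lia.
  rewrite (Nat.pow_add_r 2 B), (Nat.pow_add_r 2 e) in *. pose proof (pow2_pos (B * T)).
  assert (2 ^ 1 <= 2 ^ B) by now apply pow2_le. rewrite Nat.pow_1_r in *.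
  assert (f T * 2 ^ (B * T) < 2 ^ e * 2 ^ (B * T)) by now apply Nat.mul_lt_mono_pos_r.
  set (A := 2 ^ e * 2 ^ (B * T)) in *. nia.
Qed.

Lemma num_tail B T T' f : T <= T' -> (forall i, T <= i -> f i = 0) -> num B T' f = num B T f.
Proof.
  intros HT Hf. unfold num. replace T' with (T + (T' - T)) by lia. rewrite sum_split.
  rewrite (sum_0 (T' - T)); [lia|]. intros i _. rewrite Hf by lia. reflexivity.
Qed.

Lemma mul_le_sq b x y : x <= b -> y <= b -> x * y <= 4 * (b * b).
Proof. intros Hx Hy. pose proof (Nat.mul_le_mono _ _ _ _ Hx Hy). lia. Qed.

Section Numbers.
Variables (P : Type) (pc : P -> ctx) (bs : P -> nat).
Notation GF := (GF P pc bs).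
Notation Def := (Def P pc bs).
Notation bd := (bd P pc).
Notation m p := (cm (pc p)).
Notation B p := (cB (pc p)).
Notation Q p := (cQ (pc p)).
Notation a2 p := (2 * ca (pc p)).
Notation lim p := (clim (pc p)).
Notation B0 p := (cB0 (pc p)).

Let Vr := gf_var P pc bs.
Let Vb := bd_var P pc.

Lemma mod_Q_lt p x : x mod Q p < Q p.
Proof. apply Nat.mod_upper_bound. unfold cQ. lia. Qed.

Lemma mod_Q_B0 p x : x mod Q p <= B0 p.
Proof. pose proof (mod_Q_lt p x). pose proof (Q_le (pc p)). lia. Qed.

Lemma gf_modQ f : GF f -> bd f -> GF (fun p v => f p v mod Q p).
Proof. intros Hf Bf. apply gf_mod; [assumption|assumption|apply gf_Q]. Qed.

(** The iteration always has [clim] steps and idles from [N] on; reducing modulo [cQ] keeps the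
    partial sums within a state. *)
Lemma gf_sum f (N : P -> nat) : GF (fun p _ => N p) -> (forall p, N p <= lim p) -> GF f -> bd f ->
  GF (fun p v => sum (N p) (fun i => f p (i .: v)) mod Q p).
Proof.
  intros HN HNl Hf Bf.
  set (g := fun p (u : nat -> nat) => if u 0 <? N p
     then (u 1 mod Q p + f p (u 0 .: (fun k => u (2 + k))) mod Q p) mod Q p else u 1).
  assert (Hfc : GF (fun p u => f p (u 0 .: (fun k => u (2 + k))))) by (apply gf_comp1; auto).
  assert (Bfc : bd (fun p u => f p (u 0 .: (fun k => u (2 + k))))).
  { intros p u Hu. apply Bf. apply bounded_scons; [apply Hu|]. intros i; apply Hu. }
  assert (Hg : GF g).
  { apply gf_if; [apply df_ltb; auto| |auto]. apply gf_modQ.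
    - apply gf_add; apply gf_modQ; auto.
    - intros p u _. apply small1. pose proof (mod_Q_B0 p (u 1)).
      pose proof (mod_Q_B0 p (f p (u 0 .: (fun k => u (2 + k))))). lia. }
  assert (Hok : Stepok P pc g).
  { intros p i s v _ _ Hs. unfold g. cbn [scons]. destruct (i <? N p); [|exact Hs].
    apply Nat.lt_le_trans with (B0 p); [|apply B0_st].
    apply Nat.lt_trans with (Q p); [apply mod_Q_lt|apply Q_le]. }
  eapply gf_ext; [|exact (gf_iter P pc bs g Hg Hok)].
  intros p v _. cbv beta.
  assert (H : forall K, iter (fun i s => g p (i .: s .: v)) 0 K 0 = sum (Nat.min K (N p)) (fun i => f p (i .: v)) mod Q p).
  { induction K as [|K IH]; [symmetry; apply Nat.Div0.mod_0_l|].
    cbn [iter]. rewrite IH. unfold g at 1. cbn [scons]. rewrite Nat.add_0_l.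
    change (fun k => (K .: sum (Nat.min K (N p)) (fun i => f p (i .: v)) mod Q p .: v) (2 + k)) with v.
    destruct (Nat.ltb_spec K (N p)) as [HK|HK].
    - rewrite (Nat.min_l K), (Nat.min_l (S K)) by lia. cbn [sum].
      rewrite Nat.Div0.mod_mod, <- Nat.Div0.add_mod. reflexivity.
    - rewrite !Nat.min_r by lia. reflexivity. }
  rewrite H, Nat.min_r by apply HNl. reflexivity.
Qed.

Lemma gf_B0 : GF (fun p _ => B0 p).
Proof. apply gf_pow, gf_2a. Qed.

Lemma gf_2B : GF (fun p _ => 2 ^ B p).
Proof. apply gf_pow, gf_B. Qed.

Lemma B_ge p : 1 <= B p.
Proof. apply pow2_pos. Qed.

Lemma two_B p : 2 <= 2 ^ B p.
Proof. apply (pow2_le 1). apply B_ge. Qed.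

Definition smallf (f : P -> (nat -> nat) -> nat) : Prop := forall p v, bounded (m p) v -> f p v < B0 p.

Lemma bd_smallf f : smallf f -> bd f.
Proof. intros H p v Hv. apply small1. specialize (H p v Hv). lia. Qed.

Lemma gf_carry f : GF f -> smallf f ->
  GF (fun p u => carry (B p) (fun i => f p (i .: etl u)) (Nat.min (lim p) (u 0))).
Proof.
  intros Hf Sf. assert (Bf := bd_smallf f Sf).
  (* True carries are below [cB0]; the reduction serves arbitrary states, for which the step must
     also be bounded. *)
  set (g := fun p (u : nat -> nat) => if u 0 <? u 2
     then (u 1 mod B0 p + f p (u 0 .: (fun k => u (3 + k)))) / 2 ^ B p else u 1).
  assert (Hfc : GF (fun p u => f p (u 0 .: (fun k => u (3 + k))))) by (apply gf_comp1; auto).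
  assert (Sfc : smallf (fun p u => f p (u 0 .: (fun k => u (3 + k))))).
  { intros p u Hu. apply Sf. apply bounded_scons; [apply Hu|]. intros i; apply Hu. }
  assert (Hmod : forall p x, x mod B0 p < B0 p) by (intros; apply Nat.mod_upper_bound, pow2_ne).
  assert (Hg : GF g).
  { apply gf_if; [apply df_ltb; auto| |auto]. apply gf_div.
    - apply gf_add; [|assumption]. apply gf_mod; auto using gf_B0.
    - intros p u Hu. apply small1. specialize (Sfc p u Hu). specialize (Hmod p (u 1)). cbv beta in *. lia.
    - apply gf_2B. }
  assert (Hok : Stepok P pc g).
  { intros p i s v Hv Hi Hs. unfold g. cbn [scons]. destruct (i <? v 0); [|exact Hs].
    apply Nat.lt_le_trans with (B0 p); [|apply B0_st].
    apply Nat.Div0.div_lt_upper_bound. pose proof (two_B p). specialize (Hmod p s).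
    assert (Hfv : f p (i .: (fun k => (i .: s .: v) (3 + k))) < B0 p).
    { apply Sf. apply bounded_scons; [exact Hi|]. intros j; apply Hv. }
    nia. }
  eapply gf_ext; [|exact (gf_iter P pc bs g Hg Hok)].
  intros p v Hv. cbv beta.
  assert (Hc : forall K, K <= 2 ^ m p -> carry (B p) (fun i => f p (i .: etl v)) K < B0 p).
  { intros K HK. apply carry_lt; [apply B_ge|]. intros i Hi. apply Sf.
    apply bounded_scons; [lia|]. intros j; apply Hv. }
  assert (Hl : lim p <= 2 ^ m p) by (apply Nat.lt_le_incl, small1; pose proof (lim_le (pc p)); lia).
  assert (H : forall K, K <= lim p -> iter (fun i s => g p (i .: s .: v)) 0 K 0 =
    carry (B p) (fun i => f p (i .: etl v)) (Nat.min K (v 0))).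
  { induction K as [|K IH]; intros HK; [reflexivity|].
    cbn [iter]. rewrite IH by lia. unfold g at 1. cbn [scons]. rewrite Nat.add_0_l.
    match goal with |- context [fun k => (_ .: _ .: v) (3 + k)] =>
      change (fun k => (K .: carry (B p) (fun i => f p (i .: etl v)) (Nat.min K (v 0)) .: v) (3 + k)) with (etl v) end.
    destruct (Nat.ltb_spec K (v 0)) as [Hb|Hb].
    - rewrite (Nat.min_l K), (Nat.min_l (S K)) by lia. cbn [carry].
      rewrite (Nat.mod_small _ (B0 p)) by (apply Hc; lia). reflexivity.
    - rewrite !Nat.min_r by lia. reflexivity. }
  apply H. reflexivity.
Qed.

Definition DefN (X : P -> (nat -> nat) -> nat) : Prop :=
  GF (fun p u => dg (B p) (X p (etl u)) (u 0)).

Lemma DefN_ext X Y : (forall p v, bounded (m p) v -> X p v = Y p v) -> DefN X -> DefN Y.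
Proof.
  intros H. apply gf_ext. intros p v Hv. cbv beta. rewrite H; [reflexivity|]. intros i; apply Hv.
Qed.

(** Overlapping entries are resolved by carries. The number is below [2 ^ (cB * clim)], so blocks
    from [clim] on are 0 and carries are needed only on the range of one iteration. *)
Lemma defn_num f (T : P -> nat) : GF f -> smallf f -> (forall p, T p <= a2 p) ->
  (forall p i v, bounded (m p) v -> T p <= i -> f p (i .: v) = 0) ->
  DefN (fun p v => num (B p) (T p) (fun i => f p (i .: v))).
Proof.
  intros Hf Sf HT H0. unfold DefN.
  assert (Hl : forall p, a2 p <= lim p).
  { intros p. unfold ca, clim. rewrite <- Nat.pow_succ_r'. apply pow2_le. pose proof (c_del (pc p)). lia. }
  assert (G : GF (fun p u => if u 0 <? lim p then
     (carry (B p) (fun i => f p (i .: etl u)) (Nat.min (lim p) (u 0)) + f p u) mod 2 ^ B p else 0)).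
  { apply gf_if; [apply df_ltb; auto using gf_lim| |apply gf_0]. apply gf_mod.
    - apply gf_add; [now apply gf_carry|assumption].
    - intros p u Hu. apply small1. pose proof (Sf p u Hu).
      assert (carry (B p) (fun i => f p (i .: etl u)) (Nat.min (lim p) (u 0)) < B0 p); [|lia].
      apply carry_lt; [apply B_ge|]. intros i Hi. apply Sf. apply bounded_scons; [|intros j; apply Hu].
      apply Nat.lt_trans with (u 0); [lia|apply Hu].
    - apply gf_2B. }
  eapply gf_ext; [|exact G]. intros p u Hu. cbv beta.
  assert (Hu' : bounded (m p) (etl u)) by (intros i; apply Hu).
  destruct (Nat.ltb_spec (u 0) (lim p)) as [Hb|Hb].
  - rewrite Nat.min_r by lia.
    rewrite <- (num_tail _ (T p) (lim p)); [|etransitivity; [apply HT|apply Hl]|].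
    2:{ intros i Hi. now apply H0. }
    rewrite dg_carry by assumption. do 2 f_equal.
    f_equal. apply functional_extensionality. now intros [|i].
  - symmetry. apply dg_ge with (lim p); [|assumption].
    apply Nat.lt_le_trans with (2 ^ (a2 p + B p * T p)).
    + apply num_bound; [apply B_ge|]. intros i Hi. apply Sf. apply bounded_scons; [|assumption].
      apply small1. specialize (HT p). pose proof (a_le (pc p)). lia.
    + apply pow2_le. specialize (HT p). pose proof (B_ge p).
      apply Nat.le_trans with (2 * (B p * a2 p)); [nia|].
      unfold cB, ca, clim. replace (2 * (2 ^ (8 * cdel (pc p)) * (2 * 2 ^ (10 * cdel (pc p)))))
        with (2 ^ 2 * (2 ^ (8 * cdel (pc p)) * 2 ^ (10 * cdel (pc p)))) by (simpl (2 ^ 2); ring).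
      rewrite <- !Nat.pow_add_r. apply pow2_le. pose proof (c_del (pc p)). lia.
Qed.

Definition ev1 (f : P -> (nat -> nat) -> nat -> nat) (p : P) (u : nat -> nat) : nat :=
  if u 0 <? a2 p then f p (etl u) (2 ^ u 0) mod Q p else 0.

(** [f] is a polynomial whose values modulo [cQ] at the powers of two are definable. *)
Definition PEv (f : P -> (nat -> nat) -> nat -> nat) : Prop := GF (ev1 f).

Lemma ev1_lt f p u : ev1 f p u < B0 p.
Proof.
  unfold ev1. destruct (u 0 <? a2 p); [|apply pow2_pos].
  apply Nat.lt_trans with (Q p); [apply mod_Q_lt|apply Q_le].
Qed.

Lemma a2_pos p : 0 < a2 p.
Proof. pose proof (pow2_pos (10 * cdel (pc p))). unfold ca. lia. Qed.

Lemma pow_a2_lt p x : 2 ^ (x mod a2 p) < B0 p.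
Proof. apply pow2_lt, Nat.mod_upper_bound. pose proof (a2_pos p). lia. Qed.

Lemma mod_a2_lt p x : x mod a2 p < B0 p.
Proof. apply Nat.lt_trans with (2 := pow_a2_lt p x), pow2_gt. Qed.

Lemma gf_mod_a2 f : GF f -> bd f -> GF (fun p v => f p v mod a2 p).
Proof. intros Hf Bf. apply gf_mod; auto using gf_2a. Qed.

(** The Fourier transform recovers the coefficients from the values at powers of two, exactly
    because they are below [cQ] by the bound on the value at 1; carries then assemble the value at
    [2 ^ cB]. Thus sums and products of long numbers need only be computed on residues. *)
Lemma defn_poly f : (forall p v, bounded (m p) v -> Pol (a2 p) (f p v)) ->
  (forall p v, bounded (m p) v -> f p v 1 < 2 ^ ca (pc p)) -> PEv f ->
  DefN (fun p v => f p v (2 ^ B p)).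
Proof.
  intros HP H1 Hf.
  set (h := fun p (u : nat -> nat) => ev1 f p (u 0 .: (fun k => u (2 + k))) *
     2 ^ (((u 0 mod a2 p) * (a2 p - u 1)) mod a2 p)).
  assert (Hexp : bd (fun p u => (u 0 mod a2 p) * (a2 p - u 1))).
  { intros p u _. apply small2. pose proof (mod_a2_lt p (u 0)). pose proof (a_le (pc p)).
    assert ((u 0 mod a2 p) * (a2 p - u 1) <= B0 p * B0 p) by (apply Nat.mul_le_mono; lia). lia. }
  assert (B2a : bd (fun p _ => a2 p)) by (intros p v _; apply small1; pose proof (a_le (pc p)); lia).
  assert (Gh : GF h).
  { apply gf_mul; [apply gf_comp1; auto|]. apply gf_pow, gf_mod_a2; [|exact Hexp].
    apply gf_mul; [now apply gf_mod_a2|]. apply gf_minus; auto using gf_2a. }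
  assert (Bh : bd h).
  { intros p u _. apply small2. unfold h. pose proof (ev1_lt f p (u 0 .: (fun k => u (2 + k)))).
    pose proof (pow_a2_lt p ((u 0 mod a2 p) * (a2 p - u 1))).
    etransitivity; [apply Nat.mul_le_mono; apply Nat.lt_le_incl; eassumption|lia]. }
  assert (Hl : forall p, a2 p <= lim p).
  { intros p. unfold ca, clim. rewrite <- Nat.pow_succ_r'. apply pow2_le. pose proof (c_del (pc p)). lia. }
  assert (Gs := gf_sum h (fun p => a2 p) (gf_2a P pc bs) Hl Gh Bh).
  set (cf := fun p (u : nat -> nat) => if u 0 <? a2 p then
     ((sum (a2 p) (fun i => h p (i .: u)) mod Q p) * (B0 p / a2 p)) mod Q p else 0).
  assert (Gc : GF cf).
  { apply gf_if; [apply df_ltb; auto using gf_2a| |apply gf_0]. apply gf_modQ.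
    - apply gf_mul; [exact Gs|]. apply gf_div; [apply gf_B0| |apply gf_2a].
      intros p v _. apply small1. lia.
    - intros p u _. apply small2.
      pose proof (mod_Q_B0 p (sum (a2 p) (fun i => h p (i .: u)))). pose proof (div_le (B0 p) (a2 p)).
      etransitivity; [apply Nat.mul_le_mono; eassumption|lia]. }
  assert (Sc : smallf cf).
  { intros p u _. unfold cf. destruct (u 0 <? a2 p); [|apply pow2_pos].
    apply Nat.lt_trans with (Q p); [apply mod_Q_lt|apply Q_le]. }
  eapply DefN_ext; [|apply (defn_num cf (fun p => a2 p) Gc Sc)].
  - intros p v Hv. destruct (HP p v Hv) as [c Hc].
    assert (Hcl : forall i, i < a2 p -> c i < Q p).
    { intros i Hi. apply Nat.lt_trans with (2 ^ ca (pc p)); [|unfold cQ; lia].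
      apply Nat.le_lt_trans with (2 := H1 p v Hv). rewrite Hc.
      pose proof (sum_term_le (a2 p) (fun i => c i * 1 ^ i) i Hi) as Hle. cbv beta in Hle.
      rewrite Nat.pow_1_l, Nat.mul_1_r in Hle. exact Hle. }
    rewrite Hc. unfold num. apply sum_ext. intros t Ht. rewrite <- Nat.pow_mul_r. f_equal.
    unfold cf. cbn [scons]. destruct (Nat.ltb_spec t (a2 p)); [|lia].
    rewrite <- (dft_coef (10 * cdel (pc p)) c (f p v) t Ht Hcl Hc).
    fold (ca (pc p)). fold (Q p).
    (* [cB0] is [2 ^ (2 * ca)], which is 1 modulo [cQ], so this quotient is the inverse of
       [2 * ca]. *)
    assert (E2 : B0 p / a2 p = 2 ^ (a2 p - S (10 * cdel (pc p)))).
    { assert (Ea : 2 ^ S (10 * cdel (pc p)) = a2 p) by apply Nat.pow_succ_r'.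
      assert (S (10 * cdel (pc p)) <= a2 p).
      { pose proof (pow2_gt (10 * cdel (pc p))). unfold ca. lia. }
      unfold cB0. rewrite <- Ea at 2.
      replace (2 ^ (a2 p)) with (2 ^ (a2 p - S (10 * cdel (pc p))) * 2 ^ S (10 * cdel (pc p))).
      - apply Nat.div_mul, pow2_ne.
      - rewrite <- Nat.pow_add_r. f_equal. lia. }
    rewrite E2. apply mul_mod_eq; [|reflexivity]. rewrite Nat.Div0.mod_mod. f_equal.
    apply sum_ext. intros j Hj. unfold h. cbn [scons].
    change (fun k => (j .: t .: v) (2 + k)) with v.
    unfold ev1. cbn [scons]. change (etl (j .: v)) with v.
    destruct (Nat.ltb_spec j (a2 p)); [|lia]. rewrite (Nat.mod_small j) by assumption. reflexivity.
  - reflexivity.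
  - intros p i v Hv Hi. unfold cf. cbn [scons]. destruct (Nat.ltb_spec i (a2 p)); [lia|reflexivity].
Qed.

Lemma PEv_add f g : PEv f -> PEv g -> PEv (fun p v x => f p v x + g p v x).
Proof.
  intros Hf Hg. eapply gf_ext; [|apply gf_modQ; [exact (gf_add _ _ _ _ _ Hf Hg)|]].
  - intros p u _. unfold ev1. destruct (u 0 <? a2 p); [|apply Nat.Div0.mod_0_l].
    now rewrite <- Nat.Div0.add_mod.
  - intros p u _. apply small1. pose proof (ev1_lt f p u). pose proof (ev1_lt g p u). lia.
Qed.

Lemma PEv_mul f g : PEv f -> PEv g -> PEv (fun p v x => f p v x * g p v x).
Proof.
  intros Hf Hg. eapply gf_ext; [|apply gf_modQ; [exact (gf_mul _ _ _ _ _ Hf Hg)|]].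
  - intros p u _. unfold ev1. destruct (u 0 <? a2 p); [|apply Nat.Div0.mod_0_l].
    now rewrite <- Nat.Div0.mul_mod.
  - intros p u _. apply small2. pose proof (ev1_lt f p u). pose proof (ev1_lt g p u).
    etransitivity; [apply Nat.mul_le_mono; apply Nat.lt_le_incl; eassumption|lia].
Qed.

Lemma PEv_const f : GF f -> bd f -> PEv (fun p v _ => f p v).
Proof.
  intros Hf Bf. unfold PEv, ev1. apply gf_if; [apply df_ltb; auto using gf_2a| |apply gf_0].
  apply gf_modQ; [exact (gf_ren P pc bs f S Hf)|]. intros p u Hu. apply Bf. intros i; apply Hu.
Qed.

(** At [x = 2 ^ j] the value is [2 ^ (j * k)], whose exponent matters only modulo [2 * ca]; reducing
    both factors keeps the product within a word. *)
Lemma PEv_mono k : GF k -> bd k -> PEv (fun p v x => x ^ k p v).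
Proof.
  intros Hk Bk. unfold PEv.
  assert (Hk' : GF (fun p u => k p (etl u))) by exact (gf_ren P pc bs k S Hk).
  assert (Bk' : bd (fun p u => k p (etl u))) by (intros p u Hu; apply Bk; intros i; apply Hu).
  eapply gf_ext; [|apply (gf_if P pc bs (fun p u => u 0 <? a2 p)
    (fun p u => 2 ^ (((u 0 mod a2 p) * (k p (etl u) mod a2 p)) mod a2 p) mod Q p) (fun _ _ => 0))].
  - intros p u _. unfold ev1. destruct (u 0 <? a2 p); [|reflexivity].
    rewrite <- Nat.Div0.mul_mod, <- Nat.pow_mul_r. symmetry. exact (pow_mod_2a (10 * cdel (pc p)) _).
  - apply df_ltb; auto using gf_2a.
  - apply gf_modQ.
    + apply gf_pow, gf_mod_a2; [apply gf_mul; now apply gf_mod_a2|].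
      intros p u _. apply small2. pose proof (mod_a2_lt p (u 0)). pose proof (mod_a2_lt p (k p (etl u))).
      etransitivity; [apply Nat.mul_le_mono; apply Nat.lt_le_incl; eassumption|lia].
    + intros p u _. apply small1.
      pose proof (pow_a2_lt p ((u 0 mod a2 p) * (k p (etl u) mod a2 p))). lia.
  - apply gf_0.
Qed.

Lemma PEv_num X (N : P -> nat) : DefN X -> GF (fun p _ => N p) -> (forall p, N p <= lim p) ->
  PEv (fun p v x => numpoly (B p) (N p) (X p v) x).
Proof.
  intros HX HN HNl. unfold PEv.
  set (g := fun p (u : nat -> nat) => dg (B p) (X p (fun k => u (2 + k))) (u 0) *
     2 ^ (((u 1 mod a2 p) * (u 0 mod lim p)) mod a2 p)).
  assert (Hml : forall p x, x mod lim p < lim p) by (intros; apply Nat.mod_upper_bound, pow2_ne).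
  assert (GX : GF (fun p u => dg (B p) (X p (fun k => u (2 + k))) (u 0))).
  { exact (gf_comp1 P pc bs _ (fun p u => u 0) 2 HX (Vr 0) (Vb 0)). }
  assert (Gg : GF g).
  { apply gf_mul; [exact GX|]. apply gf_pow, gf_mod_a2.
    - apply gf_mul; [now apply gf_mod_a2|]. apply gf_mod; auto using gf_lim.
    - intros p u _. apply small2. pose proof (mod_a2_lt p (u 1)). pose proof (Hml p (u 0)).
      pose proof (lim_le (pc p)). apply mul_le_sq; lia. }
  assert (Bg : bd g).
  { intros p u _. apply small2. unfold g. pose proof (dg_lt (B p) (X p (fun k => u (2 + k))) (u 0)).
    pose proof (B_le (pc p)). pose proof (pow_a2_lt p ((u 1 mod a2 p) * (u 0 mod lim p))).
    apply mul_le_sq; lia. }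
  assert (Gs := gf_sum g N HN HNl Gg Bg).
  eapply gf_ext; [|eapply (gf_if P pc bs (fun p u => u 0 <? a2 p) _ (fun _ _ => 0)); [|exact Gs|apply gf_0]].
  - intros p u _. unfold ev1. destruct (Nat.ltb_spec (u 0) (a2 p)) as [Hj|Hj]; [|reflexivity].
    unfold numpoly. apply sum_mod. intros b Hb. unfold g. cbn [scons].
    change (fun k => (b .: u) (2 + k)) with (etl u).
    apply mul_mod_eq; [reflexivity|]. rewrite (Nat.mod_small (u 0)) by assumption.
    rewrite (Nat.mod_small b) by (specialize (HNl p); lia).
    rewrite <- Nat.pow_mul_r. symmetry. exact (pow_mod_2a (10 * cdel (pc p)) _).
  - apply df_ltb; auto using gf_2a.
Qed.

(** Here the series length [s] is unbounded, so the recursion of [horner] is itself iterated on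
    residues. *)
Lemma PEv_horner X (k s : P -> nat) : PEv X -> GF (fun p _ => k p) -> GF (fun p _ => s p) ->
  (forall p, k p <= B0 p) -> (forall p, s p <= lim p) ->
  PEv (fun p v x => horner (X p v x) (x ^ k p) (s p)).
Proof.
  intros HX Hk Hs Bk Bs. unfold PEv.
  set (ex := fun p (u : nat -> nat) => (u 2 mod a2 p) * k p * (u 0 mod lim p)).
  set (g := fun p (u : nat -> nat) => if u 0 <? s p then
     ((u 1 mod Q p) * ev1 X p (u 2 .: (fun j => u (3 + j))) + 2 ^ (ex p u mod a2 p)) mod Q p else u 1).
  assert (Hml : forall p x, x mod lim p < lim p) by (intros; apply Nat.mod_upper_bound, pow2_ne).
  assert (Bex : bd ex).
  { intros p u _. apply small_lt_m. unfold ex. pose proof (mod_a2_lt p (u 2)). pose proof (Hml p (u 0)).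
    pose proof (lim_le (pc p)). specialize (Bk p).
    apply Nat.le_trans with (B0 p * B0 p * B0 p).
    - apply Nat.mul_le_mono; [apply Nat.mul_le_mono|]; lia.
    - rewrite <- (Nat.mul_1_r (B0 p * B0 p * B0 p)) at 1. apply Nat.mul_le_mono_l. apply pow2_pos. }
  assert (Gex : GF ex).
  { apply gf_mul; [apply gf_mul; [now apply gf_mod_a2|exact Hk]|]. apply gf_mod; auto using gf_lim. }
  assert (Gg : GF g).
  { apply gf_if; [apply df_ltb; auto| |auto]. apply gf_modQ.
    - apply gf_add; [apply gf_mul; [now apply gf_modQ|apply gf_comp1; auto]|].
      now apply gf_pow, gf_mod_a2.
    - intros p u _. apply small2. pose proof (mod_Q_B0 p (u 1)).
      pose proof (ev1_lt X p (u 2 .: (fun j => u (3 + j)))). pose proof (pow_a2_lt p (ex p u)).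
      assert ((u 1 mod Q p) * ev1 X p (u 2 .: (fun j => u (3 + j))) <= B0 p * B0 p) by (apply Nat.mul_le_mono; lia).
      pose proof (B0_ge (pc p)). nia. }
  assert (Hok : Stepok P pc g).
  { intros p i t v _ _ Ht. unfold g. cbn [scons]. destruct (i <? s p); [|exact Ht].
    apply Nat.lt_le_trans with (B0 p); [|apply B0_st].
    apply Nat.lt_trans with (Q p); [apply mod_Q_lt|apply Q_le]. }
  eapply gf_ext; [|eapply (gf_if P pc bs (fun p u => u 0 <? a2 p) _ (fun _ _ => 0));
    [|exact (gf_iter P pc bs g Gg Hok)|apply gf_0]].
  - intros p u _. unfold ev1 at 1. destruct (Nat.ltb_spec (u 0) (a2 p)) as [Hj|Hj]; [|reflexivity].
    set (xx := X p (etl u) (2 ^ u 0)).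
    assert (H : forall K, K <= lim p -> iter (fun i t => g p (i .: t .: u)) 0 K 0 =
      horner xx ((2 ^ u 0) ^ k p) (Nat.min K (s p)) mod Q p).
    { induction K as [|K IH]; intros HK; [symmetry; apply Nat.Div0.mod_0_l|].
      cbn [iter]. rewrite IH by lia. unfold g at 1. cbn [scons]. rewrite Nat.add_0_l.
      destruct (Nat.ltb_spec K (s p)) as [HKs|HKs].
      - rewrite (Nat.min_l K), (Nat.min_l (S K)) by lia. cbn [horner].
        apply add_mod_eq.
        + rewrite Nat.Div0.mod_mod. apply mul_mod_eq; [apply Nat.Div0.mod_mod|].
          unfold ev1. cbn [scons].
          match goal with |- context [etl (_ .: ?w)] => change w with (etl u) end.
          change (etl (u 0 .: etl u)) with (etl u).
          destruct (Nat.ltb_spec (u 0) (a2 p)); [|lia]. apply Nat.Div0.mod_mod.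
        + unfold ex. cbn [scons]. rewrite (Nat.mod_small (u 0)), (Nat.mod_small K (lim p)) by lia.
          rewrite <- !Nat.pow_mul_r, Nat.mul_assoc. symmetry. exact (pow_mod_2a (10 * cdel (pc p)) _).
      - rewrite !Nat.min_r by lia. reflexivity. }
    rewrite H, Nat.min_r by (apply Bs || reflexivity). reflexivity.
  - apply df_ltb; auto using gf_2a.
Qed.
End Numbers.

(** * Operations on long numbers *)

(** Numbers at most [2 ^ (B * N)] below a power of the base are those whose digits from [N] up to
    the top are all maximal; such closeness can be tested block by block. *)
Lemma top_digits B N hb l Y : 1 <= B -> N + hb <= l -> Y < 2 ^ (B * l) ->
  ((forall b, b < l -> b < N \/ dg B Y b = if b <? N + hb then 2 ^ B - 1 else 0) <->
   (2 ^ (B * (N + hb)) <= Y + 2 ^ (B * N) /\ Y < 2 ^ (B * (N + hb)))).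
Proof.
  intros HB Hl HY. set (Z := Y / 2 ^ (B * N)).
  assert (HZl : Z < 2 ^ (B * (l - N))).
  { apply Nat.Div0.div_lt_upper_bound. rewrite <- Nat.pow_add_r.
    replace (B * N + B * (l - N)) with (B * l) by nia. exact HY. }
  assert (HZ : Z = 2 ^ (B * hb) - 1 <-> (2 ^ (B * (N + hb)) <= Y + 2 ^ (B * N) /\ Y < 2 ^ (B * (N + hb)))).
  { pose proof (Nat.div_mod Y (2 ^ (B * N)) (pow2_ne _)) as Hd. fold Z in Hd.
    pose proof (Nat.mod_upper_bound Y (2 ^ (B * N)) (pow2_ne _)) as Hr.
    rewrite Nat.mul_add_distr_l, Nat.pow_add_r. pose proof (pow2_pos (B * hb)) as Hh.
    set (A := 2 ^ (B * N)) in *. set (H := 2 ^ (B * hb)) in *. set (r := Y mod A) in *. split.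
    - intros E. assert (A * Z = A * H - A) by (rewrite E; nia). nia.
    - intros [H1 H2].
      assert (A * Z < A * H) by lia. assert (A * H < A * (Z + 2)) by nia.
      assert (0 < A) by apply pow2_pos.
      apply Nat.mul_lt_mono_pos_l in H0, H3; try assumption. lia. }
  rewrite <- HZ. split.
  - intros H. apply (dg_ext B (l - N)); [exact HZl| |].
    + assert (2 ^ (B * hb) <= 2 ^ (B * (l - N))) by (apply pow2_le; nia). pose proof (pow2_pos (B * hb)). lia.
    + intros k Hk. rewrite dg_ones. unfold Z. rewrite dg_shift.
      destruct (H (N + k) ltac:(lia)) as [Hc|Hc]; [lia|]. rewrite Hc.
      destruct (Nat.ltb_spec k hb), (Nat.ltb_spec (N + k) (N + hb)); try lia; reflexivity.
  - intros E b Hb. destruct (Nat.lt_ge_cases b N) as [Hn|Hn]; [now left|right].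
    replace b with (N + (b - N)) at 1 by lia. rewrite <- dg_shift. fold Z. rewrite E, dg_ones.
    destruct (Nat.ltb_spec (b - N) hb), (Nat.ltb_spec b (N + hb)); try lia; reflexivity.
Qed.

(** The length of the division series. The guessed reciprocal is precise to [cB * chb] bits, short
    enough for a word; [chb * cs = 2 * cB] makes [cs] terms precise to [2 * n] bits. *)
Definition cs (c : ctx) : nat := 2 ^ cdel c.
Definition chb (c : ctx) : nat := 2 * 2 ^ (7 * cdel c).
Definition cMb (c : ctx) : nat := cB c + chb c.

Section Numeric2.
Variable c : ctx.

Lemma Bs_a : 16 * (cB c * cs c) <= ca c.
Proof.
  unfold cB, cs, ca. pose proof (c_del c).
  apply Nat.le_trans with (2 ^ 4 * (2 ^ (8 * cdel c) * 2 ^ cdel c)); [simpl (2 ^ 4); lia|].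
  rewrite <- !Nat.pow_add_r. apply pow2_le. lia.
Qed.

Lemma s_ge : 256 <= cs c.
Proof. apply (pow2_le 8). apply c_del. Qed.

Lemma B_ge_del : 8 * cdel c < cB c.
Proof. apply pow2_gt. Qed.

Lemma hb_s : chb c * cs c = 2 * cB c.
Proof.
  unfold chb, cs, cB. rewrite <- Nat.mul_assoc, <- Nat.pow_add_r. do 2 f_equal. lia.
Qed.

Lemma hb_B : chb c <= cB c.
Proof. pose proof hb_s. pose proof s_ge. nia. Qed.

Lemma Mb_le : cMb c <= 2 * cB c.
Proof. unfold cMb. pose proof hb_B. lia. Qed.

Lemma B_pos : 1 <= cB c.
Proof. apply pow2_pos. Qed.

Lemma lim_B : 4 * cB c <= clim c.
Proof.
  unfold cB, clim. pose proof (c_del c). apply Nat.le_trans with (2 ^ 2 * 2 ^ (8 * cdel c)); [simpl (2 ^ 2); lia|].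
  rewrite <- Nat.pow_add_r. apply pow2_le. lia.
Qed.

Lemma n_eq : cB c * cB c = 2 ^ (16 * cdel c).
Proof. unfold cB. rewrite <- Nat.pow_add_r. f_equal. lia. Qed.

Lemma m_le_n : cm c <= cB c * cB c.
Proof. rewrite n_eq. unfold cm. apply pow2_le. pose proof (c_del c). lia. Qed.

Lemma h_le_m : cB c * chb c + 2 <= cm c.
Proof.
  unfold cB, chb, cm. pose proof (c_del c).
  replace (2 ^ (8 * cdel c) * (2 * 2 ^ (7 * cdel c))) with (2 ^ (15 * cdel c + 1)).
  - replace (15 * cdel c + 3) with (15 * cdel c + 1 + 2) by lia.
    rewrite (Nat.pow_add_r 2 (15 * cdel c + 1) 2). simpl (2 ^ 2).
    assert (2 ^ 1 <= 2 ^ (15 * cdel c + 1)) by (apply pow2_le; lia). simpl (2 ^ 1) in *. lia.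
  - replace (15 * cdel c + 1) with (8 * cdel c + (1 + 7 * cdel c)) by lia.
    rewrite !Nat.pow_add_r. simpl (2 ^ 1). ring.
Qed.

Lemma numpoly_1_le N X : N <= 2 * cB c -> numpoly (cB c) N X 1 <= 2 ^ (2 * cB c + 1).
Proof.
  intros HN. etransitivity; [apply numpoly_1|].
  replace (2 * cB c + 1) with (1 + cB c + cB c) by lia. rewrite (Nat.pow_add_r 2 (1 + cB c)).
  apply Nat.mul_le_mono_r. rewrite Nat.pow_add_r. pose proof (pow2_gt (cB c)). simpl (2 ^ 1). lia.
Qed.

Lemma n_small : cB c * cB c <= cB0 c * cB0 c.
Proof. apply Nat.mul_le_mono; apply cB_le. Qed.
End Numeric2.

Section Ops.
Variables (P : Type) (pc : P -> ctx) (bs : P -> nat).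
Notation GF := (GF P pc bs).
Notation Def := (Def P pc bs).
Notation bd := (bd P pc).
Notation DefN := (DefN P pc bs).
Notation PEv := (PEv P pc bs).
Notation m p := (cm (pc p)).
Notation B p := (cB (pc p)).
Notation a2 p := (2 * ca (pc p)).
Notation lim p := (clim (pc p)).
Notation B0 p := (cB0 (pc p)).
Notation nn p := (cB (pc p) * cB (pc p)).

Let Vr := gf_var P pc bs.
Let Vb := bd_var P pc.

Definition ltn (X : P -> (nat -> nat) -> nat) : Prop := forall p v, bounded (m p) v -> X p v < 2 ^ nn p.

Lemma etl_bounded p v : bounded (m p) v -> bounded (m p) (etl v).
Proof. intros H i; apply H. Qed.

Lemma bd_dgN (X : P -> (nat -> nat) -> nat) : bd (fun p u => dg (B p) (X p (etl u)) (u 0)).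
Proof.
  intros p u _. apply small1. pose proof (dg_lt (B p) (X p (etl u)) (u 0)). pose proof (B_le (pc p)). lia.
Qed.

Lemma DefN_ren X (r : nat -> nat) : DefN X -> DefN (fun p v => X p (fun i => v (r i))).
Proof.
  intros H. exact (gf_ren P pc bs _ (fun i => match i with 0 => 0 | S j => S (r j) end) H).
Qed.

Lemma defn_word f : GF f -> bd f -> DefN f.
Proof.
  intros Hf Bf. apply gf_dg; [apply gf_B|exact (gf_ren P pc bs f S Hf)| |apply Vr].
  intros p u Hu. apply Bf, etl_bounded, Hu.
Qed.

Lemma defn_if (b : P -> (nat -> nat) -> bool) X Y : Def (fun p v => b p v = true) -> DefN X -> DefN Y ->
  DefN (fun p v => if b p v then X p v else Y p v).
Proof.
  intros Hb HX HY. eapply gf_ext; [|exact (gf_if P pc bs (fun p u => b p (etl u)) _ _ (Def_ren P pc bs _ S Hb) HX HY)].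
  intros p u _. cbv beta. now destruct (b p (etl u)).
Qed.

Lemma gf_ones : GF (fun p _ => 2 ^ B p - 1).
Proof.
  apply gf_minus; [apply gf_2B| |apply gf_1]. intros p v _. apply small1. pose proof (B_le (pc p)). lia.
Qed.

Lemma defn_trunc X : DefN X -> DefN (fun p v => X p v mod 2 ^ nn p).
Proof.
  intros HX. eapply gf_ext; [|eapply (gf_if P pc bs (fun p u => u 0 <? B p) _ (fun _ _ => 0));
    [|exact HX|apply gf_0]].
  - intros p u _. cbv beta. now rewrite dg_mod.
  - apply df_ltb; auto using gf_B.
Qed.

Lemma defn_compl X : DefN X -> ltn X -> DefN (fun p v => 2 ^ nn p - 1 - X p v).
Proof.
  intros HX LX. eapply gf_ext; [|apply (gf_if P pc bs (fun p u => u 0 <? B p)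
    (fun p u => 2 ^ B p - 1 - dg (B p) (X p (etl u)) (u 0)) (fun _ _ => 0))].
  - intros p u Hu. cbv beta. pose proof (LX p (etl u) (etl_bounded p u Hu)) as Hl.
    destruct (Nat.ltb_spec (u 0) (B p)).
    + symmetry. now apply dg_compl.
    + symmetry. apply dg_ge with (B p); [|assumption]. pose proof (pow2_pos (nn p)). lia.
  - apply df_ltb; auto using gf_B.
  - apply gf_minus; [apply gf_ones| |exact HX].
    intros p v _. apply small1. pose proof (B_le (pc p)). lia.
  - apply gf_0.
Qed.

Lemma ltn_compl X : ltn (fun p v => 2 ^ nn p - 1 - X p v).
Proof. intros p v _. pose proof (pow2_pos (nn p)). lia. Qed.

Lemma defn_land X Y : DefN X -> DefN Y -> DefN (fun p v => Nat.land (X p v) (Y p v)).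
Proof.
  intros HX HY. eapply gf_ext; [|exact (gf_land P pc bs _ _ HX (bd_dgN X) HY (bd_dgN Y))].
  intros p u _. cbv beta. now rewrite dg_land.
Qed.

Lemma PEv_numB X : DefN X -> PEv (fun p v x => numpoly (B p) (B p) (X p v) x).
Proof.
  intros HX. apply (PEv_num P pc bs X (fun p => B p) HX (gf_B P pc bs)).
  intros p. pose proof (lim_B (pc p)). lia.
Qed.

Lemma ca_big p e : e < 16 * (B p * cs (pc p)) -> 2 ^ e < 2 ^ ca (pc p).
Proof. intros H. apply pow2_lt. pose proof (Bs_a (pc p)). lia. Qed.

Lemma Bs_ge p : 256 * B p <= B p * cs (pc p).
Proof. pose proof (s_ge (pc p)). nia. Qed.

Lemma defn_add3 X Y c : c <= 1 -> DefN X -> DefN Y -> ltn X -> ltn Y -> DefN (fun p v => X p v + Y p v + c).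
Proof.
  intros Hc HX HY LX LY.
  eapply DefN_ext; [|apply (defn_poly P pc bs (fun p v x =>
    numpoly (B p) (B p) (X p v) x + numpoly (B p) (B p) (Y p v) x + c))].
  - intros p v Hv. cbv beta. rewrite !numpoly_base by (apply LX || apply LY; assumption). reflexivity.
  - intros p v _. apply Pol_le with (B p); [pose proof (Bs_a (pc p)); pose proof (Bs_ge p); lia|].
    apply Pol_add; [apply Pol_add; apply numpoly_Pol|].
    apply Pol_le with 1; [apply B_pos|apply Pol_const].
  - intros p v _. apply Nat.le_lt_trans with (2 ^ (2 * B p + 3)).
    + replace (2 * B p + 3) with (2 + (2 * B p + 1)) by lia. rewrite (Nat.pow_add_r 2 2). simpl (2 ^ 2).
      pose proof (numpoly_1_le (pc p) (B p) (X p v) ltac:(lia)).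
      pose proof (numpoly_1_le (pc p) (B p) (Y p v) ltac:(lia)). pose proof (pow2_pos (2 * B p + 1)). lia.
    + apply ca_big. pose proof (Bs_ge p). pose proof (B_pos (pc p)). lia.
  - apply PEv_add; [apply PEv_add; now apply PEv_numB|].
    apply PEv_const; [destruct c as [|[|c]]; [apply gf_0|apply gf_1|lia]|].
    intros p v _. apply small1. pose proof (B0_ge (pc p)). lia.
Qed.

Lemma defn_mul X Y : DefN X -> DefN Y -> ltn X -> ltn Y -> DefN (fun p v => X p v * Y p v).
Proof.
  intros HX HY LX LY.
  eapply DefN_ext; [|apply (defn_poly P pc bs (fun p v x =>
    numpoly (B p) (B p) (X p v) x * numpoly (B p) (B p) (Y p v) x))].
  - intros p v Hv. cbv beta. rewrite !numpoly_base by (apply LX || apply LY; assumption). reflexivity.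
  - intros p v _. apply Pol_le with (B p + B p); [pose proof (Bs_a (pc p)); pose proof (Bs_ge p); lia|].
    apply Pol_mul; apply numpoly_Pol.
  - intros p v _. apply Nat.le_lt_trans with (2 ^ (2 * B p + 1 + (2 * B p + 1))).
    + apply le_pow2_mul; apply numpoly_1_le; lia.
    + apply ca_big. pose proof (Bs_ge p). pose proof (B_pos (pc p)). lia.
  - apply PEv_mul; now apply PEv_numB.
Qed.

(** [Y + (2 ^ n - 1 - X) + 1] is [2 ^ n + Y - X]; its block number [cB], the first one beyond [n]
    bits, is 1 exactly when [X <= Y]. *)
Lemma df_leN X Y : DefN X -> DefN Y -> ltn X -> ltn Y -> Def (fun p v => X p v <= Y p v).
Proof.
  intros HX HY LX LY.
  assert (HZ := defn_add3 Y _ 1 (Nat.le_refl 1) HY (defn_compl X HX LX) LY (ltn_compl X)).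
  assert (BB : bd (fun p _ => B p)) by (intros p v _; apply small1; pose proof (cB_le (pc p)); lia).
  assert (H := gf_comp1 P pc bs _ (fun p _ => B p) 0 HZ (gf_B P pc bs) BB).
  eapply Def_ext; [|apply (df_eq P pc bs _ (fun _ _ => 1) H); [|apply gf_1]].
  - intros p v Hv. cbn [scons].
    change (etl (B p .: (fun k => v (0 + k)))) with v.
    pose proof (LX p v Hv). pose proof (LY p v Hv). set (n := 2 ^ nn p) in *.
    unfold dg. fold n. pose proof (two_B P pc p). pose proof (pow2_pos (nn p)) as Hp. fold n in Hp.
    destruct (Nat.le_gt_cases (X p v) (Y p v)) as [Hle|Hgt].
    + split; [intros _; exact Hle|intros _].
      replace ((Y p v + (n - 1 - X p v) + 1) / n) with 1; [apply Nat.mod_small; lia|].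
      apply Nat.div_unique with (Y p v - X p v); lia.
    + split; [|lia]. rewrite Nat.div_small by lia. rewrite Nat.Div0.mod_0_l. easy.
  - intros p v Hv. apply small1. cbn [scons].
    match goal with |- dg ?b ?x ?k <= _ => pose proof (dg_lt b x k) end.
    pose proof (B_le (pc p)). lia.
Qed.

Lemma df_lebN X Y : DefN X -> DefN Y -> ltn X -> ltn Y -> Def (fun p v => (X p v <=? Y p v) = true).
Proof.
  intros HX HY LX LY. eapply Def_ext; [|exact (df_leN X Y HX HY LX LY)]. intros p v _. now rewrite Nat.leb_le.
Qed.

Lemma gf_n : GF (fun p _ => nn p).
Proof. apply gf_mul; apply gf_B. Qed.

Lemma bd_n : bd (fun p _ => nn p).
Proof. intros p v _. apply small2. pose proof (n_small (pc p)). lia. Qed.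

Lemma ltn_word f : bd f -> ltn f.
Proof.
  intros Bf p v Hv. apply Nat.lt_le_trans with (1 := Bf p v Hv). apply pow2_le, m_le_n.
Qed.

(** Below the cut-off the exponent is less than [n], so it lies in block 0, and the power has a
    single nonzero block. *)
Lemma defn_pow X : DefN X -> ltn X -> DefN (fun p v => Nat.min (2 ^ X p v) (2 ^ nn p - 1)).
Proof.
  intros HX LX.
  assert (Bz : bd (fun _ _ => 0)) by (intros p v _; apply pow2_pos).
  assert (Hx0 : GF (fun p v => dg (B p) (X p v) 0)).
  { exact (gf_comp1 P pc bs _ (fun _ _ => 0) 0 HX (gf_0 P pc bs) Bz). }
  assert (Hone : DefN (fun p _ => 2 ^ nn p - 1)).
  { eapply DefN_ext; [|apply (defn_compl (fun _ _ => 0)); [apply defn_word; [apply gf_0|exact Bz]|apply ltn_word, Bz]].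
    intros p v _. cbv beta. lia. }
  assert (HC : Def (fun p v => (nn p <=? X p v) = true)).
  { apply df_lebN; [apply defn_word; [apply gf_n|apply bd_n]|assumption|apply ltn_word, bd_n|assumption]. }
  assert (Hx0' : GF (fun p u => dg (B p) (X p (etl u)) 0)) by exact (gf_ren P pc bs _ S Hx0).
  assert (Bx0 : bd (fun p u => dg (B p) (X p (etl u)) 0)).
  { intros p u _. apply small1. pose proof (dg_lt (B p) (X p (etl u)) 0). pose proof (B_le (pc p)). lia. }
  assert (Hp : DefN (fun p v => 2 ^ dg (B p) (X p v) 0)).
  { eapply gf_ext; [|apply (gf_if P pc bs (fun p u => u 0 =? dg (B p) (X p (etl u)) 0 / B p)
      (fun p u => 2 ^ (dg (B p) (X p (etl u)) 0 mod B p)) (fun _ _ => 0))].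
    - intros p u _. cbv beta. rewrite dg_pow2 by apply B_pos. reflexivity.
    - apply df_eqb; auto. apply gf_div; auto using gf_B.
    - apply gf_pow, gf_mod; auto using gf_B.
    - apply gf_0. }
  eapply DefN_ext; [|exact (defn_if _ _ _ HC Hone Hp)].
  intros p v Hv. cbv beta. pose proof (pow2_pos (nn p)). destruct (Nat.leb_spec (nn p) (X p v)) as [Hle|Hlt].
  - assert (2 ^ nn p <= 2 ^ X p v) by now apply pow2_le. lia.
  (* [n = 2 ^ (16 * cdel)] is less than [2 ^ cB], so an exponent below [n] fits into one block. *)
  - assert (HE : dg (B p) (X p v) 0 = X p v).
    { unfold dg. rewrite Nat.mul_0_r, Nat.pow_0_r, Nat.div_1_r. apply Nat.mod_small.
      apply Nat.lt_trans with (1 := Hlt). rewrite n_eq. apply pow2_lt.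
      assert (H2 := pow2_gt (8 * cdel (pc p) - 1)). pose proof (c_del (pc p)).
      unfold cB. replace (8 * cdel (pc p)) with (1 + (8 * cdel (pc p) - 1)) by lia.
      rewrite Nat.pow_add_r. simpl (2 ^ 1).
      assert (H3 := pow2_gt (8 * cdel (pc p) - 3)).
      replace (8 * cdel (pc p) - 1) with (2 + (8 * cdel (pc p) - 3)) by lia.
      rewrite Nat.pow_add_r. simpl (2 ^ 2). lia. }
    rewrite HE. pose proof (pow2_lt _ _ Hlt). lia.
Qed.

(** * Division of long numbers *)

Section Division.
Variables U W : P -> (nat -> nat) -> nat.
Hypothesis (HU : DefN U) (HW : DefN W) (LU : ltn U) (LW : ltn W).

(* environment: x0, e, then the arguments of U and W after two further entries *)
Let U' p (w : nat -> nat) := U p (fun i => w (4 + i)).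
Let W' p (w : nat -> nat) := W p (fun i => w (4 + i)).
Let e' p (w : nat -> nat) := w 1 mod nn p.
(** The approximate reciprocal [x0 * 2 ^ e] as a polynomial in the block base; the shift splits into
    whole blocks and a rest. *)
Let Kp p w x := numpoly (B p) (B p) (w 0) x * (2 ^ (e' p w mod B p) * x ^ (e' p w / B p)).
Let fY p w x := Kp p w x * numpoly (B p) (B p) (W' p w) x.
Let Yn p w := fY p w (2 ^ B p).
(** The blockwise complement; adding 1, as [fX] does, gives [2 ^ M - Yn], the defect of the
    approximation, for [M = cB * cMb]. *)
Let Xn p w := num (B p) (cMb (pc p)) (fun i => 2 ^ B p - 1 - dg (B p) (Yn p w) i).
Let fX p w x := numpoly (B p) (cMb (pc p)) (Xn p w) x + 1.
(** The factor [2 ^ (cB - 1)] turns the final shift by [M * s + 1] bits of [div_series] into a shift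
    by whole blocks. *)
Let fG p w x := 2 ^ (B p - 1) * ((numpoly (B p) (B p) (U' p w) x + numpoly (B p) (B p) (U' p w) x + 1) *
  Kp p w x * horner (fX p w x) (x ^ cMb (pc p)) (cs (pc p))).
Let Gn p w := fG p w (2 ^ B p).

Lemma B_ne p : B p <> 0.
Proof. pose proof (B_pos (pc p)). lia. Qed.

Lemma e_lt p w : e' p w < nn p.
Proof. apply Nat.mod_upper_bound. pose proof (B_pos (pc p)). nia. Qed.

Lemma eB_lt p w : e' p w / B p < B p.
Proof. apply Nat.Div0.div_lt_upper_bound. apply e_lt. Qed.

Lemma gf_e : GF e'.
Proof. apply gf_mod; auto using gf_n. Qed.

Lemma bd_e : bd e'.
Proof. intros p w _. pose proof (e_lt p w). apply small2. pose proof (n_small (pc p)). lia. Qed.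

Lemma HU' : DefN U'.
Proof. exact (DefN_ren U (fun i => 4 + i) HU). Qed.

Lemma HW' : DefN W'.
Proof. exact (DefN_ren W (fun i => 4 + i) HW). Qed.

Lemma Kp_Pol p w : Pol (2 * B p) (Kp p w).
Proof.
  unfold Kp. apply Pol_le with (B p + (e' p w / B p + 1)); [pose proof (eB_lt p w); lia|].
  apply Pol_mul; [apply numpoly_Pol|apply Pol_mono].
Qed.

Lemma Kp_1 p w : Kp p w 1 <= 2 ^ (3 * B p + 1).
Proof.
  unfold Kp. replace (3 * B p + 1) with (2 * B p + 1 + B p) by lia. apply le_pow2_mul.
  - apply numpoly_1_le. lia.
  - rewrite Nat.pow_1_l, Nat.mul_1_r. apply pow2_le, Nat.lt_le_incl, Nat.mod_upper_bound, B_ne.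
Qed.

Lemma Kp_base p w : bounded (m p) w -> Kp p w (2 ^ B p) = w 0 * 2 ^ e' p w.
Proof.
  intros Hw. unfold Kp. rewrite numpoly_base by exact (ltn_word _ (Vb 0) p w Hw). f_equal.
  rewrite <- Nat.pow_mul_r, <- Nat.pow_add_r. f_equal.
  pose proof (Nat.div_mod (e' p w) (B p) (B_ne p)). lia.
Qed.

Lemma Kp_PEv : PEv Kp.
Proof.
  unfold Kp. apply PEv_mul; [apply PEv_numB, defn_word; auto|]. apply PEv_mul.
  - apply PEv_const.
    + apply gf_pow, gf_mod; auto using gf_e, bd_e, gf_B.
    + intros p w _. apply small1. pose proof (Nat.mod_upper_bound (e' p w) (B p) (B_ne p)) as H.
      apply pow2_lt in H. pose proof (B_le (pc p)). lia.
  - apply PEv_mono; [apply gf_div; auto using gf_e, bd_e, gf_B|].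
    intros p w _. apply small1. pose proof (eB_lt p w). pose proof (cB_le (pc p)). lia.
Qed.

Lemma Yn_DefN : DefN Yn.
Proof.
  apply (defn_poly P pc bs fY).
  - intros p w _. apply Pol_le with (2 * B p + B p); [pose proof (Bs_a (pc p)); pose proof (Bs_ge p); lia|].
    apply Pol_mul; [apply Kp_Pol|apply numpoly_Pol].
  - intros p w _. apply Nat.le_lt_trans with (2 ^ (3 * B p + 1 + (2 * B p + 1))).
    + apply le_pow2_mul; [apply Kp_1|apply numpoly_1_le; lia].
    + apply ca_big. pose proof (Bs_ge p). pose proof (B_pos (pc p)). lia.
  - apply PEv_mul; [apply Kp_PEv|apply PEv_numB, HW'].
Qed.

Lemma gf_Mb : GF (fun p _ => cMb (pc p)).
Proof.
  apply gf_add; [apply gf_B|]. eapply gf_ext; [|apply gf_add; apply (gf_cst P pc bs 7); lia].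
  intros p v _. unfold chb. cbv beta. lia.
Qed.

Lemma Xn_DefN : DefN Xn.
Proof.
  eapply gf_ext; [|apply (gf_if P pc bs (fun p u => u 0 <? cMb (pc p))
    (fun p u => 2 ^ B p - 1 - dg (B p) (Yn p (etl u)) (u 0)) (fun _ _ => 0))].
  - intros p u _. cbv beta. unfold Xn at 1.
    assert (Hd : forall i, i < cMb (pc p) -> 2 ^ B p - 1 - dg (B p) (Yn p (etl u)) i < 2 ^ B p).
    { intros i _. pose proof (pow2_pos (B p)). lia. }
    destruct (Nat.ltb_spec (u 0) (cMb (pc p))).
    + unfold Xn. symmetry. now rewrite dg_num.
    + unfold Xn. symmetry. now apply dg_num_ge.
  - apply df_ltb; auto using gf_Mb.
  - apply gf_minus; [apply gf_ones| |exact Yn_DefN].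
    intros p v _. apply small1. pose proof (B_le (pc p)). lia.
  - apply gf_0.
Qed.

Lemma fX_PEv : PEv fX.
Proof.
  unfold fX. apply PEv_add.
  - apply (PEv_num P pc bs Xn (fun p => cMb (pc p)) Xn_DefN gf_Mb).
    intros p. pose proof (Mb_le (pc p)). pose proof (lim_B (pc p)). lia.
  - apply PEv_const; [apply gf_1|]. intros p v _. apply small1. pose proof (B0_ge (pc p)). lia.
Qed.

Lemma fX_Pol p w : Pol (cMb (pc p)) (fX p w).
Proof.
  unfold fX. apply Pol_add; [apply numpoly_Pol|]. apply Pol_le with 1; [|apply Pol_const].
  unfold cMb. pose proof (B_pos (pc p)). lia.
Qed.

Lemma horner_Pol p w : Pol (cs (pc p) * cMb (pc p) + 2)
  (fun x => horner (fX p w x) (x ^ cMb (pc p)) (cs (pc p))).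
Proof.
  apply Pol_ext with (fun x => sum (cs (pc p)) (fun i => (x ^ cMb (pc p)) ^ i * fX p w x ^ (cs (pc p) - 1 - i))).
  - intros x. symmetry. apply horner_sum.
  - apply (Pol_sum (cs (pc p)) _ (fun i x => (x ^ cMb (pc p)) ^ i * fX p w x ^ (cs (pc p) - 1 - i))).
    intros i Hi.
    apply Pol_le with (cMb (pc p) * i + 1 + ((cs (pc p) - 1 - i) * cMb (pc p) + 1)).
    + assert (cMb (pc p) * i + (cs (pc p) - 1 - i) * cMb (pc p) <= cs (pc p) * cMb (pc p)); [|lia].
      rewrite Nat.mul_comm, <- Nat.mul_add_distr_r. apply Nat.mul_le_mono_r. lia.
    + apply Pol_mul; [|apply Pol_pow, fX_Pol].
      eapply Pol_ext; [|apply (Pol_mono (cMb (pc p) * i) 1)]. intros x. cbv beta.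
      rewrite Nat.mul_1_l. apply Nat.pow_mul_r.
Qed.

Lemma horner_1 p w : horner (fX p w 1) (1 ^ cMb (pc p)) (cs (pc p)) <= 2 ^ (cs (pc p) + (2 * B p + 2) * cs (pc p)).
Proof.
  rewrite horner_sum.
  apply Nat.le_trans with (sum (cs (pc p)) (fun _ => 2 ^ ((2 * B p + 2) * cs (pc p)))).
  - apply sum_le. intros i Hi. rewrite !Nat.pow_1_l, Nat.mul_1_l.
    assert (HX : fX p w 1 <= 2 ^ (2 * B p + 2)).
    { unfold fX. pose proof (numpoly_1_le (pc p) (cMb (pc p)) (Xn p w) (Mb_le (pc p))) as H.
      replace (2 * B p + 2) with (1 + (2 * B p + 1)) by lia. rewrite Nat.pow_add_r. simpl (2 ^ 1).
      pose proof (pow2_pos (2 * B p + 1)). lia. }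
    apply Nat.le_trans with ((2 ^ (2 * B p + 2)) ^ (cs (pc p) - 1 - i)); [now apply Nat.pow_le_mono_l|].
    rewrite <- Nat.pow_mul_r. apply pow2_le. apply Nat.mul_le_mono_l. lia.
  - rewrite sum_const. apply le_pow2_mul; [|reflexivity]. apply Nat.lt_le_incl, pow2_gt.
Qed.

Lemma Gn_DefN : DefN Gn.
Proof.
  apply (defn_poly P pc bs fG).
  - intros p w _. unfold fG.
    apply Pol_le with (1 + (B p + 2 * B p + (cs (pc p) * cMb (pc p) + 2))).
    + pose proof (Bs_a (pc p)). pose proof (Bs_ge p). pose proof (Mb_le (pc p)). pose proof (B_pos (pc p)).
      assert (cs (pc p) * cMb (pc p) <= cs (pc p) * (2 * B p)) by now apply Nat.mul_le_mono_l. lia.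
    + apply Pol_mul; [apply Pol_const|]. apply Pol_mul; [apply Pol_mul; [|apply Kp_Pol]|apply horner_Pol].
      apply Pol_add; [apply Pol_add; apply numpoly_Pol|]. apply Pol_le with 1; [apply B_pos|apply Pol_const].
  - intros p w _. unfold fG.
    apply Nat.le_lt_trans with (2 ^ (B p + (2 * B p + 3 + (3 * B p + 1) + (cs (pc p) + (2 * B p + 2) * cs (pc p))))).
    + apply le_pow2_mul; [apply pow2_le; lia|]. apply le_pow2_mul; [|apply horner_1].
      apply le_pow2_mul; [|apply Kp_1].
      replace (2 * B p + 3) with (2 + (2 * B p + 1)) by lia. rewrite (Nat.pow_add_r 2 2). simpl (2 ^ 2).
      pose proof (numpoly_1_le (pc p) (B p) (U' p w) ltac:(lia)). pose proof (pow2_pos (2 * B p + 1)). lia.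
    + apply ca_big. pose proof (Bs_ge p). pose proof (B_pos (pc p)). pose proof (s_ge (pc p)).
      assert (cs (pc p) <= B p * cs (pc p)) by nia.
      replace ((2 * B p + 2) * cs (pc p)) with (2 * (B p * cs (pc p)) + 2 * cs (pc p)) by ring. lia.
  - unfold fG. apply PEv_mul; [|apply PEv_mul; [apply PEv_mul; [|apply Kp_PEv]|]].
    + apply PEv_const.
      * apply gf_pow, gf_minus; [apply gf_B| |apply gf_1].
        intros p v _. apply small1. pose proof (cB_le (pc p)). lia.
      * intros p v _. apply small1. pose proof (B_le (pc p)).
        assert (2 ^ (B p - 1) <= 2 ^ B p) by (apply pow2_le; lia). lia.
    + apply PEv_add; [apply PEv_add; apply PEv_numB, HU'|].
      apply PEv_const; [apply gf_1|]. intros p v _. apply small1. pose proof (B0_ge (pc p)). lia.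
    + apply (PEv_horner P pc bs fX (fun p => cMb (pc p)) (fun p => cs (pc p))).
      * apply fX_PEv.
      * apply gf_Mb.
      * eapply gf_ext; [|apply (gf_cst P pc bs 1); lia]. intros p v _. unfold cs. cbv beta. now rewrite Nat.mul_1_l.
      * intros p. pose proof (Mb_le (pc p)). pose proof (lim_B (pc p)). pose proof (lim_le (pc p)). lia.
      * intros p. unfold cs, clim. apply pow2_le. pose proof (c_del (pc p)). lia.
Qed.

(** The test of [top_digits] for [Yn], which accepts a guess exactly when its defect is at most
    [2 ^ n] and positive. *)
Definition good_scale p (w : nat -> nat) : Prop :=
  forall b, b < lim p -> b < B p \/ dg (B p) (Yn p w) b = if b <? cMb (pc p) then 2 ^ B p - 1 else 0.

Lemma Yn_eq p w : bounded (m p) w -> Yn p w = w 0 * 2 ^ e' p w * W' p w.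
Proof.
  intros Hw. unfold Yn, fY. rewrite Kp_base by assumption. f_equal. apply numpoly_base. apply LW.
  intros i; apply Hw.
Qed.

Lemma Yn_lt p w : bounded (m p) w -> Yn p w < 2 ^ (B p * lim p).
Proof.
  intros Hw. rewrite Yn_eq by assumption.
  apply Nat.lt_le_trans with (2 ^ (nn p + nn p + nn p)).
  - apply lt_pow2_mul; [apply lt_pow2_mul|].
    + exact (ltn_word _ (Vb 0) p w Hw).
    + apply pow2_lt, e_lt.
    + apply LW. intros i; apply Hw.
  - apply pow2_le. pose proof (lim_B (pc p)). nia.
Qed.

Lemma good_scale_iff p w : bounded (m p) w ->
  (good_scale p w <-> 2 ^ (B p * cMb (pc p)) <= Yn p w + 2 ^ nn p /\ Yn p w < 2 ^ (B p * cMb (pc p))).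
Proof.
  intros Hw. apply (top_digits (B p) (B p) (chb (pc p)) (lim p) (Yn p w)).
  - apply B_pos.
  - pose proof (hb_B (pc p)). pose proof (lim_B (pc p)). lia.
  - now apply Yn_lt.
Qed.

(** The defect is at most [2 ^ n] and [M * s = n * s + 2 * n], so the error [(2 * U + 1) * X ^ s]
    stays below [2 ^ (M * s)], as [div_series] demands. *)
Lemma Gn_div p w : bounded (m p) w -> 0 < W' p w -> good_scale p w ->
  Gn p w / 2 ^ (B p * (cMb (pc p) * cs (pc p) + 1)) = U' p w / W' p w.
Proof.
  intros Hw HW0 Hg. apply good_scale_iff in Hg; [|assumption]. destruct Hg as [H1 H2].
  set (M := B p * cMb (pc p)) in *. set (s := cs (pc p)).
  assert (HX : fX p w (2 ^ B p) = 2 ^ M - Yn p w).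
  { unfold fX. rewrite numpoly_base.
    - unfold Xn. assert (E : num (B p) (cMb (pc p)) (fun i => 2 ^ B p - 1 - dg (B p) (Yn p w) i) = 2 ^ M - 1 - Yn p w).
      { apply (dg_ext (B p) (cMb (pc p))).
        - apply num_lt. intros i _. pose proof (pow2_pos (B p)). lia.
        - unfold M. pose proof (pow2_pos (B p * cMb (pc p))). lia.
        - intros k Hk. rewrite dg_num; [|intros i _; pose proof (pow2_pos (B p)); lia|assumption].
          symmetry. now apply dg_compl. }
      rewrite E. lia.
    - apply num_lt. intros i _. pose proof (pow2_pos (B p)). lia. }
  assert (HUl : U' p w < 2 ^ nn p) by (apply LU; intros i; apply Hw).
  assert (HG : Gn p w = 2 ^ (B p - 1) * ((2 * U' p w + 1) * (w 0 * 2 ^ e' p w) * horner (2 ^ M - Yn p w) (2 ^ M) s)).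
  { unfold Gn, fG. rewrite HX, Kp_base by assumption. rewrite numpoly_base by exact HUl.
    rewrite <- Nat.pow_mul_r. fold M. f_equal. f_equal. f_equal. lia. }
  rewrite HG.
  replace (B p * (cMb (pc p) * s + 1)) with (B p - 1 + (M * s + 1)).
  2:{ unfold M, s. pose proof (B_pos (pc p)). nia. }
  rewrite (Nat.pow_add_r 2 (B p - 1)), Nat.Div0.div_mul_cancel_l by apply pow2_ne.
  apply div_series; [assumption| |].
  - rewrite <- Yn_eq by assumption. lia.
  - assert (HXs : (2 ^ M - Yn p w) ^ s <= 2 ^ (nn p * s)).
    { rewrite Nat.pow_mul_r. apply Nat.pow_le_mono_l. lia. }
    assert (HMs : M * s = nn p * s + 2 * nn p).
    { unfold M, cMb. pose proof (hb_s (pc p)) as Hh. fold s in Hh.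
      replace (B p * (B p + chb (pc p)) * s) with (nn p * s + B p * (chb (pc p) * s)) by ring.
      rewrite Hh. ring. }
    rewrite HMs, Nat.pow_add_r, Nat.mul_comm.
    assert (2 * U' p w + 1 < 2 ^ (2 * nn p)).
    { apply Nat.lt_le_trans with (2 * 2 ^ nn p); [lia|]. rewrite <- Nat.pow_succ_r'. apply pow2_le.
      pose proof (B_pos (pc p)). nia. }
    pose proof (pow2_pos (nn p * s)). nia.
Qed.

Lemma scale_ok p w : bounded (m p) w -> 0 < W' p w ->
  exists e x0, e < 2 ^ m p /\ x0 < 2 ^ m p /\
    forall w', bounded (m p) w' -> w' 0 = x0 -> w' 1 = e -> W' p w' = W' p w -> good_scale p w'.
Proof.
  intros Hw HW0. assert (HWl : W' p w < 2 ^ nn p) by (apply LW; intros i; apply Hw).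
  destruct (scale_exists (W' p w) (nn p) (B p * chb (pc p)) HW0 HWl) as (e & x0 & He & Hx & H1 & H2).
  exists e, x0. split; [|split].
  - apply Nat.lt_trans with (1 := He). exact (bd_n p (fun _ => 0) (fun _ => pow2_pos _)).
  - apply Nat.lt_le_trans with (1 := Hx). apply pow2_le, h_le_m.
  - intros w' Hw' E0 E1 EW. apply good_scale_iff; [assumption|]. rewrite Yn_eq by assumption.
    rewrite E0, EW. unfold e'. rewrite E1, Nat.mod_small by assumption.
    replace (B p * cMb (pc p)) with (nn p + B p * chb (pc p)) by (unfold cMb; ring). split; assumption.
Qed.

(** Every accepted guess of [x0] and [e] gives the same block of the quotient, and [scale_ok]
    provides one; so the existential statement defines the block. Divisor 0 and blocks beyond [n]
    bits get the value 0. *)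
Lemma defn_div : DefN (fun p v => U p v / W p v).
Proof.
  assert (Bz : bd (fun _ _ => 0)) by (intros p v _; apply pow2_pos).
  assert (W0 : Def (fun p v => W p v <= 0)).
  { apply df_leN; auto; [apply defn_word; [apply gf_0|exact Bz]|apply ltn_word, Bz]. }
  (* t = x0, e, z, b, v *)
  set (off := fun p (t : nat -> nat) => if t 3 <? B p then cMb (pc p) * cs (pc p) + 1 + t 3 else 0).
  assert (Goff : GF off).
  { apply gf_if; [apply df_ltb; auto using gf_B| |apply gf_0]. apply gf_add; [|auto].
    apply gf_add; [|apply gf_1]. apply gf_mul; [apply gf_Mb|].
    eapply gf_ext; [|apply (gf_cst P pc bs 1); lia]. intros p v _. unfold cs. cbv beta. now rewrite Nat.mul_1_l. }
  assert (Boff : bd off).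
  { intros p t _. unfold off. destruct (Nat.ltb_spec (t 3) (B p)); [|apply pow2_pos]. apply small2.
    pose proof (Mb_le (pc p)). pose proof (lim_B (pc p)). pose proof (lim_le (pc p)).
    assert (cs (pc p) <= lim p) by (unfold cs, clim; apply pow2_le; pose proof (c_del (pc p)); lia).
    pose proof (B0_ge (pc p)).
    assert (cMb (pc p) * cs (pc p) <= B0 p * B0 p) by (apply Nat.mul_le_mono; lia). nia. }
  assert (HGo : GF (fun p t => dg (B p) (Gn p t) (off p t))).
  { exact (gf_comp1 P pc bs _ off 0 Gn_DefN Goff Boff). }
  assert (HGd : Def (fun p t => t 2 = dg (B p) (Gn p t) (off p t))) by (apply df_eq; auto).
  assert (Hgood : Def good_scale).
  { apply (Def_all P pc bs (fun p _ => lim p)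
      (fun p u => u 0 < B p \/ dg (B p) (Yn p (etl u)) (u 0) = if u 0 <? cMb (pc p) then 2 ^ B p - 1 else 0)).
    - apply gf_lim.
    - intros p v _. apply small1. pose proof (lim_le (pc p)). lia.
    - apply Def_or; [apply df_lt; auto using gf_B|].
      apply df_eq; [exact Yn_DefN|apply bd_dgN|]. apply gf_if; [|apply gf_ones|apply gf_0].
      apply df_ltb; auto using gf_Mb. }
  assert (HE := Def_ex P pc bs _ (Def_ex P pc bs _ (Def_and P pc bs _ _ Hgood HGd))).
  (* v = z, b, ... *)
  assert (HWz : Def (fun p v => W p (fun i => v (2 + i)) <= 0)) by exact (Def_ren P pc bs _ (fun i => 2 + i) W0).
  assert (HB1 : Def (fun p v => v 1 < B p)) by (apply df_lt; auto using gf_B).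
  assert (HC := Def_and P pc bs _ _ HB1 (Def_not P pc bs _ HWz)).
  assert (AZ : Def (fun p v => v 0 = 0)) by (apply df_eq; auto using gf_0).
  eapply Def_ext; [|exact (Def_or P pc bs _ _ (Def_and P pc bs _ _ HC HE)
    (Def_and P pc bs _ _ (Def_not P pc bs _ HC) AZ))].
  intros p v Hv. cbv beta. set (V := fun i => v (2 + i)). change (etl (etl v)) with V.
  change (etl v 0) with (v 1).
  assert (HUl : U p V < 2 ^ nn p) by (apply LU; intros i; apply Hv).
  destruct (Nat.eq_dec (W p V) 0) as [EW|EW].
  { rewrite EW. simpl (_ / 0). replace (dg (B p) 0 (v 1)) with 0.
    2:{ unfold dg. now rewrite Nat.Div0.div_0_l, Nat.Div0.mod_0_l. }
    split; [intros [[[_ H] _]|[_ H]]; [lia|exact H]|intros H; right; split; [intros [_ H']; lia|exact H]]. }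
  destruct (Nat.lt_ge_cases (v 1) (B p)) as [Hb|Hb].
  2:{ replace (dg (B p) (U p V / W p V) (v 1)) with 0.
      - split; [intros [[[H _] _]|[_ H]]; [lia|exact H]|intros H; right; split; [intros [H' _]; lia|exact H]].
      - symmetry. apply dg_ge with (B p); [|assumption]. apply Nat.le_lt_trans with (2 := HUl), div_le. }
  assert (Key : forall x0 e, x0 < 2 ^ m p -> e < 2 ^ m p -> good_scale p (x0 .: e .: v) ->
    dg (B p) (Gn p (x0 .: e .: v)) (off p (x0 .: e .: v)) = dg (B p) (U p V / W p V) (v 1)).
  { intros x0 e Hx He Hg.
    assert (Hw : bounded (m p) (x0 .: e .: v)) by now repeat apply bounded_scons.
    assert (HW0 : 0 < W' p (x0 .: e .: v)) by (change (0 < W p V); lia).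
    assert (HGD : Gn p (x0 .: e .: v) / 2 ^ (B p * (cMb (pc p) * cs (pc p) + 1)) = U p V / W p V)
      by exact (Gn_div p (x0 .: e .: v) Hw HW0 Hg).
    rewrite <- HGD.
    rewrite dg_shift. f_equal. unfold off. cbn [scons].
    destruct (Nat.ltb_spec (v 1) (B p)); [reflexivity|lia]. }
  split.
  - intros [[_ (e & He & x0 & Hx & Hg & Hz)]|[H _]]; [|exfalso; apply H; split; [exact Hb|lia]].
    cbn [scons] in Hz. rewrite Hz. now apply Key.
  - intros Hz. left. split; [split; [exact Hb|lia]|].
    assert (Hw0 : bounded (m p) (0 .: 0 .: v)) by (repeat apply bounded_scons; auto; apply pow2_pos).
    destruct (scale_ok p (0 .: 0 .: v) Hw0) as (e & x0 & He & Hx & Hok).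
    { change (W' p (0 .: 0 .: v)) with (W p V). lia. }
    assert (Hg : good_scale p (x0 .: e .: v)).
    { apply Hok; [now repeat apply bounded_scons|reflexivity|reflexivity|reflexivity]. }
    exists e. split; [exact He|]. exists x0. split; [exact Hx|]. split; [exact Hg|].
    cbn [scons]. rewrite Hz. symmetry. now apply Key.
Qed.
End Division.
End Ops.

(** * Diagonalization *)

Definition ND (c : ctx) (j : nat) (X : (nat -> nat) -> nat) : Prop :=
  D c j (fun v => v 0 = dg (cB c) (X (etl (etl v))) (v 1)).

Definition ltc (c : ctx) (X : (nat -> nat) -> nat) : Prop :=
  forall v, bounded (cm c) v -> X v < 2 ^ (cB c * cB c).

Lemma ND_le c j j' X : j <= j' -> ND c j X -> ND c j' X.
Proof. apply D_le. Qed.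

(** Making the two long numbers and their level part of the parameter yields a constant that does
    not depend on them, so the operation can be applied at every node of a term. *)
Record par2 := Par2 {
  p_c : ctx; p_j : nat; p_X : (nat -> nat) -> nat; p_Y : (nat -> nat) -> nat;
  p_HX : ND p_c p_j p_X; p_HY : ND p_c p_j p_Y; p_LX : ltc p_c p_X; p_LY : ltc p_c p_Y
}.

Lemma par_X : DefN par2 p_c p_j p_X.
Proof. exists 0. intros p. rewrite Nat.add_0_r. apply p_HX. Qed.

Lemma par_Y : DefN par2 p_c p_j p_Y.
Proof. exists 0. intros p. rewrite Nat.add_0_r. apply p_HY. Qed.

Lemma par_LX : ltn par2 p_c p_X.
Proof. intros p. apply p_LX. Qed.

Lemma par_LY : ltn par2 p_c p_Y.
Proof. intros p. apply p_LY. Qed.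

Lemma cn_eq c : cB c * cB c = 2 ^ (2 ^ cx c).
Proof. rewrite n_eq, c_d. reflexivity. Qed.

Lemma bin_level f : exists C, forall c j X Y, ND c j X -> ND c j Y -> ltc c X -> ltc c Y ->
  ND c (j + C) (fun v => bin_nat (cB c * cB c) f (X v) (Y v)).
Proof.
  assert (H : DefN par2 p_c p_j (fun p v => bin_nat (cB (p_c p) * cB (p_c p)) f (p_X p v) (p_Y p v))).
  { destruct f; cbn [bin_nat].
    - apply defn_trunc. eapply DefN_ext; [|exact (defn_add3 _ _ _ _ _ 0 (Nat.le_0_l 1) par_X par_Y par_LX par_LY)].
      intros p v _. cbv beta. lia.
    - apply defn_trunc, defn_mul; auto using par_X, par_Y, par_LX, par_LY.
    - eapply DefN_ext; [|exact (defn_div _ _ _ _ _ par_X par_Y par_LX par_LY)].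
      intros p v _. cbv beta. destruct (Nat.eqb_spec (p_Y p v) 0) as [->|_]; reflexivity.
    - eapply DefN_ext; [|apply (defn_if _ _ _ (fun p v => p_X p v <=? p_Y p v) p_Y p_X);
        [apply df_lebN; auto using par_X, par_Y, par_LX, par_LY|apply par_Y|apply par_X]].
      intros p v _. cbv beta. destruct (Nat.leb_spec (p_X p v) (p_Y p v)); lia.
    - eapply DefN_ext; [|apply (defn_if _ _ _ (fun p v => p_X p v <=? p_Y p v) p_X p_Y);
        [apply df_lebN; auto using par_X, par_Y, par_LX, par_LY|apply par_X|apply par_Y]].
      intros p v _. cbv beta. destruct (Nat.leb_spec (p_X p v) (p_Y p v)); lia.
    - apply defn_land; auto using par_X, par_Y. }
  destruct H as [C HC]. exists C. intros c j X Y HX HY LX LY. exact (HC (Par2 c j X Y HX HY LX LY)).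
Qed.

Lemma un_level f : exists C, forall c j X, ND c j X -> ltc c X ->
  ND c (j + C) (fun v => un_nat (cB c * cB c) f (X v)).
Proof.
  assert (H : DefN par2 p_c p_j (fun p v => un_nat (cB (p_c p) * cB (p_c p)) f (p_X p v))).
  { destruct f; cbn [un_nat].
    - eapply DefN_ext; [|exact (defn_compl _ _ _ _ par_X par_LX)].
      intros p v Hv. cbv beta. symmetry. apply lnot_low. now apply p_LX.
    - exact (defn_pow _ _ _ _ par_X par_LX). }
  destruct H as [C HC]. exists C. intros c j X HX LX. exact (HC (Par2 c j X X HX HX LX LX)).
Qed.

Lemma cst_level k : exists C, forall c, ND c C (fun _ => cst_nat (cB c * cB c) k).
Proof.
  assert (H : DefN ctx (fun c => c) (fun _ => 0) (fun c _ => cst_nat (cB c * cB c) k)).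
  { assert (Bz : bd ctx (fun c => c) (fun _ _ => 0)) by (intros p v _; apply pow2_pos).
    destruct k; cbn [cst_nat].
    - apply defn_word; [apply gf_0|exact Bz].
    - apply defn_word; [apply gf_1|]. intros p v _. apply small1. pose proof (B0_ge p). lia.
    - eapply DefN_ext; [|apply (defn_compl _ _ _ (fun _ _ => 0));
        [apply defn_word; [apply gf_0|exact Bz]|apply ltn_word, Bz]].
      intros p v _. cbv beta. lia.
    - apply defn_word; [apply (gf_n ctx (fun c => c))|apply (bd_n ctx (fun c => c))]. }
  destruct H as [C HC]. exists C. exact HC.
Qed.

Lemma eq_level : exists C, forall c j X Y, ND c j X -> ND c j Y -> ltc c X -> ltc c Y ->
  D c (j + C) (fun v => X v = Y v).
Proof.
  assert (H : Def par2 p_c p_j (fun p v => p_X p v = p_Y p v)).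
  { eapply Def_ext; [|exact (Def_and _ _ _ _ _
      (df_leN _ _ _ _ _ par_X par_Y par_LX par_LY) (df_leN _ _ _ _ _ par_Y par_X par_LY par_LX))].
    intros p v _. cbv beta. lia. }
  destruct H as [C HC]. exists C. intros c j X Y HX HY LX LY. exact (HC (Par2 c j X Y HX HY LX LY)).
Qed.

Lemma uniform_level : exists C, 8 <= C /\
  (forall f c j X Y, ND c j X -> ND c j Y -> ltc c X -> ltc c Y ->
    ND c (j + C) (fun v => bin_nat (cB c * cB c) f (X v) (Y v))) /\
  (forall f c j X, ND c j X -> ltc c X -> ND c (j + C) (fun v => un_nat (cB c * cB c) f (X v))) /\
  (forall k c, ND c C (fun _ => cst_nat (cB c * cB c) k)) /\
  (forall c j X Y, ND c j X -> ND c j Y -> ltc c X -> ltc c Y -> D c (j + C) (fun v => X v = Y v)).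
Proof.
  destruct (bin_level f_add) as [C1 H1], (bin_level f_mul) as [C2 H2], (bin_level f_div) as [C3 H3],
    (bin_level f_max) as [C4 H4], (bin_level f_min) as [C5 H5], (bin_level f_cap) as [C6 H6],
    (un_level f_compl) as [C7 H7], (un_level f_pow) as [C8 H8], (cst_level c_zero) as [C9 H9],
    (cst_level c_one) as [C10 H10], (cst_level c_minus_one) as [C11 H11], (cst_level c_n) as [C12 H12],
    eq_level as [C13 H13].
  exists (8 + C1 + C2 + C3 + C4 + C5 + C6 + C7 + C8 + C9 + C10 + C11 + C12 + C13).
  split; [lia|]. split; [|split; [|split]].
  - intros f c j X Y HX HY LX LY.
    destruct f; [apply ND_le with (j + C1)|apply ND_le with (j + C2)|apply ND_le with (j + C3)|
      apply ND_le with (j + C4)|apply ND_le with (j + C5)|apply ND_le with (j + C6)];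
      try lia; auto.
  - intros f c j X HX LX. destruct f; [apply ND_le with (j + C7)|apply ND_le with (j + C8)]; try lia; auto.
  - intros k c. destruct k; [apply ND_le with C9|apply ND_le with C10|
      apply ND_le with C11|apply ND_le with C12]; try lia; auto.
  - intros c j X Y HX HY LX LY. apply D_le with (j + C13); [lia|auto].
Qed.

Section Levels.
Variable C : nat.
Hypothesis HC8 : 8 <= C.
Hypothesis Hbin : forall f c j X Y, ND c j X -> ND c j Y -> ltc c X -> ltc c Y ->
    ND c (j + C) (fun v => bin_nat (cB c * cB c) f (X v) (Y v)).
Hypothesis Hun : forall f c j X, ND c j X -> ltc c X -> ND c (j + C) (fun v => un_nat (cB c * cB c) f (X v)).
Hypothesis Hcst : forall k c, ND c C (fun _ => cst_nat (cB c * cB c) k).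
Hypothesis Heq : forall c j X Y, ND c j X -> ND c j Y -> ltc c X -> ltc c Y -> D c (j + C) (fun v => X v = Y v).

Variables (c : ctx) (j : nat) (Y : (nat -> nat) -> nat).
Hypothesis (HY : ND c j Y) (LY : ltc c Y).
Notation n := (cB c * cB c).

Lemma term_ltc t : ltc c (fun v => neval n (fun _ => Y v) t).
Proof.
  intros v Hv. rewrite cn_eq. apply neval_lt. intros _. rewrite <- cn_eq. now apply LY.
Qed.

(** Both arguments are raised to the same level before an operation adds [C], so the level grows
    with the depth and not with the number of nodes. *)
Lemma term_level t : ND c (j + C * (term_depth t + 1)) (fun v => neval n (fun _ => Y v) t).
Proof.
  induction t as [x|k|f t IH|f t IHt u IHu]; cbn [neval term_depth].
  - eapply ND_le; [|exact HY]. lia.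
  - eapply ND_le; [|exact (Hcst k c)]. lia.
  - eapply ND_le; [|exact (Hun f c _ _ IH (term_ltc t))]. lia.
  - set (h := Nat.max (term_depth t) (term_depth u)).
    eapply ND_le; [|apply (Hbin f c (j + C * (h + 1)) _ _)].
    + lia.
    + eapply ND_le; [|exact IHt]. nia.
    + eapply ND_le; [|exact IHu]. nia.
    + apply term_ltc.
    + apply term_ltc.
Qed.

(** Connectives also cost at most [C] levels per nesting, since two subformulas of a common level
    are combined. *)
Lemma formula_level a : propositional a ->
  D c (j + C * (depth a + 2)) (fun v => fsb n (fun _ => Y v) a = true).
Proof.
  assert (Hnot : forall i (R : (nat -> nat) -> Prop), D c i R -> D c (i + 1) (fun v => ~ R v)).
  { intros i R H. rewrite Nat.add_1_r. now apply D_not. }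
  assert (Hand : forall i (R R' : (nat -> nat) -> Prop), D c i R -> D c i R' -> D c (i + 1) (fun v => R v /\ R' v)).
  { intros i R R' H H'. rewrite Nat.add_1_r. now apply D_and. }
  (* All connectives at once: the conjunction, over the four rows of the truth table, of the
     negation of each row where [op] is false. This uses five levels, at most [C]. *)
  assert (Hbool : forall op : bool -> bool -> bool, forall a b : formula,
    D c (j + C * (depth a + 2)) (fun v => fsb n (fun _ => Y v) a = true) ->
    D c (j + C * (depth b + 2)) (fun v => fsb n (fun _ => Y v) b = true) ->
    D c (j + C * (S (Nat.max (depth a) (depth b)) + 2))
      (fun v => op (fsb n (fun _ => Y v) a) (fsb n (fun _ => Y v) b) = true)).
  { clear a. intros op a b Ha Hb. set (i := j + C * (Nat.max (depth a) (depth b) + 2)).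
    assert (Ha' : D c i (fun v => fsb n (fun _ => Y v) a = true)) by (eapply D_le; [|exact Ha]; unfold i; nia).
    assert (Hb' : D c i (fun v => fsb n (fun _ => Y v) b = true)) by (eapply D_le; [|exact Hb]; unfold i; nia).
    clear Ha Hb.
    set (A := fun v => fsb n (fun _ => Y v) a). set (B := fun v => fsb n (fun _ => Y v) b).
    change (D c i (fun v => A v = true)) in Ha'. change (D c i (fun v => B v = true)) in Hb'.
    change (D c (j + C * (S (Nat.max (depth a) (depth b)) + 2)) (fun v => op (A v) (B v) = true)).
    clearbody A B.
    assert (Up : forall k R, D c i R -> D c (i + k) R) by (intros k R H; eapply D_le; [|exact H]; lia).
    assert (Hlit : forall x y : bool, D c (i + 2) (fun v => A v = x /\ B v = y)).
    { assert (Hx : forall (Z : (nat -> nat) -> bool) (x : bool), D c i (fun v => Z v = true) -> D c (i + 1) (fun v => Z v = x)).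
      { intros Z x H. destruct x; [now apply Up|]. eapply D_iff; [|exact (Hnot _ _ H)].
        intros v _. cbv beta. destruct (Z v); intuition congruence. }
      intros x y. replace (i + 2) with (i + 1 + 1) by lia. apply Hand; now apply Hx. }
    assert (Hno : forall x y : bool, D c (i + 3) (fun v => ~ (op x y = false /\ A v = x /\ B v = y))).
    { intros x y. destruct (op x y) eqn:E.
      - eapply D_iff; [|apply (D_le c (i + 3)); [reflexivity|]].
        2:{ replace (i + 3) with (i + 2 + 1) by lia. apply Hnot.
            assert (Hf : D c (i + 2) (fun v => A v = true /\ A v = false)).
            { replace (i + 2) with (i + 1 + 1) by lia. apply Hand; [now apply Up|].
              eapply D_iff; [|exact (Hnot _ _ Ha')]. intros v _. cbv beta. destruct (A v); intuition congruence. }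
            exact Hf. }
        intros v _. cbv beta. split; [intros _ [H _]; easy|intros _ [H1 H2]; congruence].
      - eapply D_iff; [|replace (i + 3) with (i + 2 + 1) by lia; apply Hnot; exact (Hlit x y)].
        intros v _. cbv beta. tauto. }
    eapply D_le; [|eapply D_iff; [|apply (Hand (i + 3 + 1)); apply (Hand (i + 3));
      [apply (Hno true true)|apply (Hno true false)|apply (Hno false true)|apply (Hno false false)]]].
    - unfold i. nia.
    - intros v _. cbv beta. clear.
      destruct (A v), (B v), (op true true), (op true false), (op false true), (op false false); intuition congruence. }
  induction a; cbn [propositional depth fsb]; intros Hp; try easy.
  - set (h := Nat.max (term_depth t) (term_depth u)).
    eapply D_le; [|eapply D_iff; [|apply (Heq c (j + C * (h + 1))
      (fun v => neval n (fun _ => Y v) t) (fun v => neval n (fun _ => Y v) u))]].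
    + nia.
    + intros v _. cbv beta. now rewrite Nat.eqb_eq.
    + eapply ND_le; [|apply term_level]. nia.
    + eapply ND_le; [|apply term_level]. nia.
    + apply term_ltc.
    + apply term_ltc.
  - eapply D_le; [|eapply D_iff; [|exact (Hnot _ _ (IHa Hp))]].
    + nia.
    + intros v _. cbv beta. destruct (fsb n (fun _ => Y v) a); simpl; intuition congruence.
  - apply (Hbool andb); tauto.
  - apply (Hbool orb); tauto.
  - apply (Hbool implb); tauto.
  - apply (Hbool Bool.eqb); tauto.
Qed.
End Levels.

(** The word [q] describes the [n]-bit number [sum 2^g + q * sum 2^g] by the list of
    its digits in base [2 ^ com]: [2 g + 1] for [2^g] and [2 g + 2] for [q 2^g]. *)
Definition com (c : ctx) : nat := 2 ^ (cx c + 1).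
Definition cNE (c : ctx) : nat := 2 ^ (7 * cdel c).

Definition contrib (q e : nat) : nat :=
  if e =? 0 then 0 else 2 ^ ((e - 1) / 2) * (if e mod 2 =? 1 then 1 else q).

(** The share of one entry in the block [b]. A term [q * 2 ^ g] is charged entirely to the block of
    [g], which it may overflow; the carries take care of that. *)
Definition piece (B q e b : nat) : nat :=
  if e =? 0 then 0 else if b =? ((e - 1) / 2) / B then
    2 ^ (((e - 1) / 2) mod B) * (if e mod 2 =? 1 then 1 else q) else 0.

Definition Yq (c : ctx) (v : nat -> nat) : nat :=
  num (cB c) (2 * ca c) (fun b => if b <? 2 * ca c then
    sum (cNE c) (fun i => piece (cB c) (v 0 mod 2 ^ cB c) (dg (com c) (v 0) i) b) mod cQ c else 0)
  mod 2 ^ (cB c * cB c).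

Lemma com_eq c : com c = 32 * cdel c.
Proof. unfold com. rewrite Nat.add_1_r, Nat.pow_succ_r', c_d. lia. Qed.

Lemma piece_le c q e b : q < 2 ^ cB c -> piece (cB c) q e b < 2 ^ (2 * cB c).
Proof.
  intros Hq. unfold piece. destruct (e =? 0); [apply pow2_pos|]. destruct (b =? _); [|apply pow2_pos].
  replace (2 * cB c) with (cB c + cB c) by lia. rewrite Nat.pow_add_r.
  assert (H1 : 2 ^ (((e - 1) / 2) mod cB c) < 2 ^ cB c).
  { apply pow2_lt, Nat.mod_upper_bound. pose proof (B_pos c). lia. }
  pose proof (pow2_pos (cB c)). pose proof (pow2_pos (((e - 1) / 2) mod cB c)).
  destruct (e mod 2 =? 1); nia.
Qed.

Lemma Yq_level : exists C, forall c, ND c C (Yq c).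
Proof.
  assert (H : DefN ctx (fun c => c) (fun _ => 0) Yq).
  { apply defn_trunc.
    assert (Vr := gf_var ctx (fun c => c) (fun _ => 0)). assert (Vb := bd_var ctx (fun c => c)).
    (* environment: i, b, q *)
    set (E0 := fun c (u : nat -> nat) => dg (com c) (u 2) (u 0)).
    assert (Gcom : GF ctx (fun c => c) (fun _ => 0) (fun c _ => com c)).
    { apply (gf_pow2c ctx (fun c => c) (fun _ => 0) (fun c => cx c + 1)). intros c.
      pose proof (pow2_gt (cx c)). pose proof (c_d c). pose proof (c_del c). unfold lam.
      pose proof (pow2_gt (15 * cdel c + 7)). simpl (0 * _). rewrite Nat.add_0_r.
      replace (15 * cdel c + 8) with (1 + (15 * cdel c + 7)) by lia. rewrite Nat.pow_add_r. simpl (2 ^ 1). lia. }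
    assert (GE : GF ctx (fun c => c) (fun _ => 0) E0) by (apply gf_dg; auto).
    assert (BE : bd ctx (fun c => c) E0) by (apply bd_dg; auto).
    assert (G2 : GF ctx (fun c => c) (fun _ => 0) (fun _ _ => 2)).
    { exact (gf_add _ _ _ _ _ (gf_1 _ _ _) (gf_1 _ _ _)). }
    assert (GE1 : GF ctx (fun c => c) (fun _ => 0) (fun c u => (E0 c u - 1) / 2)).
    { apply gf_div; [apply gf_minus; auto using gf_1| |exact G2].
      intros c u Hu. specialize (BE c u Hu). cbv beta in *. lia. }
    assert (BE1 : bd ctx (fun c => c) (fun c u => (E0 c u - 1) / 2)).
    { intros c u Hu. specialize (BE c u Hu). pose proof (div_le (E0 c u - 1) 2). cbv beta in *. lia. }
    assert (Gq : GF ctx (fun c => c) (fun _ => 0) (fun c u => u 2 mod 2 ^ cB c)).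
    { apply gf_mod; auto. apply gf_2B. }
    assert (Hqlt : forall c x, x mod 2 ^ cB c < 2 ^ cB c) by (intros; apply Nat.mod_upper_bound, pow2_ne).
    set (pf := fun c (u : nat -> nat) => piece (cB c) (u 2 mod 2 ^ cB c) (E0 c u) (u 1)).
    assert (Gp : GF ctx (fun c => c) (fun _ => 0) pf).
    { apply gf_if; [apply df_eqb; auto using gf_0|apply gf_0|].
      apply gf_if; [|apply gf_mul|apply gf_0].
      - apply df_eqb; auto. apply gf_div; auto. apply gf_B.
      - apply gf_pow, gf_mod; auto. apply gf_B.
      - apply gf_if; [|apply gf_1|exact Gq]. apply df_eqb; [apply gf_mod; auto| |apply gf_1].
        intros c u Hu. apply Nat.le_lt_trans with (2 := BE c u Hu). apply Nat.Div0.mod_le. }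
    assert (Bp : bd ctx (fun c => c) pf).
    { intros c u _. apply small1. unfold pf.
      pose proof (piece_le c (u 2 mod 2 ^ cB c) (E0 c u) (u 1) (Hqlt c (u 2))).
      assert (2 ^ (2 * cB c) <= cB0 c); [|lia]. apply pow2_le. pose proof (Bs_a c). pose proof (s_ge c). nia. }
    assert (HNE : forall c, cNE c <= clim c) by (intros c; apply pow2_le; lia).
    assert (Gs := gf_sum ctx (fun c => c) (fun _ => 0) pf cNE
      (gf_cst ctx (fun c => c) (fun _ => 0) 7 ltac:(lia)) HNE Gp Bp).
    apply (defn_num ctx (fun c => c) (fun _ => 0)
      (fun c u => if u 0 <? 2 * ca c then sum (cNE c) (fun i => pf c (i .: u)) mod cQ c else 0)
      (fun c => 2 * ca c)).
    - apply gf_if; [apply df_ltb; auto; apply gf_2a|exact Gs|apply gf_0].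
    - intros c u _. destruct (u 0 <? 2 * ca c); [|apply pow2_pos].
      apply Nat.lt_trans with (cQ c); [apply (mod_Q_lt ctx (fun c => c))|apply Q_le].
    - reflexivity.
    - intros c i v _ Hi. cbn [scons]. destruct (Nat.ltb_spec i (2 * ca c)); [lia|reflexivity]. }
  destruct H as [C HC]. exists C. exact HC.
Qed.

(** The input to which a term refers is forgotten, since all inputs will be equal to [q]. *)
Definition entry (t : nat * option nat) : nat :=
  match snd t with None => 2 * fst t + 1 | Some _ => 2 * fst t + 2 end.

Definition qcode (c : ctx) (l : lin) : nat := num (com c) (length l) (fun i => nth i (map entry l) 0).

Lemma nth_map_lt {A : Type} (F : A -> nat) l d i : i < length l -> nth i (map F l) 0 = F (nth i l d).
Proof. intros Hi. rewrite (nth_indep _ 0 (F d)) by (now rewrite length_map). apply map_nth. Qed.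

Lemma list_sum_nth (l : list nat) : list_sum l = sum (length l) (fun i => nth i l 0).
Proof.
  induction l as [|a l IH] using rev_ind; [reflexivity|].
  rewrite list_sum_app, length_app, IH. simpl. rewrite Nat.add_1_r. simpl. f_equal.
  - apply sum_ext. intros i Hi. now rewrite app_nth1.
  - rewrite nth_middle. lia.
Qed.

Lemma contrib_entry q t : contrib q (entry t) = oval (fun _ => q) (snd t) * 2 ^ fst t.
Proof.
  assert (Hc : forall e, e <> 0 -> contrib q e = (if e mod 2 =? 1 then 1 else q) * 2 ^ ((e - 1) / 2)).
  { intros e He. unfold contrib. destruct (Nat.eqb_spec e 0); [easy|apply Nat.mul_comm]. }
  unfold entry. destruct t as [g [k|]]; cbn [fst snd]; rewrite Hc by lia.
  - replace (2 * g + 2 - 1) with (1 + g * 2) by lia. rewrite Nat.div_add by lia.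
    replace (2 * g + 2) with (0 + (g + 1) * 2) by lia. rewrite Nat.Div0.mod_add. reflexivity.
  - replace (2 * g + 1 - 1) with (g * 2) by lia. rewrite Nat.div_mul by lia.
    replace (2 * g + 1) with (1 + g * 2) by lia. rewrite Nat.Div0.mod_add. reflexivity.
Qed.

Lemma piece_sum B q e T : 1 <= B -> ((e - 1) / 2) / B < T ->
  sum T (fun b => piece B q e b * 2 ^ (B * b)) = contrib q e.
Proof.
  intros HB HT. unfold piece, contrib. destruct (e =? 0); [now apply sum_0|].
  rewrite (sum_single _ _ (((e - 1) / 2) / B) HT).
  - rewrite Nat.eqb_refl. rewrite (Nat.div_mod ((e - 1) / 2) B) at 3 by lia. rewrite Nat.pow_add_r. ring.
  - intros b _ Hb. destruct (Nat.eqb_spec b ((e - 1) / 2 / B)); [easy|reflexivity].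
Qed.

Lemma entry_bounds c l i : (forall t, In t l -> fst t < cB c * cB c) -> i < length l ->
  nth i (map entry l) 0 < 2 ^ com c /\ (nth i (map entry l) 0 - 1) / 2 < cB c * cB c.
Proof.
  intros Hg Hi. pose proof (c_del c) as Hdel. assert (Hin : In (nth i l (0, None)) l) by now apply nth_In.
  rewrite (nth_map_lt _ _ (0, None)) by exact Hi.
  set (t := nth i l (0, None)) in *. specialize (Hg t Hin).
  assert (H1 : entry t <= 2 * fst t + 2) by (unfold entry; destruct (snd t); lia).
  split.
  - apply Nat.lt_le_trans with (2 ^ (16 * cdel c + 2)); [|apply pow2_le; rewrite com_eq; lia].
    rewrite n_eq in Hg. rewrite Nat.pow_add_r. simpl (2 ^ 2). lia.
  - apply Nat.le_lt_trans with (2 := Hg). apply Nat.lt_succ_r. apply Nat.Div0.div_lt_upper_bound. lia.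
Qed.

Lemma qcode_lt c l : length l <= cNE c -> (forall t, In t l -> fst t < cB c * cB c) ->
  qcode c l < 2 ^ cB c.
Proof.
  intros Hlen Hg. pose proof (c_del c) as Hdel. apply Nat.lt_le_trans with (2 ^ (com c * length l)).
  - apply num_lt. intros i Hi. now apply entry_bounds.
  - apply pow2_le. apply Nat.le_trans with (com c * cNE c); [now apply Nat.mul_le_mono_l|].
    rewrite com_eq. unfold cNE, cB. replace (8 * cdel c) with (cdel c + 7 * cdel c) by lia.
    rewrite Nat.pow_add_r. apply Nat.mul_le_mono_r.
    assert (Hgen : forall k, 32 * (8 + k) <= 2 ^ (8 + k)).
    { induction k as [|k IH]; [simpl; lia|]. replace (8 + S k) with (S (8 + k)) by lia.
      rewrite (Nat.pow_succ_r' 2 (8 + k)). lia. }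
    specialize (Hgen (cdel c - 8)). replace (8 + (cdel c - 8)) with (cdel c) in Hgen by lia. exact Hgen.
Qed.

(** Exchanging the sums over blocks and entries gives back the linear form. The block sums are below
    [cQ] and the list is followed by zeros, which contribute nothing, so no reduction changes the
    result. *)
Lemma Yq_code c l v : length l <= cNE c -> (forall t, In t l -> fst t < cB c * cB c) ->
  v 0 = qcode c l -> ev (fun _ => qcode c l) l < 2 ^ (cB c * cB c) ->
  Yq c v = ev (fun _ => qcode c l) l.
Proof.
  intros Hlen Hg Hv Hev. pose proof (qcode_lt c l Hlen Hg) as Hq. set (q := qcode c l) in *.
  pose proof (c_del c) as Hdel. pose proof (B_pos c) as HB1.
  pose proof (fun i => entry_bounds c l i Hg) as Hent.
  assert (Hdg : forall i, dg (com c) q i = nth i (map entry l) 0).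
  { intros i. destruct (Nat.lt_ge_cases i (length l)) as [Hi|Hi].
    - unfold q, qcode. apply (dg_num (com c) (length l) (fun i => nth i (map entry l) 0)); [|exact Hi].
      intros k Hk. now apply Hent.
    - rewrite nth_overflow by (rewrite length_map; lia).
      apply dg_ge with (length l); [|assumption]. apply num_lt. intros k Hk. now apply Hent. }
  assert (Hnil : forall i b, length l <= i -> piece (cB c) q (nth i (map entry l) 0) b = 0).
  { intros i b Hi. rewrite nth_overflow by (rewrite length_map; lia). reflexivity. }
  assert (Hsum : forall b, sum (cNE c) (fun i => piece (cB c) (v 0 mod 2 ^ cB c) (dg (com c) (v 0) i) b) =
    sum (length l) (fun i => piece (cB c) q (nth i (map entry l) 0) b)).
  { intros b. rewrite Hv, Nat.mod_small by exact Hq.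
    replace (cNE c) with (length l + (cNE c - length l)) by lia. rewrite sum_split.
    rewrite (sum_0 (cNE c - length l)).
    - rewrite Nat.add_0_r. apply sum_ext. intros i _. now rewrite Hdg.
    - intros i _. rewrite Hdg. apply Hnil. lia. }
  assert (Hsmall : forall b, sum (length l) (fun i => piece (cB c) q (nth i (map entry l) 0) b) < cQ c).
  { intros b. apply Nat.le_lt_trans with (sum (length l) (fun _ => 2 ^ (2 * cB c))).
    - apply sum_le. intros i _. apply Nat.lt_le_incl, piece_le, Hq.
    - rewrite sum_const. unfold cQ. apply Nat.lt_lt_add_r.
      apply Nat.le_lt_trans with (2 ^ (7 * cdel c + 2 * cB c)).
      + rewrite Nat.pow_add_r. now apply Nat.mul_le_mono_r.
      + apply pow2_lt. pose proof (B_ge_del c). pose proof (Bs_a c). pose proof (s_ge c). nia. }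
  unfold Yq.
  assert (HBa : cB c <= 2 * ca c) by (pose proof (Bs_a c); pose proof (s_ge c); nia).
  transitivity (sum (2 * ca c) (fun b => sum (length l) (fun i => piece (cB c) q (nth i (map entry l) 0) b * 2 ^ (cB c * b))) mod 2 ^ (cB c * cB c)).
  - f_equal. unfold num. apply sum_ext. intros b Hb. destruct (Nat.ltb_spec b (2 * ca c)); [|lia].
    rewrite Hsum, Nat.mod_small by apply Hsmall. symmetry. apply sum_mul_r.
  - rewrite sum_swap.
    assert (E : sum (length l) (fun i => sum (2 * ca c) (fun b => piece (cB c) q (nth i (map entry l) 0) b * 2 ^ (cB c * b)))
       = ev (fun _ => q) l).
    { unfold ev. rewrite list_sum_nth, length_map. apply sum_ext. intros i Hi.
      rewrite piece_sum; [|assumption|].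
      - rewrite !(nth_map_lt _ _ (0, None)) by exact Hi. apply contrib_entry.
      - apply Nat.lt_le_trans with (cB c); [|exact HBa].
        apply Nat.Div0.div_lt_upper_bound. now apply Hent. }
    rewrite E. now apply Nat.mod_small.
Qed.

(** The failure of [P] at the number described by the input has some level linear in [cx], so it is
    the solvability of a system that can be coded in the top structure. If the input describes the
    code of this system, solvability at it means [psi] and also the failure of [P]. *)
Lemma diagonal : exists C, forall c, C * (cx c + 4) <= cJ c -> False.
Proof.
  destruct uniform_level as (C & HC8 & Hbin & Hun & Hcst & Heq).
  destruct Yq_level as [C' HY]. exists (C + C').
  intros c HJ.
  pose proof (c_d c) as Hd. pose proof (c_top c) as Htop. pose proof (c_u c) as Hu.
  pose proof (c_lam c) as Hlam. pose proof (c_w c) as Hw. pose proof (c_del c) as Hdel.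
  destruct (c_P c (16 * cdel c)) as (HP & Hk & HH); [lia|].
  assert (LY : ltc c (Yq c)).
  { intros v _. unfold Yq. apply Nat.mod_upper_bound, pow2_ne. }
  set (P := cP c (16 * cdel c)) in *.
  pose proof (formula_level C HC8 Hbin Hun Hcst Heq c C' (Yq c) (HY c) LY P HP) as HF.
  apply D_not in HF. set (j := S (C' + C * (depth P + 2))) in *.
  assert (Hj : j <= cJ c) by (unfold j; nia).
  destruct (HF Hj) as (s & Hwf & Hs & HR).
  assert (Hjw : (j + 1) * cw c <= (cJ c + 2) * cw c) by (apply Nat.mul_le_mono_r; lia).
  assert (Hju : j * cu c <= cJ c * cu c) by (apply Nat.mul_le_mono_r; lia).
  assert (Hlj : lam c j = 15 * cdel c + 8 + j * cu c) by reflexivity.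
  set (K := 2 ^ ((j + 1) * cw c)) in *. set (L := 2 ^ lam c j) in *.
  assert (HKL : K <= L) by (apply pow2_le; lia).
  assert (Hbig : 4000 * L * (K * K * K) <= 2 ^ (16 * cdel c)).
  { assert (4000 <= 2 ^ 12) by (simpl; lia).
    apply Nat.le_trans with (2 ^ 12 * L * (K * K * K)); [apply Nat.mul_le_mono_r, Nat.mul_le_mono_r; assumption|].
    unfold K, L. rewrite <- !Nat.pow_add_r. apply pow2_le. lia. }
  destruct (encode (cy c) s L K (16 * cdel c) Hwf Hs (pow2_pos _) HKL Hbig) as (l & Hl & Hg & Henc).
  (* [q] depends on the form [l] only, so there is no circularity: the code is [l] evaluated with
     all inputs equal to [q]. *)
  set (q := qcode c l). set (v := fun _ : nat => q).
  assert (HmL : cm c <= L) by (pose proof (cm_le c j); unfold L; lia).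
  assert (Hlen : length l <= cNE c).
  { apply Nat.le_trans with (1 := Hl). apply Nat.le_trans with (2 ^ 5 * K); [simpl (2 ^ 5); lia|].
    unfold K, cNE. rewrite <- Nat.pow_add_r. apply pow2_le. lia. }
  assert (Hg' : forall t, In t l -> fst t < cB c * cB c) by (intros t Ht; rewrite n_eq; auto).
  pose proof (qcode_lt c l Hlen Hg') as Hq. fold q in Hq.
  assert (Hv : bounded (cm c) v).
  { intros i. unfold v. apply small1.
    assert (2 ^ cB c <= cB0 c); [|lia]. apply pow2_le. pose proof (Bs_a c). pose proof (s_ge c). nia. }
  assert (HvL : forall i, v i < 2 ^ L).
  { intros i. apply Nat.lt_le_trans with (1 := Hv i). now apply pow2_le. }
  destruct (Henc v HvL) as [Hlt Hpsi].
  assert (HYq : Yq c v = ev v l).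
  { apply Yq_code; [assumption|assumption|reflexivity|]. rewrite n_eq. exact Hlt. }
  specialize (HR v Hv). specialize (HH _ Hlt). rewrite HYq, n_eq in HR.
  destruct (fsb (2 ^ (16 * cdel c)) (fun _ => ev v l) P); intuition congruence.
Qed.

(** * Choice of the parameters *)

Lemma log2R_pow x d : d <= 2 ^ x -> 1 <= d -> (log2R (INR d) <= INR x)%R.
Proof.
  intros H Hd. unfold log2R.
  assert (H2 : (0 < ln 2)%R) by (rewrite <- ln_1; apply ln_increasing; lra).
  assert (H3 : (INR d <= 2 ^ x)%R).
  { apply le_INR in H. rewrite pow_INR in H. simpl (INR 2) in H.
    replace (1 + 1)%R with 2%R in H by ring. exact H. }
  assert (H4 : (ln (INR d) <= INR x * ln 2)%R).
  { rewrite <- ln_pow by lra. destruct H3 as [H3|H3].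
    - apply Rlt_le, ln_increasing; [apply lt_0_INR; lia|exact H3].
    - rewrite H3. apply Rle_refl. }
  apply Rmult_le_reg_r with (1 := H2). unfold Rdiv. rewrite Rmult_assoc, Rinv_l by lra. lra.
Qed.

(** The root of the logarithm is at most the root of [x], which for a natural number [x] is at most
    [x]. *)
Lemma depth_le k x d : d <= 2 ^ x -> 1 <= d -> (INR k < sqrt (log2R (INR d)))%R -> k <= x.
Proof.
  intros H Hd Hk. apply INR_le.
  apply Rle_trans with (sqrt (INR x)).
  - apply Rlt_le, Rlt_le_trans with (1 := Hk). apply sqrt_le_1_alt. now apply log2R_pow.
  - destruct x as [|x]; [simpl; rewrite sqrt_0; lra|].
    assert (1 <= INR (S x))%R by (rewrite S_INR; pose proof (pos_INR x); lra).
    apply Rsqr_incr_0_var; [|lra]. rewrite Rsqr_sqrt by lra. unfold Rsqr. nra.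
Qed.

Lemma cube_scale a b D u : a * (b * (D * D) * (4 * u * (4 * u) * (4 * u))) = b * (a * 64) * (D * D) * (u * u * u).
Proof. ring. Qed.

Lemma pow2_dominates D m : 78 * (256 * 64) * (D * D) <= 2 ^ (21 + 2 * D + m).
Proof.
  assert (HD : D <= 2 ^ D) by (apply Nat.lt_le_incl, Nat.pow_gt_lin_r; lia).
  replace (21 + 2 * D + m) with (7 + (8 + 6) + (D + D) + m) by lia. rewrite !Nat.pow_add_r.
  rewrite <- (Nat.mul_1_r (_ * _ * _)).
  apply Nat.mul_le_mono; [|pose proof (Nat.pow_nonzero 2 m); lia].
  apply Nat.mul_le_mono; [|now apply Nat.mul_le_mono].
  apply Nat.mul_le_mono; [apply Nat.leb_le; reflexivity|].
  apply Nat.mul_le_mono; apply Nat.leb_le; reflexivity.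
Qed.

Lemma cubic_bound C D Z : C + 2 = D -> 16 <= Z ->
  8 + (C * Z + 2) * (3 * ((C * Z + 2) * (2 * (Z - 4) + 40)) + 40) <= 78 * (D * D) * (Z * Z * Z).
Proof.
  intros HCD HZ.
  assert (HJ : C * Z + 2 <= D * Z) by (rewrite <- HCD; lia).
  assert (Hw : 2 * (Z - 4) + 40 <= 10 * Z) by lia.
  assert (H1 : (C * Z + 2) * (2 * (Z - 4) + 40) <= D * Z * (10 * Z)) by now apply Nat.mul_le_mono.
  apply Nat.le_trans with (8 + D * Z * (3 * (D * Z * (10 * Z)) + 40)).
  { apply Nat.add_le_mono_l, Nat.mul_le_mono; [assumption|]. lia. }
  replace (D * Z * (3 * (D * Z * (10 * Z)) + 40)) with (30 * (D * Z * (D * Z * Z)) + 40 * (D * Z)) by ring.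
  replace (78 * (D * D) * (Z * Z * Z)) with (78 * (D * Z * (D * Z * Z))) by ring.
  assert (H1D : 1 <= D) by lia. assert (H1Z : 1 <= Z) by lia.
  pose proof (Nat.mul_le_mono 1 D 1 Z H1D H1Z) as HDZ.
  pose proof (Nat.mul_le_mono 1 (D * Z) 1 Z HDZ H1Z) as HDZZ.
  pose proof (Nat.mul_le_mono_l _ _ (D * Z) HDZZ) as HDZ3.
  rewrite Nat.mul_1_r in HDZ3. lia.
Qed.

(** The total growth is a cubic polynomial in [x]: [O(x)] levels, each with a step of [O(x ^ 2)]. It
    must fit into [2 ^ (x - 4)], a sixteenth of [2 ^ x]. *)
Lemma size_choice C m : exists x, 8 <= 2 ^ (x - 4) /\ 4 <= x /\ m <= 2 ^ (x - 4) /\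
  8 + (C * (x + 4) + 2) * (3 * ((C * (x + 4) + 2) * (2 * x + 40)) + 40) <= 2 ^ (x - 4).
Proof.
  pose proof (pow2_dominates (C + 2) m) as HD.
  assert (exists u, 21 + 2 * (C + 2) + m = u) as [u Hu] by eauto. rewrite Hu in HD.
  (* Then [2 ^ (x - 4)] is the fourth power of [2 ^ u] divided by 256: three factors dominate the
     cube of [u], the fourth one all constants and [m]. *)
  exists (4 * u - 4).
  assert (HU : u <= 2 ^ u) by (apply Nat.lt_le_incl, Nat.pow_gt_lin_r; lia).
  replace (4 * u - 4 + 4) with (4 * u) by lia. replace (4 * u - 4 - 4) with (4 * u - 8) by lia.
  assert (HT : 4 * u - 8 <= 2 ^ (4 * u - 8)) by (apply Nat.lt_le_incl, Nat.pow_gt_lin_r; lia).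
  assert (H256 : 256 * 2 ^ (4 * u - 8) = 2 ^ u * (2 ^ u * 2 ^ u * 2 ^ u)).
  { change 256 with (2 ^ 8). rewrite <- !Nat.pow_add_r. f_equal. lia. }
  generalize dependent (2 ^ (4 * u - 8)). generalize dependent (2 ^ u). intros U HD HU T HT H256.
  split; [lia|]. split; [lia|]. split; [lia|].
  apply Nat.le_trans with (1 := cubic_bound C (C + 2) (4 * u) eq_refl ltac:(lia)).
  apply (Nat.mul_le_mono_pos_l _ _ 256); [lia|]. rewrite H256, cube_scale.
  apply Nat.mul_le_mono; [assumption|].
  apply Nat.mul_le_mono; [apply Nat.mul_le_mono|]; assumption.
Qed.

Theorem theorem4 (y : variable) :
  exists (eps : R) (psi : formula),
    (0 < eps)%R /\
    single_existential psi /\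
    only_free y psi /\
    forall P : nat -> formula,
      (forall d : nat, propositional (P d) /\ only_free y (P d)) ->
      (forall d : nat, models (M d) (All y (Iff psi (P d)))) ->
      forall m : nat, exists d : nat,
        m <= d /\ (INR (depth (P d)) >= eps * sqrt (log2R (INR d)))%R.
Proof.
  exists 1%R, (psi y). split; [lra|]. split; [apply psi_single|]. split; [apply psi_only_free|].
  intros P HP HM m. apply Classical_Prop.NNPP. intros Hno.
  assert (Hlt : forall d, m <= d -> (INR (depth (P d)) < sqrt (log2R (INR d)))%R).
  { intros d Hd. apply Rnot_le_lt. intros Hle. apply Hno. exists d. split; [exact Hd|]. lra. }
  destruct diagonal as [C HC]. destruct (size_choice C m) as (x & H8 & Hx & Hm & Hsz).
  set (del := 2 ^ (x - 4)) in *. set (J := C * (x + 4)) in *. set (w := 2 * x + 40) in *.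
  set (u := 3 * ((J + 2) * w) + 40) in *.
  assert (Hd : 2 ^ x = 16 * del).
  { unfold del. change 16 with (2 ^ 4). rewrite <- Nat.pow_add_r. f_equal. lia. }
  assert (Hlam : (J + 2) * w + 8 <= del) by (unfold u in *; nia).
  assert (HPd : forall d, 15 * del <= d <= 16 * del ->
    propositional (P d) /\ depth (P d) <= x /\
    forall Y, Y < 2 ^ 2 ^ d -> (psin y (2 ^ d) Y <-> fsb (2 ^ d) (fun _ => Y) (P d) = true)).
  { intros d Hdd. split; [apply HP|]. split.
    - apply depth_le with d; [lia|lia|]. apply Hlt. lia.
    - intros Y HY. set (v := exist _ Y HY : M d).
      (* Under the constant assignment [v] every variable has the value [Y], whichever variables
         occur in [P d]. *)
      pose proof (HM d (fun _ => v) v) as Hs. cbn [sat] in Hs.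
      assert (Hc : forall z, update (fun _ : variable => v) y v z = v).
      { intros z. unfold update. destruct (Nat.eqb z y); reflexivity. }
      rewrite (sat_psi d _ y v Hc), (sat_fsb d _ _ (proj1 (HP d))) in Hs.
      rewrite (fsb_ext (2 ^ d) _ (fun _ => Y)) in Hs; [exact Hs|].
      intros z. now rewrite Hc. }
  assert (Htop : 15 * del + 8 + (J + 2) * u <= 16 * del) by lia.
  exact (HC (Ctx y P x del J w u Hd H8 (le_n _) (le_n _) Hlam Htop HPd) (le_n _)).
Qed.
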